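(* Let $p$ be an odd prime, $n$ a positive integer, let $E_0^{i,j}=\mathrm{Hom}_{C_p}(W_i,D(n,0)^j)$, and let $E_*^{*,*}$ be the corresponding type I spectral sequence. If $p$ does not divide $n$, then $$E_2^{i,j}=\begin{cases}(\mathbb Z/n)^{\oplus g(-j)}&\text{for }i=0,\\0&\text{for }i>0,\end{cases}$$ and the spectral sequence collapses and gives rise to no extension problems. If $p$ divides $n$, the $E_2$-page is $$E_2^{i,j}=\begin{cases}(\mathbb Z/n)^{\oplus g(-j)}\oplus\mathbb Z/p&\text{for }i=0,\ j\text{ odd},\ 0>j>1-p,\\(\mathbb Z/n)^{\oplus g(-j)}&\text{for }i=0\text{ and }(j\text{ even or }j\ge0\text{ or }j\le1-p),\\\mathbb Z/p&\text{for }i>0,\ 0\ge j\ge1-p,\\0&\text{otherwise.}\end{cases}$$ In this case the spectral sequence collapses at $E_3$, and $$E_3^{i,j}=\begin{cases}(\mathbb Z/n)^{\oplus g(-j)}&\text{if }i=0,\\\mathbb Z/p&\text{if either }j=0,\ i>0\text{ and }i\text{ even},\\&\quad\text{or }j=1-p\text{ and }i\text{ odd},\\&\quad\text{or }i=1\text{ and }j=-1,-3,\dots,2-p,\\0&\text{otherwise.}\end{cases}$$ The only non-trivial extensions in reassembling $H^*\mathrm{Tot}\,E_0^{*,*}$ from $E_\infty^{*,*}$ are that the extension with kernel $E_3^{1,-j}$ and quotient $E_3^{0,1-j}$ is non-split for $j=1,3,\dots,p-2$.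
   Context: $g(j)=\frac1p\left((p-1)(-1)^j+\binom{p-1}{j}\right)$ for $0\le j\le p-1$ and $g(j)=0$ otherwise. $W_*$ is the integral cellular chain complex of a contractible $C_p$-free $C_p$-CW-complex (so a free resolution of $\mathbb Z$ over $\mathbb ZC_p$), and $\mathrm{Hom}_{C_p}=\mathrm{Hom}_{\mathbb ZC_p}$. $C(n,0)^*$ is the cochain complex with $C(n,0)^{-1}=C(n,0)^0=\mathbb Z$, all other groups zero, and differential multiplication by $n$. $D(n,0)^*=(C(n,0)^* )^{\otimes p}$ is the complex of $\mathbb ZC_p$-modules where $C_p$ acts by cyclically permuting the tensor factors with the Koszul sign (interchanging adjacent homogeneous factors $c,c'$ introduces $(-1)^{\deg c\deg c'}$). The differentials of the double complex are $d:E_0^{i,j}\to E_0^{i+1,j}$ (from $W_*$) and $d':E_0^{i,j}\to E_0^{i,j+1}$ (from $D(n,0)^*$); the type I spectral sequence is the one with $d_0=d'$, so $d_r:E_r^{i,j}\to E_r^{i+r,j-r+1}$ and $E_2^{i,j}=H^i(C_p;H^j(D(n,0)^* ))$. $\mathrm{Tot}$ denotes the total complex. *)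

(* Defs.v *)
From HB Require Import structures.
From mathcomp Require Import all_boot all_order all_algebra.
From mathcomp Require Import boolp classical_sets functions.
From mathcomp Require Import zify ring.
Set Implicit Arguments.
Unset Strict Implicit.
Unset Printing Implicit Defensive.
Import Order.TTheory GRing.Theory Num.Theory.
Local Open Scope ring_scope.

(* A module over Z[C_p] = Z[t]/(t^p - 1) is an abelian group with an
   endomorphism t such that t^p = 1; Z[C_p]-linear maps are the additive maps
   commuting with t. *)

Record cpmod (p : nat) := CpMod {
  cpsort :> zmodType;
  cpgen : {additive cpsort -> cpsort};
  cpgenX : forall x, iter p cpgen x = x }.
Arguments cpgen {p} M : rename.

Section CpHom.
Variables (p : nat) (V U : cpmod p).

Definition cplinear : {pred V -> U} :=
  [pred f | `[< (forall x y, f (x - y) = f x - f y) /\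
                (forall x, f (cpgen V x) = cpgen U (f x)) >]].

Record cphom := CpHom { cphom_fun :> V -> U; cphomP : cphom_fun \in cplinear }.

HB.instance Definition _ := [isSub for cphom_fun].
HB.instance Definition _ := [Choice of cphom by <:].

Lemma cplinear_zmod_closed : zmod_closed cplinear.
Proof.
split=> [|f g].
  by apply/asboolP; split=> [x y|x]; rewrite /GRing.zero/= ?subr0 ?raddf0.
move=> /asboolP[fB fE] /asboolP[gB gE]; apply/asboolP; split=> [x y|x].
  by rewrite !fctE fB gB !opprD !opprK addrACA.
by rewrite !fctE fE gE raddfB.
Qed.
HB.instance Definition _ := GRing.isZmodClosed.Build _ _ cplinear_zmod_closed.
HB.instance Definition _ := [SubChoice_isSubZmodule of cphom by <:].

Lemma cphomB (f : cphom) x y : f (x - y) = f x - f y.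
Proof. by have /asboolP[] := cphomP f. Qed.
Lemma cphomE (f : cphom) x : f (cpgen V x) = cpgen U (f x).
Proof. by have /asboolP[] := cphomP f. Qed.
HB.instance Definition _ (f : cphom) :=
  GRing.isZmodMorphism.Build V U f (cphomB f).

End CpHom.

Lemma cpcomp_linear p (V U X : cpmod p) (g : cphom U X) (f : cphom V U) :
  g \o f \in @cplinear p V X.
Proof.
by apply/asboolP; split=> [x y|x] /=; rewrite ?cphomB // !cphomE.
Qed.
Definition cpcomp p (V U X : cpmod p) (g : cphom U X) (f : cphom V U) :=
  CpHom (cpcomp_linear g f).

Lemma iter_idfun p (x : int) : iter p (idfun : int -> int) x = x.
Proof. by elim: p. Qed.
Definition trivZ (p : nat) : cpmod p := @CpMod p int idfun (@iter_idfun p).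

(* (t^k b_i), for i : I and k < p, is a basis of the underlying abelian group,
   i.e. (b_i) is a (possibly infinite) Z[C_p]-basis. *)
Definition cpfree p (M : cpmod p) : Prop :=
  exists (I : eqType) (b : I -> M),
    (forall x, exists (s : seq I) (c : I -> 'I_p -> int),
       uniq s /\ x = \sum_(i <- s) \sum_(k < p) iter k (cpgen M) (b i) *~ c i k)
    /\ (forall (s : seq I) (c : I -> 'I_p -> int), uniq s ->
       \sum_(i <- s) \sum_(k < p) iter k (cpgen M) (b i) *~ c i k = 0 ->
       forall i k, i \in s -> c i k = 0).

(* Cellular chain complexes of contractible free C_p-CW-complexes are of this
   form; the modules may have infinite rank. *)
Record cpresolution (p : nat) := CpResolution {
  res :> nat -> cpmod p;
  resd : forall i, cphom (res i.+1) (res i);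
  resaug : cphom (res 0%N) (trivZ p);
  res_free : forall i, cpfree (res i);
  resaug_surj : forall z : int, exists x, resaug x = z;
  res_exact0 : forall x, resaug x = 0 <-> exists y, resd 0%N y = x;
  res_exact : forall i x, resd i x = 0 <-> exists y, resd i.+1 y = x }.

(* The coboundary is indexed by its target degree, so that no transport along
   (j - 1) + 1 = j is needed. *)
Record cpcomplex (p : nat) := CpComplex {
  cx :> int -> cpmod p;
  cxd : forall j, cphom (cx (j - 1)) (cx j);
  cxdd : forall j x, cxd j (cxd (j - 1) x) = 0 }.

Record bicomplex := BiComplex {
  bc :> nat -> int -> zmodType;
  bch : forall i j, {additive bc i j -> bc i.+1 j};
  bcv : forall i j, {additive bc i (j - 1) -> bc i j};
  bchh : forall i j x, bch i.+1 j (bch i j x) = 0;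
  bcvv : forall i j x, bcv i j (bcv i (j - 1) x) = 0;
  bchv : forall i j x, bch i j (bcv i j x) = bcv i.+1 j (bch i (j - 1) x) }.
Arguments bch : clear implicits.
Arguments bcv : clear implicits.

Definition tot (E : bicomplex) := forall i j, E i j.

Section Tot.
Variable E : bicomplex.

HB.instance Definition _ := gen_eqMixin (tot E).
HB.instance Definition _ := gen_choiceMixin (tot E).

Definition tot0 : tot E := fun i j => 0.
Definition totN (x : tot E) : tot E := fun i j => - x i j.
Definition totD (x y : tot E) : tot E := fun i j => x i j + y i j.

Lemma tot_ext (x y : tot E) : (forall i j, x i j = y i j) -> x = y.
Proof.
by move=> e; apply: functional_extensionality_dep => i;
  apply: functional_extensionality_dep => j.
Qed.
Lemma totDA : associative totD.
Proof. by move=> x y z; apply: tot_ext => i j; apply: addrA. Qed.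
Lemma totDC : commutative totD.
Proof. by move=> x y; apply: tot_ext => i j; apply: addrC. Qed.
Lemma tot0D : left_id tot0 totD.
Proof. by move=> x; apply: tot_ext => i j; apply: add0r. Qed.
Lemma totND : left_inverse tot0 totN totD.
Proof. by move=> x; apply: tot_ext => i j; apply: addNr. Qed.
HB.instance Definition _ :=
  GRing.isZmodule.Build (tot E) totDA totDC tot0D totND.

(* The total differential d + (-1)^i d'. *)
Definition totd (x : tot E) : tot E := fun i j =>
  match i return E i j with
  | 0%N => 0
  | i'.+1 => bch E i' j (x i' j)
  end + bcv E i j (x i (j - 1)) *~ (-1) ^+ i.

Lemma totdB x y : totd (x - y) = totd x - totd y.
Proof.
apply: tot_ext => i j; rewrite /totd.
have e (u v : tot E) k l : (u - v) k l = u k l - v k l by [].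
rewrite [RHS]e e raddfB /= mulrzBl.
case: i => [|i]; first by rewrite !add0r.
by rewrite e raddfB /= opprD addrACA.
Qed.

Lemma totdd x : totd (totd x) = 0.
Proof.
apply: tot_ext => i j; rewrite /totd.
rewrite !raddfD /= !raddfMz /= bcvv mul0rz addr0.
case: i => [|i]; first by rewrite raddf0 mul0rz add0r.
rewrite raddfD /= raddfMz /= bchv.
have -> : bch E i j (match i return E i j with
    0%N => 0 | i'.+1 => bch E i' j (x i' j) end) = 0.
  by case: i => [|i]; rewrite ?raddf0 ?bchh.
by rewrite add0r exprS mulN1r mulrNz subrr.
Qed.

(* Tot^m, as the elements supported on i + j = m (when E_0^{i,j} = 0 outside
   of finitely many rows j, the direct sum and the direct product agree). *)
Definition tot_deg (m : int) (x : tot E) : Prop :=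
  forall i j, i%:Z + j != m -> x i j = 0.

Definition tot_fil (s : nat) (x : tot E) : Prop :=
  forall i j, (i < s)%N -> x i j = 0.

(* E_r^{i,j} = ss_Z r i (i + j) / ss_B r i (i + j), where
   ss_Z r i m = {x in F^i Tot^m | D x in F^{i+r} Tot^{m+1}},
   ss_B r i m = D (ss_Z (r-1) (i-r+1) (m-1)) + ss_Z (r-1) (i+1) m.
   Truncated subtraction is harmless since F^k = Tot for k <= 0. *)
Definition ss_Z (r i : nat) (m : int) (x : tot E) : Prop :=
  [/\ tot_deg m x, tot_fil i x & tot_fil (i + r) (totd x)].

Definition ss_B (r i : nat) (m : int) (x : tot E) : Prop :=
  exists y z,
    [/\ tot_deg (m - 1) y, tot_fil (i.+1 - r) y & tot_fil i (totd y)] /\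
    [/\ tot_deg m z, tot_fil i.+1 z & tot_fil (i + r) (totd z)] /\
    x = totd y + z.

(* The preimage of F^i H^m(Tot) in the cocycles of Tot^m. *)
Definition fil_H (i : nat) (m : int) (x : tot E) : Prop :=
  [/\ tot_deg m x, totd x = 0 &
      exists2 y, tot_deg (m - 1) y & tot_fil i (x - totd y)].

Definition cobound (m : int) (x : tot E) : Prop :=
  exists2 y, tot_deg (m - 1) y & x = totd y.

End Tot.

(* The subquotient N / B of A is isomorphic to M (for subgroups B <= N). *)
Definition subquo_iso (A : zmodType) (N B : A -> Prop) (M : zmodType) : Prop :=
  exists f : A -> M,
    [/\ forall x y, N x -> N y -> f (x - y) = f x - f y,
        forall u, exists2 x, N x & f x = u &
        forall x, N x -> (f x = 0 <-> B x)].

Definition page_iso (E : bicomplex) (r i : nat) (j : int) (M : zmodType) :=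
  subquo_iso (@ss_Z E r i (i%:Z + j)) (@ss_B E r i (i%:Z + j)) M.

(* d_r^{i,j} : E_r^{i,j} -> E_r^{i+r,j-r+1} is induced by the total
   differential. *)
Definition ss_d_eq0 (E : bicomplex) (r i : nat) (j : int) : Prop :=
  forall x, @ss_Z E r i (i%:Z + j) x ->
    @ss_B E r (i + r) (i%:Z + j + 1) (totd x).

(* The inclusion of the cocycles of F^i Tot^{i+j} in ss_Z r i (i + j) induces
   an isomorphism from E_oo^{i,j} = F^i H^{i+j} / F^{i+1} H^{i+j} to E_r^{i,j}. *)
Definition ss_abuts (E : bicomplex) (r i : nat) (j : int) : Prop :=
  let m := i%:Z + j in
  (forall x, @ss_Z E r i m x -> exists y,
     [/\ tot_deg m y, tot_fil i y, totd y = 0 & ss_B r i m (x - y)]) /\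
  (forall y : tot E, tot_deg m y -> tot_fil i y -> totd y = 0 ->
     (ss_B r i m y <-> fil_H i.+1 m y)).

Definition collapses_at (E : bicomplex) (r : nat) : Prop :=
  (forall s i j, (r <= s)%N -> ss_d_eq0 E s i j) /\
  (forall i j, ss_abuts E r i j).

(* For subgroups Q <= K <= G of A, the extension K/Q -> G/Q -> G/K is split:
   s represents a homomorphic section of G/Q -> G/K. *)
Definition ext_split (A : zmodType) (K G Q : A -> Prop) : Prop :=
  exists s : A -> A,
    [/\ forall x, G x -> G (s x),
        forall x y, G x -> G y -> Q (s (x - y) - (s x - s y)),
        forall x, K x -> Q (s x) &
        forall x, G x -> K (s x - x)].

(* The extension F^{i+1} H^m -> F^i H^m -> E_oo^{i,m-i} is split. *)
Definition step_split (E : bicomplex) (i : nat) (m : int) : Prop :=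
  ext_split (@fil_H E i.+1 m) (@fil_H E i m) (@cobound E m).

(* The extension E_oo^{1,m-1} -> H^m / F^2 H^m -> E_oo^{0,m} is split. *)
Definition low_split (E : bicomplex) (m : int) : Prop :=
  ext_split (@fil_H E 1 m) (@fil_H E 0 m) (@fil_H E 2 m).

Section HomBicomplex.
Variables (p : nat) (W : cpresolution p) (D : cpcomplex p).

Definition hom_h i j (f : cphom (W i) (D j)) : cphom (W i.+1) (D j) :=
  cpcomp f (resd W i).
Definition hom_v i j (f : cphom (W i) (D (j - 1))) : cphom (W i) (D j) :=
  cpcomp (cxd D j) f.

Lemma cphom_ext (V U : cpmod p) (f g : cphom V U) : f =1 g -> f = g.
Proof. by move=> e; apply: val_inj; apply: funext. Qed.

Lemma hom_hB i j : {morph @hom_h i j : x y / x - y}.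
Proof. by move=> f g; apply: cphom_ext. Qed.
Lemma hom_vB i j : {morph @hom_v i j : x y / x - y}.
Proof. by move=> f g; apply: cphom_ext => x /=; apply: cphomB. Qed.
HB.instance Definition _ i j :=
  GRing.isZmodMorphism.Build _ _ (@hom_h i j) (@hom_hB i j).
HB.instance Definition _ i j :=
  GRing.isZmodMorphism.Build _ _ (@hom_v i j) (@hom_vB i j).

Lemma hom_hh i j x : @hom_h i.+1 j (@hom_h i j x) = 0.
Proof.
apply: cphom_ext => w /=.
have /res_exact-> : exists y, resd W i.+1 y = resd W i.+1 w by exists w.
by rewrite raddf0.
Qed.
Lemma hom_vv i j x : @hom_v i j (@hom_v i (j - 1) x) = 0.
Proof. by apply: cphom_ext => w /=; apply: cxdd. Qed.
Lemma hom_hv i j x : @hom_h i j (@hom_v i j x) = @hom_v i.+1 j (@hom_h i (j - 1) x).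
Proof. exact: cphom_ext. Qed.

Definition hom_bicomplex : bicomplex :=
  @BiComplex (fun i j => cphom (W i) (D j)) (fun i j => @hom_h i j)
    (fun i j => @hom_v i j) hom_hh hom_vv hom_hv.

End HomBicomplex.

Record based_complex := BasedComplex {
  bas : finType;
  bdeg : bas -> int;
  bdif : bas -> bas -> int; (* bdif b c: coefficient of c in the coboundary of b *)
  bdif_deg : forall b c, bdif b c != 0 -> bdeg c = bdeg b + 1;
  bdifdif : forall a c, \sum_b bdif a b * bdif b c = 0 }.

Definition sgz1 (z : int) : int := (-1) ^+ `|z|%N.

Lemma sgz1D a b : sgz1 (a + b) = sgz1 a * sgz1 b.
Proof.
rewrite /sgz1 -signr_odd -[X in X * _]signr_odd -[X in _ * X]signr_odd.
rewrite -signr_addb; congr (_ ^+ nat_of_bool _); lia.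
Qed.
Lemma sgz1_sqr a : sgz1 a * sgz1 a = 1.
Proof. by rewrite /sgz1 -expr2 sqrr_sign. Qed.
Lemma sgz1_mm a : sgz1 (a * a) = sgz1 a.
Proof. by rewrite /sgz1 abszM -signr_odd oddM andbb signr_odd. Qed.
Lemma sgz1_sum (I : Type) (r : seq I) (P : pred I) (F : I -> int) :
  sgz1 (\sum_(i <- r | P i) F i) = \prod_(i <- r | P i) sgz1 (F i).
Proof. by apply: (big_morph sgz1 sgz1D). Qed.

Section TensorPower.
Variables (p : nat) (C : based_complex).

(* The word w stands for the basis element w_0 (x) ... (x) w_(p-1). *)
Definition word := {ffun 'I_p -> bas C}.
Definition wdeg (w : word) : int := \sum_i bdeg (w i).

Definition tens := {ffun word -> int}.

(* Cyclic permutation w_0 (x) ... (x) w_(p-1) |->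
   +/- w_(p-1) (x) w_0 (x) ... (x) w_(p-2): the last factor is moved past each
   of the preceding ones. *)
Definition rotw (w : word) : word := [ffun i => w (ord_pred i)].
Definition unrotw (w : word) : word := [ffun i => w (ordS i)].
Definition rot_exp (w : word) : int :=
  \sum_(i < p | i.+1 == p :> nat) \sum_(k < p | (k < i)%N)
    bdeg (w k) * bdeg (w i).
Definition tens_rot (x : tens) : tens :=
  [ffun w => sgz1 (rot_exp (unrotw w)) * x (unrotw w)].

(* Leibniz rule: the coboundary acts on the i-th factor with the sign
   (-1)^(deg w_0 + ... + deg w_(i-1)). *)
Definition wdif_at (w w' : word) (i : 'I_p) : int :=
  sgz1 (\sum_(k < p | (k < i)%N) bdeg (w k)) * bdif (w i) (w' i) *
  [forall k, (k != i) ==> (w k == w' k)]%:R.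
Definition wdif (w w' : word) : int := \sum_(i < p) wdif_at w w' i.
Definition tens_dif (x : tens) : tens := [ffun w' => \sum_w x w * wdif w w'].

Lemma rotwK : cancel rotw unrotw.
Proof. by move=> w; apply/ffunP=> i; rewrite !ffunE ordSK. Qed.
Lemma unrotwK : cancel unrotw rotw.
Proof. by move=> w; apply/ffunP=> i; rewrite !ffunE ord_predK. Qed.

Lemma tens_rotB : {morph tens_rot : x y / x - y}.
Proof. by move=> x y; apply/ffunP=> w; rewrite !ffunE mulrBr. Qed.
Lemma tens_difB : {morph tens_dif : x y / x - y}.
Proof.
move=> x y; apply/ffunP=> w; rewrite !ffunE -sumrB.
by apply: eq_bigr => u _; rewrite !ffunE mulrBl.
Qed.

Lemma wdeg_unrotw w : wdeg (unrotw w) = wdeg w.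
Proof.
rewrite /wdeg [RHS](reindex_inj (can_inj (@ordSK p))).
by apply: eq_bigr => i _; rewrite ffunE.
Qed.

Lemma rot_expE w : rot_exp w =
  \sum_(i < p | i.+1 == p :> nat) (wdeg w - bdeg (w i)) * bdeg (w i).
Proof.
apply: eq_bigr => i /eqP ip; rewrite -mulr_suml; congr (_ * _).
rewrite /wdeg [in RHS](bigD1 i) //= addrAC subrr add0r; apply: eq_bigl => k.
by rewrite -val_eqE /=; have := ltn_ord k; lia.
Qed.

Lemma val_iter_ordS k (i : 'I_p) : val (iter k (@ordS p) i) = ((i + k) %% p)%N.
Proof.
elim: k => [|k IH]; first by rewrite addn0 modn_small.
by rewrite iterS /= IH -addn1 modnDml addn1 addnS.
Qed.

Lemma iter_unrotw k w i : iter k unrotw w i = w (iter k (@ordS p) i).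
Proof. by elim: k i => [|k IH] i //; rewrite iterS ffunE IH -iterSr. Qed.

Lemma wdeg_iter k w : wdeg (iter k unrotw w) = wdeg w.
Proof. by elim: k => // k IH; rewrite iterS wdeg_unrotw. Qed.

Lemma iter_tens_rot k x w : iter k tens_rot x w =
  (\prod_(j < k) sgz1 (rot_exp (iter j.+1 unrotw w))) * x (iter k unrotw w).
Proof.
elim: k w => [|k IH] w; first by rewrite big_ord0 mul1r.
rewrite iterS ffunE IH big_ord_recl mulrA; congr (_ * _ * _); last first.
  by rewrite -iterSr.
by apply: eq_bigr => j _; rewrite -iterSr.
Qed.

Lemma tens_rotX x : iter p tens_rot x = x.
Proof.
apply/ffunP => w; rewrite iter_tens_rot.
have -> : iter p unrotw w = w.
  apply/ffunP => i; rewrite iter_unrotw; congr (w _); apply: val_inj.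
  by rewrite val_iter_ordS modnDr modn_small.
suff -> : \prod_(j < p) sgz1 (rot_exp (iter j.+1 unrotw w)) = 1 by rewrite mul1r.
have E (j : 'I_p) : rot_exp (iter j.+1 unrotw w) = (wdeg w - bdeg (w j)) * bdeg (w j).
  have p0 : (p.-1 < p)%N by have := ltn_ord j; lia.
  rewrite rot_expE (big_pred1 (Ordinal p0)); last first.
    move=> i; apply/eqP/eqP => [ip|->] /=; last by lia.
    by apply: val_inj => /=; lia.
  rewrite wdeg_iter iter_unrotw.
  suff -> : iter j.+1 (@ordS p) (Ordinal p0) = j by [].
  apply: val_inj; rewrite val_iter_ordS /=.
  have -> : (p.-1 + j.+1 = j + p)%N by have := ltn_ord j; lia.
  by rewrite modnDr modn_small.
rewrite (eq_bigr _ (fun j _ => congr1 sgz1 (E j))) -sgz1_sum.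
under eq_bigr do rewrite mulrBl.
rewrite sumrB -mulr_sumr -/(wdeg w) sgz1D sgz1_mm.
have -> : sgz1 (- \sum_j bdeg (w j) * bdeg (w j)) = sgz1 (wdeg w).
  rewrite /sgz1 abszN -!/(sgz1 _) /wdeg !sgz1_sum.
  by apply: eq_bigr => j _; apply: sgz1_mm.
exact: sgz1_sqr.
Qed.

Lemma wdif_at_deg u v i : wdif_at u v i != 0 ->
  [/\ bdeg (v i) = bdeg (u i) + 1,
      forall k, k != i -> u k = v k & wdeg v = wdeg u + 1].
Proof.
rewrite /wdif_at !mulf_eq0 !negb_or => /andP[/andP[_ d0]].
case: forallP => // a _.
have {}a k : k != i -> u k = v k by move=> /(implyP (a k))/eqP.
have e := bdif_deg d0; split=> //.
rewrite /wdeg (bigD1 i) //= e [in RHS](bigD1 i) //= addrAC.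
by congr (_ + _ + _); apply: eq_bigr => k /a->.
Qed.

Lemma wdif_deg u v : wdif u v != 0 -> wdeg v = wdeg u + 1.
Proof.
case: (boolP [exists i, wdif_at u v i != 0]).
  by case/existsP => i /wdif_at_deg[].
rewrite negb_exists => /forallP a /eqP[]; rewrite /wdif big1 // => i _.
by have := a i; rewrite negbK => /eqP.
Qed.

Lemma wdif_rot u v :
  sgz1 (rot_exp u) * wdif (rotw u) (rotw v) = sgz1 (rot_exp v) * wdif u v.
Proof.
rewrite /wdif [in LHS](reindex_inj (can_inj (@ordSK p))) !mulr_sumr.
apply: eq_bigr => i _.
have agr : [forall k, (k != ordS i) ==> (rotw u k == rotw v k)] =
           [forall k, (k != i) ==> (u k == v k)].
  apply/forallP/forallP => a k.
    by have := a (ordS k); rewrite !ffunE ordSK (can_eq (@ordSK p)).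
  have := a (ord_pred k); rewrite !ffunE; congr (~~ _ ==> _).
  by rewrite -(can_eq (@ordSK p)) ord_predK.
have e : wdif_at (rotw u) (rotw v) (ordS i) =
   sgz1 (\sum_(k < p | (k < ordS i)%N) bdeg (rotw u k)) *
   (sgz1 (\sum_(k < p | (k < i)%N) bdeg (u k)) * wdif_at u v i).
  rewrite /wdif_at agr !ffunE ordSK !mulrA; congr (_ * _ * _).
  by rewrite -mulrA sgz1_sqr mulr1.
rewrite e.
have [->|/wdif_at_deg[di ag dw]] := eqVneq (wdif_at u v i) 0.
  by rewrite !mulr0.
move: (wdif_at u v i) => t; rewrite !mulrA; congr (_ * _); have ip := ltn_ord i.
have p0 : (p.-1 < p)%N by lia.
have lst (k : 'I_p) : (k.+1 == p :> nat) = (k == Ordinal p0).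
  apply/eqP/eqP => [kp|->] /=; last by lia.
  by apply: val_inj => /=; lia.
rewrite !rot_expE !(big_pred1 (Ordinal p0) lst).
set l := Ordinal p0.
have [il|il] := eqVneq i l.
  rewrite [in X in _ * X * _]big_pred0 ?mulr1; last first.
    by move=> k; rewrite il /= prednK ?modnn //; lia.
  have e1 : \sum_(k < p | (k < i)%N) bdeg (u k) = wdeg u - bdeg (u l).
    rewrite /wdeg [in RHS](bigD1 l) //= addrAC subrr add0r; apply: eq_bigl => k.
    by rewrite il -val_eqE /=; have := ltn_ord k; lia.
  rewrite e1 -il di dw.
  have -> : wdeg u + 1 - (bdeg (u i) + 1) = wdeg u - bdeg (u i) by ring.
  by rewrite mulrDr mulr1 [RHS]sgz1D.
rewrite dw -(ag l) 1?eq_sym //.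
have il' : (i.+1 < p)%N by move: il; rewrite -val_eqE /=; lia.
have -> : \sum_(k < p | (k < ordS i)%N) bdeg (rotw u k) =
   bdeg (u l) + \sum_(k < p | (k < i)%N) bdeg (u k).
  rewrite (reindex_inj (can_inj (@ordSK p))) (bigD1 l) /=; last first.
    by rewrite prednK ?modnn ?modn_small //; lia.
  rewrite ffunE ordSK; congr (_ + _).
  apply: eq_big => [k|k _]; last by rewrite ffunE ordSK.
  have [->|kl] := eqVneq k l; first by rewrite andbF /= ; lia.
  have := ltn_ord k; move: kl; rewrite -val_eqE /= => kl kp.
  by rewrite andbT !modn_small //; lia.
rewrite sgz1D !mulrA -[LHS]mulrA sgz1_sqr mulr1 -sgz1D; congr sgz1.
ring.
Qed.

Lemma tens_dif_rot x : tens_dif (tens_rot x) = tens_rot (tens_dif x).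
Proof.
apply/ffunP => w; rewrite !ffunE mulr_sumr.
rewrite (reindex_inj (can_inj rotwK)); apply: eq_bigr => u _.
rewrite ffunE rotwK -{1}(unrotwK w) mulrAC wdif_rot; ring.
Qed.

Lemma wdifdif u v : \sum_w wdif u w * wdif w v = 0.
Proof.
pose F i k := \sum_w wdif_at u w i * wdif_at w v k.
have -> : \sum_w wdif u w * wdif w v = \sum_i \sum_k F i k.
  rewrite /F; under [RHS]eq_bigr do rewrite exchange_big.
  rewrite [RHS]exchange_big; apply: eq_bigr => w _.
  by rewrite mulr_suml; apply: eq_bigr => i _; rewrite mulr_sumr.
have Fd i : F i i = 0.
  rewrite /F.
  have [ag|nag] := boolP [forall k, (k != i) ==> (u k == v k)]; last first.
    rewrite big1 // => w _; apply/eqP; apply: contraNT nag.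
    rewrite mulf_eq0 negb_or => /andP[/wdif_at_deg[_ a _] /wdif_at_deg[_ a' _]].
    by apply/forallP => k; apply/implyP => ki; rewrite a // a'.
  have {}ag k : k != i -> u k = v k by move=> /(implyP (forallP ag k))/eqP.
  pose h b : word := [ffun k => if k == i then b else u k].
  rewrite (bigID [pred w : word | [forall k, (k != i) ==> (u k == w k)]]) /=.
  rewrite [X in _ + X]big1 ?addr0; last first.
    by move=> w /negPf a; rewrite /wdif_at a mulr0 mul0r.
  rewrite (reindex_onto h (fun w : word => w i)) /=; last first.
    move=> w /forallP a; apply/ffunP => k; rewrite ffunE.
    by case: eqP => [->//|/eqP ki]; have /implyP/(_ ki)/eqP := a k.
  under eq_bigl => b.
    rewrite ffunE eqxx eqxx andbT.
    have -> : [forall k, (k != i) ==> (u k == h b k)] = true.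
      apply/forallP => k; apply/implyP => /negPf ki; by rewrite ffunE ki.
    over.
  rewrite (eq_bigr (fun b => bdif (u i) b * bdif b (v i))) ?bdifdif // => b _.
  rewrite /wdif_at ffunE eqxx.
  have -> : [forall k, (k != i) ==> (u k == h b k)] = true.
    by apply/forallP => k; apply/implyP => /negPf ki; rewrite ffunE ki.
  have -> : [forall k, (k != i) ==> (h b k == v k)] = true.
    apply/forallP => k; apply/implyP => ki; rewrite ffunE (negPf ki).
    by rewrite ag.
  have -> : \sum_(k < p | (k < i)%N) bdeg (h b k) =
            \sum_(k < p | (k < i)%N) bdeg (u k).
    apply: eq_bigr => k ki; rewrite ffunE; case: eqP => // e.
    by move: ki; rewrite e ltnn.
  by rewrite !mulr1 mulrACA sgz1_sqr mul1r.
have Fa (i k : 'I_p) : (i < k)%N -> F i k = - F k i.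
  move=> ik; have ik' : i != k by rewrite -val_eqE /=; lia.
  have F1 (a b : 'I_p) : a != b -> F a b =
      wdif_at u [ffun l => if l == a then v a else u l] a *
      wdif_at [ffun l => if l == a then v a else u l] v b.
    move=> ab; rewrite /F (bigD1 [ffun l => if l == a then v a else u l]) //=.
    rewrite big1 ?addr0 // => w /eqP nw; apply/eqP; apply: contra_notT nw.
    rewrite mulf_eq0 negb_or => /andP[/wdif_at_deg[_ c _] /wdif_at_deg[_ c' _]].
    by apply/ffunP => l; rewrite ffunE; case: eqP => [->|/eqP la];
      [exact: c'|rewrite c].
  rewrite !F1 // 1?eq_sym //; rewrite /wdif_at !ffunE !eqxx.
  rewrite [k == i]eq_sym (negPf ik').
  have A (a : 'I_p) :
    [forall l, (l != a) ==> (u l == [ffun l0 => if l0 == a then v a else u l0] l)].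
    by apply/forallP => l; apply/implyP => la; rewrite ffunE (negPf la).
  have B (a b : 'I_p) : a != b ->
    [forall l, (l != b) ==> ([ffun l0 => if l0 == a then v a else u l0] l == v l)] =
    [forall l, [&& l != a & l != b] ==> (u l == v l)].
    move=> ab; apply/forallP/forallP => c l; apply/implyP.
      move=> /andP[la lb]; have /implyP/(_ lb) := c l.
      by rewrite ffunE (negPf la).
    move=> lb; rewrite ffunE; have [->//|la] := eqVneq l a.
    by have := c l; rewrite la lb.
  rewrite !A !B // 1?eq_sym //.
  have -> : [forall l, [&& l != k & l != i] ==> (u l == v l)] =
            [forall l, [&& l != i & l != k] ==> (u l == v l)].
    by apply: eq_forallb => l; rewrite andbC.
  have -> : \sum_(k0 < p | (k0 < i)%N)
      bdeg ([ffun l => if l == k then v k else u l] k0) =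
      \sum_(k0 < p | (k0 < i)%N) bdeg (u k0).
    apply: eq_bigr => l li; rewrite ffunE; case: eqP => // e.
    by move: li ik; rewrite e; lia.
  have [->|d0] := eqVneq (bdif (u i) (v i)) 0; first by ring.
  have -> : \sum_(k0 < p | (k0 < k)%N)
      bdeg ([ffun l => if l == i then v i else u l] k0) =
      \sum_(k0 < p | (k0 < k)%N) bdeg (u k0) + 1.
    rewrite (bigD1 i) //= ffunE eqxx (bdif_deg d0) [in RHS](bigD1 i) //= addrAC.
    by congr (_ + _ + _); apply: eq_bigr => l /andP[_ li]; rewrite ffunE (negPf li).
  rewrite sgz1D [sgz1 1]/sgz1 /=; ring.
have S : \sum_i \sum_k F i k = - \sum_i \sum_k F i k.
  rewrite [in RHS]exchange_big -sumrN; apply: eq_bigr => i _.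
  rewrite -sumrN; apply: eq_bigr => k _.
  have [ik|ik|/val_inj->] := ltngtP i k; first exact: Fa.
    by rewrite (Fa _ _ ik) opprK.
  by rewrite Fd oppr0.
lia.
Qed.

Lemma tens_difdif x : tens_dif (tens_dif x) = 0.
Proof.
apply/ffunP => v; rewrite !ffunE.
under eq_bigr do rewrite ffunE mulr_suml.
rewrite exchange_big big1 //= => u _.
under eq_bigr do rewrite -mulrA.
by rewrite -mulr_sumr wdifdif mulr0.
Qed.

Definition homog (j : int) : {pred tens} :=
  [pred x : tens | [forall w, (x w != 0) ==> (wdeg w == j)]].

Lemma homogP j (x : tens) :
  reflect (forall w, x w != 0 -> wdeg w = j) (x \in homog j).
Proof.
apply: (iffP forallP) => a w; first by move=> /(implyP (a w))/eqP.
by apply/implyP => /a/eqP.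
Qed.

Lemma homog_zmod_closed j : zmod_closed (homog j).
Proof.
split=> [|x y /homogP xj /homogP yj]; apply/homogP => w; rewrite !ffunE ?eqxx //.
have [x0|/xj//] := eqVneq (x w) 0; have [y0|/yj//] := eqVneq (y w) 0.
by rewrite x0 y0 subrr eqxx.
Qed.
HB.instance Definition _ j :=
  GRing.isZmodClosed.Build tens (homog j) (homog_zmod_closed j).

(* The degree j part of the p-th tensor power. *)
Record tensor (j : int) := Tensor { tval :> tens; tvalP : tval \in homog j }.
HB.instance Definition _ j := [isSub for @tval j].
HB.instance Definition _ j := [Choice of tensor j by <:].
HB.instance Definition _ j := [SubChoice_isSubZmodule of tensor j by <:].

Lemma tens_rot_homog j (x : tensor j) : tens_rot x \in homog j.
Proof.
apply/homogP => w; rewrite ffunE mulf_eq0 negb_or => /andP[_].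
by move/(homogP _ _ (tvalP x)); rewrite wdeg_unrotw.
Qed.
Definition tensor_rot j (x : tensor j) : tensor j := Tensor (tens_rot_homog x).

Lemma tensor_rotB j : {morph @tensor_rot j : x y / x - y}.
Proof. by move=> x y; apply: val_inj; apply: tens_rotB. Qed.
HB.instance Definition _ j :=
  GRing.isZmodMorphism.Build _ _ (@tensor_rot j) (@tensor_rotB j).

Lemma tensor_rotX j (x : tensor j) : iter p (@tensor_rot j) x = x.
Proof.
apply: val_inj; rewrite -[RHS]tens_rotX.
have it k : val (iter k (@tensor_rot j) x) = iter k tens_rot (val x).
  by elim: k => // k IH; rewrite !iterS -IH.
exact: it.
Qed.

Definition tensor_cpmod (j : int) : cpmod p :=
  @CpMod p (tensor j) (@tensor_rot j) (@tensor_rotX j).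

Lemma tens_dif_homog j (x : tensor (j - 1)) : tens_dif x \in homog j.
Proof.
apply/homogP => v; rewrite ffunE => s0.
have [w] : exists w, tval x w * wdif w v != 0.
  apply/existsP; apply: contraNT s0; rewrite negb_exists => /forallP a.
  by rewrite big1 // => w _; apply/eqP; have := a w; rewrite negbK.
rewrite mulf_eq0 negb_or => /andP[/(homogP _ _ (tvalP x)) e /wdif_deg->].
by rewrite e subrK.
Qed.
Definition tensor_dif j (x : tensor (j - 1)) : tensor j :=
  Tensor (tens_dif_homog x).

Lemma tensor_dif_linear j :
  (@tensor_dif j : tensor_cpmod (j - 1) -> tensor_cpmod j) \in
  @cplinear p (tensor_cpmod (j - 1)) (tensor_cpmod j).
Proof.
apply/asboolP; split=> [x y|x]; apply: val_inj; first exact: tens_difB.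
exact: tens_dif_rot.
Qed.

Lemma tensor_difdif j x :
  CpHom (tensor_dif_linear j) (CpHom (tensor_dif_linear (j - 1)) x) = 0.
Proof. by apply: val_inj; apply: tens_difdif. Qed.

Definition tensor_power : cpcomplex p :=
  @CpComplex p tensor_cpmod (fun j => CpHom (tensor_dif_linear j))
    tensor_difdif.

End TensorPower.

(* C(n,0): true is the generator of degree -1, false that of degree 0. *)
Section Cn0.
Variable n : nat.
Definition Cn0_deg (b : bool) : int := if b then -1 else 0.
Definition Cn0_dif (b c : bool) : int := if b && ~~ c then n%:Z else 0.
Lemma Cn0_dif_deg b c : Cn0_dif b c != 0 -> Cn0_deg c = Cn0_deg b + 1.
Proof. by case: b c => [] []. Qed.
Lemma Cn0_difdif a c : \sum_b Cn0_dif a b * Cn0_dif b c = 0.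
Proof. by rewrite big_bool; case: a c => [] [] /=; rewrite ?mulr0 ?mul0r. Qed.
Definition Cn0 : based_complex := BasedComplex Cn0_dif_deg Cn0_difdif.
End Cn0.

Definition Dn0 (p n : nat) : cpcomplex p := tensor_power p (Cn0 n).

(* g(k) = ((p - 1) (-1)^k + 'C(p - 1, k)) / p for 0 <= k <= p - 1, and 0
   otherwise; by g_spec the division is exact and the quotient nonnegative. *)
Definition g (p : nat) (k : int) : nat :=
  match k with
  | Posz k => if (k <= p - 1)%N then
      `|(((p%:Z - 1) * (-1) ^+ k + 'C(p - 1, k)%:Z) %/ p%:Z)%Z|%N else 0
  | Negz _ => 0
  end.

Lemma bin_geq m k : (0 < k < m)%N -> (m <= 'C(m, k))%N.
Proof.
elim: m k => // m IH [//|k] /=; rewrite ltnS => km.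
have [->|nkm] := eqVneq k.+1 m; first by rewrite binSn.
rewrite binS -addn1 leq_add ?IH ?bin_gt0 //; last by lia.
by rewrite /= ltn_neqAle nkm.
Qed.

Lemma g_spec (p k : nat) : prime p -> (k <= p - 1)%N ->
  (g p k)%:Q = p%:Q^-1 * ((p%:Q - 1) * (-1) ^+ k + 'C(p - 1, k)%:Q).
Proof.
move=> pp kp; rewrite /g kp; have p1 := prime_gt1 pp.
set a : int := (p%:Z - 1) * (-1) ^+ k + 'C(p - 1, k)%:Z.
have a0 : 0 <= a.
  rewrite /a -signr_odd; case: (boolP (odd k)) => ok; last first.
    by rewrite expr0 mulr1; lia.
  rewrite expr1; case: (ltnP k (p - 1)) => kp'.
    by have := @bin_geq (p - 1) k; case: k ok {a kp} kp' => // k _; lia.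
  have ek : k = (p - 1)%N by lia.
  have := even_prime pp; rewrite ek binn; case=> [->//|op].
  by move: ok; rewrite ek oddB ?op //; lia.
have dv : (p %| a)%Z.
  have key l : (l <= p - 1)%N -> (p %| 'C(p - 1, l)%:Z - (-1) ^+ l)%Z.
    elim: l => [|l IH] lp; first by rewrite bin0.
    have := prime_dvd_bin pp (k := l.+1); rewrite /= => d.
    have {}d : (p%:Z %| 'C(p, l.+1)%:Z)%Z by apply: d; lia.
    have e : 'C(p, l.+1) = ('C(p - 1, l.+1) + 'C(p - 1, l))%N.
      by rewrite -binS; congr 'C(_, _); lia.
    have -> : 'C(p - 1, l.+1)%:Z - (-1) ^+ l.+1 =
              'C(p, l.+1)%:Z - ('C(p - 1, l)%:Z - (-1) ^+ l).
      by rewrite e PoszD exprS; ring.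
    by rewrite rpredB ?IH //; lia.
  have -> : a = p%:Z * (-1) ^+ k + ('C(p - 1, k)%:Z - (-1) ^+ k).
    by rewrite /a; ring.
  by rewrite rpredD ?key // dvdz_mulr.
have p0 : p%:Q != 0 by rewrite intr_eq0; lia.
apply: (mulfI p0); rewrite mulVKf //.
have -> : (p%:Q - 1) * (-1) ^+ k + 'C(p - 1, k)%:Q = a%:~R.
  by rewrite /a rmorphD rmorphM rmorphB /= rmorphXn rmorphN1.
rewrite gez0_abs ?divz_ge0 //; last by lia.
by rewrite -intrM mulrC divzK.
Qed.

(* The cyclic group Z/n, for n > 0 (note that 'Z_1 is not trivial). *)
Definition Zmod (n : nat) : zmodType := 'I_n.-1.+1.
Definition Zmod_pow (n k : nat) : zmodType := 'rV[Zmod n]_k.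
Definition dsum (A B : zmodType) : zmodType := (A * B)%type.
Definition zmod0 : zmodType := Zmod 1.

(* Main.v *)
Require Import Defs.
From HB Require Import structures.
From mathcomp Require Import all_boot all_order all_algebra.
From mathcomp Require Import boolp functions.
From mathcomp Require Import zify ring.
Set Implicit Arguments.
Unset Strict Implicit.
Unset Printing Implicit Defensive.
Import Order.TTheory GRing.Theory Num.Theory.
Local Open Scope ring_scope.

(** Write [L_k], for [0 <= k <= p], for the term of degree [-k] of the [p]-th
    tensor power of [C(n,0)]. It is the [k]-th exterior power of [Z^p], permuted
    by the cyclic group, and the differential is [n] times the contraction
    [bdry] with [(1, ..., 1)]. The complex [(L, bdry)] is exact ([bdry_cone]);
    its inner terms [L_k], [0 < k < p], are free over the group ring
    ([koszul_norm_one]), and its two outer terms are the trivial module [Z],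
    because a [p]-cycle is even ([koszul_fixed]). Let [Z_k] be the cycles in
    [L_k]. Then the cohomology of the tensor power in degree [-k] is
    [Z_k / n Z_k], and the exact sequences of [Z_k], [L_k] and [Z_(k-1)] shift the
    Tate cohomology of [Z_0 = Z] to that of [Z_k]: of the two Tate groups of
    [Z_k], one is [Z/p] and the other vanishes, according to the parity of [k]
    ([tate_degree]). The same sequences, which become exact up to index [p] on
    invariants, show that the invariants of [Z_k] are free abelian of rank [g(k)]
    ([invariants_lattice]).

    By the comparison of resolutions, the pages from [E_2] on, the filtered
    cohomology of the total complex and the splitting of its extensions can be
    computed with the periodic resolution ([change_resolution],
    [hom_model_equiv]): a filtered homotopy equivalence whose homotopies lower
    the filtration by at most one preserves them all. Then a cochain is a
    sequence of elements of [L], and the horizontal differentials are alternately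
    [t - 1] and the norm. Both operators are denoted by [hop b], with the parity
    [b] of the column.

    An element of [E_2] in column [i] is represented by its leading part [a], a
    cycle with [hop b a] in [n Z_k]. Dividing [hop b a] by [n] gives an element of
    the other Tate group, and the kernel of this map is represented by the cycles
    with [hop b a = 0], which are cocycles of the total complex
    ([numer2_kernel_iso], [kernel_cocycle]). When [p] does not divide [n],
    multiplication by [n] is invertible on the Tate groups, and only the invariants
    modulo [n] remain, in column [0]. When [p] divides [n], the nonzero Tate group
    contributes [Z/p] to each term of [E_2] in a positive column, as a kernel or as
    a quotient ([E2_positive]), and to those of the odd rows in column [0]
    ([E2_zero_odd]). The second differential is the shift of Tate cohomology: it is
    injective on the classes detected by the other Tate group, except in the bottom
    row ([numer3_kernel]), and it hits those with [hop b a = 0], except in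
    the top row and in the first two columns ([kernel_denom3]). What remains
    consists of leading parts of cocycles ([survivors_cocycle]), and this alone
    implies the collapse at [E_3] and the convergence ([permanent_collapse]).

    In every total degree at most one term of [E_3] outside of column [0] is
    nonzero, so only the extensions by this term of the term in column [0] are in
    question. In odd degrees the invariant cycles give a section ([odd_step]). In
    even degrees, an invariant cycle that is not a norm is killed by [n] in column
    [0], but [n] times a cocycle lifting it cannot be a coboundary modulo [F^2],
    since this would exhibit it as a norm ([even_nonsplit]). *)

(** * Identities in abelian groups *)

(** Identities between sums of elements of an abelian group are decided by
    comparing the integer coefficients of their variables. *)
Inductive zterm := ZVar of nat | ZZero | ZAdd of zterm & zterm | ZOpp of zterm.

Fixpoint zeval (A : zmodType) (e : seq A) (t : zterm) : A :=
  match t with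
  | ZVar i => nth 0 e i
  | ZZero => 0
  | ZAdd a b => zeval e a + zeval e b
  | ZOpp a => - zeval e a
  end.

Fixpoint zcoef (t : zterm) (i : nat) : int :=
  match t with
  | ZVar j => (i == j)%:Z
  | ZZero => 0
  | ZAdd a b => zcoef a i + zcoef b i
  | ZOpp a => - zcoef a i
  end.

Lemma zevalE (A : zmodType) (e : seq A) (t : zterm) :
  zeval e t = \sum_(i < size e) nth 0 e i *~ zcoef t i.
Proof.
elim: t => [j||a IHa b IHb|a IH] /=.
- have [je|ej] := ltnP j (size e).
    rewrite (bigD1 (Ordinal je)) //= eqxx mulr1z big1 ?addr0 // => i /negPf.
    by rewrite -val_eqE /= => ->; rewrite mulr0z.
  rewrite nth_default // big1 // => i _.
  by rewrite ltn_eqF ?mulr0z // (leq_trans (ltn_ord i)).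
- by rewrite big1.
- by rewrite IHa IHb -big_split; apply: eq_bigr => i _; rewrite mulrzDr.
- by rewrite IH -sumrN; apply: eq_bigr => i _; rewrite mulrNz.
Qed.

Lemma zeval_eq (A : zmodType) (e : seq A) (s t : zterm) :
  all (fun i => zcoef s i == zcoef t i) (iota 0 (size e)) ->
  zeval e s = zeval e t.
Proof.
move=> /allP st; rewrite !zevalE; apply: eq_bigr => i _.
by rewrite (eqP (st i _)) // mem_iota /= ltn_ord.
Qed.

Ltac zindex x e :=
  lazymatch e with
  | ?y :: ?e' =>
      match constr:((x, y)) with
      | (?z, ?z) => constr:(0%N)
      | (@GRing.natmul _ ?a ?n, @GRing.natmul _ ?a ?n) => constr:(0%N)
      | _ => let i := zindex x e' in constr:(i.+1)
      end
  end.
Ltac zmember x e :=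
  lazymatch e with
  | ?y :: ?e' =>
      match constr:((x, y)) with
      | (?z, ?z) => constr:(true)
      | (@GRing.natmul _ ?a ?n, @GRing.natmul _ ?a ?n) => constr:(true)
      | _ => zmember x e'
      end
  | _ => constr:(false)
  end.
Ltac zvars t e :=
  lazymatch t with
  | @GRing.add _ ?a ?b => let e' := zvars a e in zvars b e'
  | @GRing.opp _ ?a => zvars a e
  | @GRing.zero _ => e
  | _ => lazymatch zmember t e with true => e | false => constr:(t :: e) end
  end.
Ltac zreify t e :=
  lazymatch t with
  | @GRing.add _ ?a ?b =>
      let a' := zreify a e in let b' := zreify b e in constr:(ZAdd a' b')
  | @GRing.opp _ ?a => let a' := zreify a e in constr:(ZOpp a')
  | @GRing.zero _ => constr:(ZZero)
  | _ => let i := zindex t e in constr:(ZVar i)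
  end.
Ltac abel :=
  lazymatch goal with
  | |- @eq ?T ?s ?t =>
      let e := zvars s (@nil T) in let e := zvars t e in
      let s' := zreify s e in let t' := zreify t e in
      refine (@zeval_eq _ e s' t' _); vm_compute; reflexivity
  end.

(** * Subquotients *)

Definition subgroup (A : zmodType) (N : A -> Prop) : Prop :=
  N 0 /\ forall x y, N x -> N y -> N (x - y).

Lemma subgroup0 (A : zmodType) (N : A -> Prop) : subgroup N -> N 0.
Proof. by case. Qed.
Lemma subgroupB (A : zmodType) (N : A -> Prop) x y :
  subgroup N -> N x -> N y -> N (x - y).
Proof. by case=> _; apply. Qed.
Lemma subgroupN (A : zmodType) (N : A -> Prop) x : subgroup N -> N x -> N (- x).
Proof. by move=> sN; rewrite -sub0r; apply: subgroupB => //; case: sN. Qed.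
Lemma subgroupD (A : zmodType) (N : A -> Prop) x y :
  subgroup N -> N x -> N y -> N (x + y).
Proof.
by move=> sN Nx Ny; rewrite -[y]opprK; apply: subgroupB => //; apply: subgroupN.
Qed.
Lemma subgroupMn (A : zmodType) (N : A -> Prop) x n :
  subgroup N -> N x -> N (x *+ n).
Proof.
move=> sN Nx; elim: n => [|n IH]; first exact: subgroup0.
by rewrite mulrS; apply: subgroupD.
Qed.
Lemma subgroupMz (A : zmodType) (N : A -> Prop) x n :
  subgroup N -> N x -> N (x *~ n).
Proof.
move=> sN Nx; case: n => n; first exact: subgroupMn.
by rewrite NegzE mulrNz; apply: subgroupN => //; apply: subgroupMn.
Qed.

Lemma subquo_iso_ext (A M : zmodType) (N N' B B' : A -> Prop) :
  (forall x, N x <-> N' x) -> (forall x, N x -> (B x <-> B' x)) ->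
  subquo_iso N B M -> subquo_iso N' B' M.
Proof.
move=> eN eB [f [fB fS fK]]; exists f; split.
- by move=> x y /eN Nx /eN Ny; apply: fB.
- by move=> u; have [x /eN Nx <-] := fS u; exists x.
- by move=> x /eN Nx; rewrite fK // eB.
Qed.

(** Connecting homomorphisms depend on choices, so the map which induces the
    isomorphism is only required to be additive modulo [B]. *)
Lemma subquo_iso_transfer (A A' M : zmodType) (N B : A -> Prop)
    (N' B' : A' -> Prop) (f : A' -> A) :
  subgroup N -> subgroup N' ->
  (forall x, N' x -> N (f x)) ->
  (forall x y, N' x -> N' y -> B (f (x - y) - (f x - f y))) ->
  (forall x, N' x -> (B' x <-> B (f x))) ->
  (forall y, N y -> exists2 x, N' x & B (y - f x)) ->
  subquo_iso N B M -> subquo_iso N' B' M.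
Proof.
move=> sN sN' fN fB fK fS [q [qB qS qK]].
have qE x y : N x -> N y -> B (x - y) -> q x = q y.
  move=> Nx Ny Bxy; apply/eqP; rewrite -subr_eq0 -qB //; apply/eqP/qK => //.
  exact: subgroupB.
exists (q \o f); split=> /=.
- move=> x y Nx Ny; rewrite -qB; [|exact: fN..].
  apply: qE; [by apply/fN; apply: subgroupB| |exact: fB].
  by apply: subgroupB => //; apply: fN.
- move=> u; have [y Ny <-] := qS u; have [x Nx Bx] := fS y Ny.
  by exists x => //; rewrite -(qE y (f x)) //; apply: fN.
- by move=> x Nx; rewrite fK // qK //; apply: fN.
Qed.

(** The second isomorphism theorem, induced by a choice of representatives in
    [N] of the classes of [N']. *)
Lemma subquo_iso_extend (A M : zmodType) (N B N' B' : A -> Prop) :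
  subgroup N -> subgroup N' -> subgroup B' ->
  (forall x, N x -> N' x) ->
  (forall x, N' x -> exists2 y, N y & B' (x - y)) ->
  (forall x, N x -> (B x <-> B' x)) ->
  subquo_iso N B M -> subquo_iso N' B' M.
Proof.
move=> sN sN' sB' NN' N'N BB'.
have /choice[r rP] x : exists y, N' x -> N y /\ B' (x - y).
  have [/N'N[y Ny By]|nN] := pselect (N' x); first by exists y.
  by exists 0.
apply: (@subquo_iso_transfer _ _ _ _ _ _ _ r) => //.
- by move=> x /rP[].
- move=> x y Nx Ny; have [Nr Br] := rP x Nx; have [Ns Bs] := rP y Ny.
  have [Nt Bt] := rP _ (subgroupB sN' Nx Ny).
  apply/BB'; first by do 2?[apply: subgroupB => //].
  have -> : r (x - y) - (r x - r y) =
      ((x - r x) - (y - r y)) - (x - y - r (x - y)).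
    by abel.
  by do 2?[apply: subgroupB => //].
- move=> x Nx; have [Nr Br] := rP x Nx; rewrite BB' //; split=> h.
    by rewrite -[r x](subKr x); apply: subgroupB.
  by rewrite -[x](subrK (r x)); apply: subgroupD.
- move=> y Ny; exists y; first exact: NN'.
  have [Nr Br] := rP y (NN' _ Ny).
  by apply/BB' => //; apply: subgroupB.
Qed.

Lemma subquo_morph0 (A M : zmodType) (N : A -> Prop) (f : A -> M) :
  subgroup N -> (forall x y, N x -> N y -> f (x - y) = f x - f y) -> f 0 = 0.
Proof. by move=> [N0 _] fB; rewrite -(subrr 0) fB // subrr. Qed.

Lemma subquo_morphMn (A M : zmodType) (N : A -> Prop) (f : A -> M) x k :
  subgroup N -> (forall x y, N x -> N y -> f (x - y) = f x - f y) ->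
  N x -> f (x *+ k) = f x *+ k.
Proof.
move=> sN fB Nx; elim: k => [|k IH]; first exact: subquo_morph0 sN fB.
have fN y : N y -> f (- y) = - f y.
  by move=> Ny; rewrite -sub0r fB // ?(subquo_morph0 sN fB) ?sub0r //; case: sN.
have NM : N (x *+ k) by apply: subgroupMn.
have NNM : N (- (x *+ k)) by apply: subgroupN.
by rewrite !mulrS -IH -{1}[x *+ k]opprK fB // fN // opprK.
Qed.

(** A representative of a generator of [Zmod p] that [p] multiplies into [B]
    defines a section of the projection onto [Zmod p]. *)
Lemma subquo_iso_dsum (A M : zmodType) (N K B : A -> Prop) (p : nat) :
  (0 < p)%N -> subgroup N -> subgroup K -> subgroup B ->
  (forall x, B x -> K x) -> (forall x, K x -> N x) ->
  (forall x, N x -> exists y, [/\ N y, K (x - y) & B (y *+ p)]) ->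
  subquo_iso K B M -> subquo_iso N K (Zmod p) ->
  subquo_iso N B (dsum M (Zmod p)).
Proof.
move=> p0 sN sK sB BK KN ord [q [qB qS qK]] [f [fB fS fK]].
have pE : p.-1.+1 = p by rewrite prednK.
have [a1 Na1 fa1] := fS (inZp 1).
have [a [Na Kaa Ba]] := ord a1 Na1.
have fa : f a = inZp 1.
  apply/eqP; rewrite -fa1 eq_sym -subr_eq0 -fB //.
  by apply/eqP; apply: (proj2 (fK _ _)) => //; apply: subgroupB.
have fMn k : f (a *+ k) = inZp k.
  by rewrite (subquo_morphMn k sN fB Na) fa Zp_mulrn /=; apply: val_inj;
     rewrite /= modnMml mul1n.
have NaMn k : N (a *+ k) by apply: subgroupMn.
pose c x := x - a *+ (f x : nat).
have cK x : N x -> K (c x).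
  move=> Nx; apply: (proj1 (fK _ _)); first exact: subgroupB.
  by rewrite fB // fMn; apply/eqP; rewrite subr_eq0 -{1}[f x]valZpK.
have qE x y : K x -> K y -> B (x - y) -> q x = q y.
  move=> Nx Ny Bxy; apply/eqP; rewrite -subr_eq0 -qB //; apply/eqP/qK => //.
  exact: subgroupB.
have aE k l : k = l %[mod p] -> B (a *+ k - a *+ l).
  move=> e; have aM m : B (a *+ (m * p)).
    by rewrite mulnC mulrnA; apply: subgroupMn.
  have -> : a *+ k - a *+ l = a *+ (k %/ p * p) - a *+ (l %/ p * p).
    by rewrite {1}(divn_eq k p) {1}(divn_eq l p) e !mulrnDr; abel.
  exact: subgroupB.
exists (fun x => (q (c x), f x)); split.
- move=> x y Nx Ny; have Nxy := subgroupB sN Nx Ny.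
  rewrite fB //; congr (_, _); rewrite -qB; [|exact: cK..].
  apply: qE; [exact: cK|by apply: subgroupB => //; apply: cK|].
  have -> : c (x - y) - (c x - c y) =
      - (a *+ (f (x - y) : nat) + a *+ (f y : nat) - a *+ (f x : nat)).
    by rewrite /c; abel.
  apply: subgroupN => //; rewrite -mulrnDr; apply: aE.
  have modE k l : k = l %[mod p.-1.+1] -> k = l %[mod p] by rewrite pE.
  by apply/modE; rewrite fB // -[in RHS](subrK (f y) (f x)) /= modn_mod.
- move=> [u v]; have [x Kx <-] := qS u.
  have Nx := KN _ Kx; have fx : f x = 0 by apply/fK.
  have fxv : f (x + a *+ (v : nat)) = v.
    rewrite -[a *+ _]opprK fB //; last exact: subgroupN.
    rewrite fx -[- _ : A]sub0r fB //; last exact: subgroup0.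
    by rewrite (subquo_morph0 sN fB) !sub0r opprK fMn valZpK.
  exists (x + a *+ (v : nat)); first exact: subgroupD.
  by rewrite /c fxv addrK.
- move=> x Nx; split=> [[qc fx]|Bx].
    have Kx : K x by apply/fK.
    by apply/qK => //; move: qc; rewrite /c fx mulr0n subr0.
  have Kx := BK _ Bx; have fx : f x = 0 by apply/fK.
  by rewrite /c fx mulr0n subr0; congr (_, _); apply/qK.
Qed.

Lemma subquo_iso_zmod0 (A : zmodType) (N B : A -> Prop) :
  subgroup N -> (forall x, N x -> B x) -> subquo_iso N B zmod0.
Proof.
move=> [N0 _] NB; exists (fun=> 0).
split=> [x y _ _|u|x Nx]; first by rewrite subr0.
  by exists 0 => //; apply/val_inj; case: u => [[]].
by split=> // _; apply: NB.
Qed.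

Lemma subquo_iso_zmod0_sub (A : zmodType) (N B : A -> Prop) :
  subquo_iso N B zmod0 -> forall x, N x -> B x.
Proof.
move=> [f [_ _ fK]] x Nx; apply/fK => //.
by apply: val_inj; case: (f x) => [[]].
Qed.

(** * Filtered complexes and their spectral sequences *)

(** The common form of the total complex of a bicomplex and of the periodic model
    to which it is reduced. *)
Record fcomplex := FComplex {
  fc :> zmodType;
  fd : {additive fc -> fc};
  fdeg : int -> fc -> Prop;
  ffil : nat -> fc -> Prop;
  fdd : forall x, fd (fd x) = 0;
  fdeg_sub : forall m, subgroup (fdeg m);
  ffil_sub : forall s, subgroup (ffil s);
  fdeg_d : forall m x, fdeg m x -> fdeg (m + 1) (fd x);
  ffil_d : forall s x, ffil s x -> ffil s (fd x);
  ffil0 : forall x, ffil 0 x;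
  ffilW : forall s t x, (s <= t)%N -> ffil t x -> ffil s x }.
Arguments fd : clear implicits.
Arguments fdeg : clear implicits.
Arguments ffil : clear implicits.

Section FilteredComplex.
Variable X : fcomplex.

Lemma fdeg0 m : fdeg X m 0. Proof. exact: subgroup0 (fdeg_sub X m). Qed.
Lemma fdegB m x y : fdeg X m x -> fdeg X m y -> fdeg X m (x - y).
Proof. exact: subgroupB (fdeg_sub X m). Qed.
Lemma fdegD m x y : fdeg X m x -> fdeg X m y -> fdeg X m (x + y).
Proof. exact: subgroupD (fdeg_sub X m). Qed.
Lemma ffil_0 s : ffil X s 0. Proof. exact: subgroup0 (ffil_sub X s). Qed.
Lemma ffilB s x y : ffil X s x -> ffil X s y -> ffil X s (x - y).
Proof. exact: subgroupB (ffil_sub X s). Qed.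
Lemma ffilD s x y : ffil X s x -> ffil X s y -> ffil X s (x + y).
Proof. exact: subgroupD (ffil_sub X s). Qed.
Lemma fdeg_pred m x : fdeg X (m - 1) x -> fdeg X m (fd X x).
Proof. by move=> mx; rewrite -[m](subrK 1); apply: fdeg_d. Qed.
Hint Resolve fdeg0 ffil_0 ffil0 : core.

Lemma fdD x y : fd X (x + y) = fd X x + fd X y. Proof. exact: raddfD. Qed.
Lemma fdB x y : fd X (x - y) = fd X x - fd X y. Proof. exact: raddfB. Qed.

(** The terms, differentials and extensions of the spectral sequence of a
    bicomplex, for an arbitrary filtered complex: on a total complex they unfold
    to the original ones. *)
Definition ssZ (r i : nat) (m : int) (x : X) : Prop :=
  [/\ fdeg X m x, ffil X i x & ffil X (i + r) (fd X x)].

Definition ssB (r i : nat) (m : int) (x : X) : Prop :=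
  exists y z,
    [/\ fdeg X (m - 1) y, ffil X (i.+1 - r) y & ffil X i (fd X y)] /\
    [/\ fdeg X m z, ffil X i.+1 z & ffil X (i + r) (fd X z)] /\
    x = fd X y + z.

Definition ssH (i : nat) (m : int) (x : X) : Prop :=
  [/\ fdeg X m x, fd X x = 0 &
      exists2 y, fdeg X (m - 1) y & ffil X i (x - fd X y)].

Definition ssBH (m : int) (x : X) : Prop :=
  exists2 y, fdeg X (m - 1) y & x = fd X y.

Definition page (r i : nat) (j : int) (M : zmodType) :=
  subquo_iso (ssZ r i (i%:Z + j)) (ssB r i (i%:Z + j)) M.

Definition dvanishes (r i : nat) (j : int) : Prop :=
  forall x, ssZ r i (i%:Z + j) x -> ssB r (i + r) (i%:Z + j + 1) (fd X x).

Definition abuts (r i : nat) (j : int) : Prop :=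
  let m := i%:Z + j in
  (forall x, ssZ r i m x -> exists y,
     [/\ fdeg X m y, ffil X i y, fd X y = 0 & ssB r i m (x - y)]) /\
  (forall y : X, fdeg X m y -> ffil X i y -> fd X y = 0 ->
     (ssB r i m y <-> ssH i.+1 m y)).

Definition stepsplits (i : nat) (m : int) : Prop :=
  ext_split (ssH i.+1 m) (ssH i m) (ssBH m).

Definition lowsplits (m : int) : Prop :=
  ext_split (ssH 1 m) (ssH 0 m) (ssH 2 m).

(** All the elements of [E_r] are permanent cycles. It is enough to compare
    leading parts, and this is all that the collapse and the convergence
    depend on. *)
Definition permanent (r : nat) : Prop :=
  forall i m x, ssZ r i m x -> exists y,
    [/\ fdeg X m y, ffil X i y, fd X y = 0 & ffil X i.+1 (x - y)].

Lemma ssZ_sub r i m : subgroup (ssZ r i m).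
Proof.
split=> [|x y [mx ix dx] [my iy dy]].
  by split; rewrite ?raddf0.
by split; rewrite ?raddfB /=; (exact: fdegB || exact: ffilB).
Qed.

Lemma ssB_sub r i m : subgroup (ssB r i m).
Proof.
split.
  by exists 0, 0; do !split; rewrite ?raddf0 ?addr0.
move=> x y [u [v [[mu iu du] [[mv iv dv] ->]]]] [u' [v' [[mu' iu' du'] [[mv' iv' dv'] ->]]]].
exists (u - u'), (v - v'); do !split; rewrite ?raddfB //=; last by abel.
all: by (exact: fdegB || exact: ffilB).
Qed.

(** As long as the filtrations of a chain and of its boundary differ by at least
    [r], the leading part of the chain is that of a cocycle, which can be
    subtracted. *)
Lemma permanent_bound r i m w : permanent r -> (0 < r)%N ->
  fdeg X m w -> ffil X i (fd X w) ->
  exists w', [/\ fdeg X m w', ffil X (i.+1 - r) w' & fd X w' = fd X w].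
Proof.
move=> perm r0 mw iw.
suff h k : (k + r <= i.+1)%N -> exists w',
    [/\ fdeg X m w', ffil X k w' & fd X w' = fd X w].
  have [ri|ir] := leqP r i.+1; first by apply: h; rewrite subnK.
  by exists w; split=> //; rewrite (eqP (ltnW ir)); apply: ffil0.
elim: k => [_|k IH kr]; first by exists w.
have [v [mv kv dv]] := IH (ltnW kr).
have [c [mc kc dc vc]] : exists y,
    [/\ fdeg X m y, ffil X k y, fd X y = 0 & ffil X k.+1 (v - y)].
  by apply: perm; split=> //; rewrite dv; apply: ffilW iw; lia.
exists (v - c); split=> //; last by rewrite raddfB /= dc subr0.
exact: fdegB.
Qed.

(** The differential of an element of [E_s] is also that of its difference with a
    cocycle with the same leading part, and that difference has higher
    filtration. *)
Lemma permanent_collapse r : permanent r -> (0 < r)%N ->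
  (forall s i j, (r <= s)%N -> dvanishes s i j) /\ (forall i j, abuts r i j).
Proof.
move=> perm r0; split=> [s i j rs x [mx ix dx]|i j].
  have [y [my iy dy xy]] : exists y, [/\ fdeg X (i%:Z + j) y, ffil X i y,
      fd X y = 0 & ffil X i.+1 (x - y)].
    by apply: perm; split=> //; apply: ffilW dx; lia.
  have dxy : fd X (x - y) = fd X x by rewrite raddfB /= dy subr0.
  exists (x - y), 0; do !split; rewrite ?raddf0 ?addr0 ?dxy //.
  - by rewrite addrK; apply: fdegB.
  - by apply: ffilW xy; lia.
rewrite /abuts; set m := i%:Z + j; split=> [x Zx|y my iy dy].
  have [y [my iy dy xy]] := perm _ _ _ Zx; have [mx ix dx] := Zx.
  exists y; split=> //; exists 0, (x - y).
  do !split; rewrite ?raddf0 ?add0r ?raddfB ?dy ?subr0 //.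
  exact: fdegB.
split=> [[u [z [[mu iu du] [[mz iz dz] e]]]]|[_ _ [w mw yw]]].
  by split=> //; exists u => //; rewrite e addrC addKr.
have iw : ffil X i (fd X w).
  rewrite -[fd X w](subKr y); apply: ffilB => //; exact: ffilW yw.
have [w' [mw' iw' dw']] := permanent_bound perm r0 mw iw.
exists w', (y - fd X w); do !split; rewrite ?dw' ?raddfB ?dy ?fdd ?subr0 //=.
- by apply: fdegB => //; apply: fdeg_pred.
- by rewrite addrC subrK.
Qed.

End FilteredComplex.

Record filtered_map (X Y : fcomplex) (f : X -> Y) : Prop := FilteredMap {
  fmapB : {morph f : x y / x - y};
  fmap_d : forall x, f (fd X x) = fd Y (f x);
  fmap_deg : forall m x, fdeg X m x -> fdeg Y m (f x);
  fmap_fil : forall s x, ffil X s x -> ffil Y s (f x) }.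

(** Chain homotopies may lower the filtration by one, as those do which come
    from a homotopy between two maps of resolutions. *)
Record filtered_homotopy (X : fcomplex) (f h : X -> X) : Prop :=
  FilteredHomotopy {
  fhom0 : h 0 = 0;
  fhom_deg : forall m x, fdeg X m x -> fdeg X (m - 1) (h x);
  fhom_fil : forall s x, ffil X s.+1 x -> ffil X s (h x);
  fhomE : forall x, f x - x = fd X (h x) + h (fd X x) }.

Definition filtered_equiv (X Y : fcomplex) : Prop :=
  exists f g h k, [/\ @filtered_map X Y f, @filtered_map Y X g,
    @filtered_homotopy X (g \o f) h & @filtered_homotopy Y (f \o g) k].

Lemma filtered_equiv_sym X Y : filtered_equiv X Y -> filtered_equiv Y X.
Proof. by move=> [f [g [h [k [? ? ? ?]]]]]; exists g, f, k, h. Qed.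

Lemma filtered_map_comp (X Y Z : fcomplex) (g : Y -> Z) (f : X -> Y) :
  filtered_map g -> filtered_map f -> filtered_map (g \o f).
Proof.
move=> G F; split=> [x y|x|m x mx|s x sx] /=.
- by rewrite (fmapB F) (fmapB G).
- by rewrite (fmap_d F) (fmap_d G).
- by apply/(fmap_deg G)/(fmap_deg F).
- by apply/(fmap_fil G)/(fmap_fil F).
Qed.

Lemma filtered_homotopy_comp (X Y : fcomplex) (f : X -> Y) (g : Y -> X)
    (e : Y -> Y) (h : X -> X) (k : Y -> Y) :
  filtered_map f -> filtered_map g -> filtered_homotopy (g \o f) h ->
  filtered_homotopy e k ->
  filtered_homotopy (g \o e \o f) (fun x => h x + g (k (f x))).
Proof.
move=> F G H K; have f0 : f 0 = 0 by rewrite -(subrr 0) (fmapB F) subrr.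
have g0 : g 0 = 0 by rewrite -(subrr 0) (fmapB G) subrr.
have gD x y : g (x + y) = g x + g y.
  rewrite -{1}[y]opprK (fmapB G) -[- y]sub0r (fmapB G) g0; abel.
split=> [|m x mx|s x sx|x].
- by rewrite (fhom0 H) f0 (fhom0 K) g0 addr0.
- by apply: fdegD; [apply: (fhom_deg H)|apply/(fmap_deg G)/(fhom_deg K)/(fmap_deg F)].
- by apply: ffilD; [apply: (fhom_fil H)|apply/(fmap_fil G)/(fhom_fil K)/(fmap_fil F)].
- have -> : (g \o e \o f) x = g (e (f x) - f x) + (g (f x) - x) + x.
    by rewrite (fmapB G) /=; abel.
  have := fhomE H x; rewrite /= => ->.
  rewrite (fhomE K) gD (fmap_d G) raddfD /= -(fmap_d F).
  by abel.
Qed.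

Lemma filtered_equiv_trans X Y Z :
  filtered_equiv X Y -> filtered_equiv Y Z -> filtered_equiv X Z.
Proof.
move=> [f [g [h [k [F G H K]]]]] [f' [g' [h' [k' [F' G' H' K']]]]].
exists (f' \o f), (g \o g'), (fun x => h x + g (h' (f x))).
exists (fun z => k' z + f' (k (g' z))); split.
- exact: filtered_map_comp.
- exact: filtered_map_comp.
- exact: (filtered_homotopy_comp F G H H').
- exact: (filtered_homotopy_comp G' F' K' K).
Qed.

#[local] Hint Resolve fdeg0 ffil_0 ffil0 : core.

Section FilteredEquivalence.
Variables (X Y : fcomplex).

Lemma fmap0 (f : X -> Y) : filtered_map f -> f 0 = 0.
Proof. by move=> F; rewrite -(subrr 0) (fmapB F) subrr. Qed.

Lemma fmapD (f : X -> Y) x y : filtered_map f -> f (x + y) = f x + f y.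
Proof.
move=> F; have fN z : f (- z) = - f z by rewrite -sub0r (fmapB F) (fmap0 F) sub0r.
by rewrite -{1}[y]opprK (fmapB F) fN opprK.
Qed.

Lemma fmap_ssZ (f : X -> Y) r i m x :
  filtered_map f -> ssZ r i m x -> ssZ r i m (f x).
Proof.
move=> F [mx ix dx]; split; first exact: (fmap_deg F mx).
  exact: (fmap_fil F ix).
by rewrite -(fmap_d F); apply: (fmap_fil F dx).
Qed.

Lemma fmap_ssB (f : X -> Y) r i m x :
  filtered_map f -> ssB r i m x -> ssB r i m (f x).
Proof.
move=> F [u [v [[mu iu du] [[mv iv dv] ->]]]]; exists (f u), (f v).
rewrite -!(fmap_d F) (fmapD _ _ F).
by do !split=> //; (exact: (fmap_deg F) || exact: (fmap_fil F)).
Qed.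

Lemma fmap_ssH (f : X -> Y) i m x :
  filtered_map f -> ssH i m x -> ssH i m (f x).
Proof.
move=> F [mx dx [y my xy]]; split; first exact: (fmap_deg F mx).
  by rewrite -(fmap_d F) dx (fmap0 F).
exists (f y); first exact: (fmap_deg F my).
by rewrite -(fmap_d F) -(fmapB F); apply: (fmap_fil F xy).
Qed.

Lemma fmap_ssBH (f : X -> Y) m x : filtered_map f -> ssBH m x -> ssBH m (f x).
Proof.
move=> F [y my ->]; exists (f y); first exact: (fmap_deg F my).
exact: (fmap_d F y).
Qed.

End FilteredEquivalence.

Section SelfHomotopy.
Variable X : fcomplex.

(** The homotopy lowers the filtration by one, while [E_r] is a quotient by
    boundaries of chains of filtration lower by up to [r - 1]: hence the
    bound on [r]. *)
Lemma fhom_ssB (f h : X -> X) r i m x :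
  filtered_homotopy f h -> filtered_map f -> (1 < r)%N ->
  ssZ r i m x -> ssB r i m (f x - x).
Proof.
move=> H F r1 Zx; have [mx ix dx] := Zx.
have [_ ifx dfx] := fmap_ssZ F Zx.
have hdx : ffil X (i + r).-1 (h (fd X x)).
  by apply: (fhom_fil H); rewrite prednK //; lia.
have ddhx : fd X (h (fd X x)) = f (fd X x) - fd X x.
  by rewrite (fhomE H) fdd (fhom0 H) addr0.
exists (h x), (h (fd X x)); do !split; last by rewrite (fhomE H).
- exact: (fhom_deg H mx).
- have [->|i0] := posnP i; first by rewrite (_ : _ - r = 0)%N //; lia.
  have ix' : ffil X i.-1.+1 x by rewrite prednK.
  by apply: ffilW (fhom_fil H ix'); lia.
- have -> : fd X (h x) = f x - x - h (fd X x) by rewrite (fhomE H); abel.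
  by apply: ffilB; [exact: ffilB|apply: ffilW hdx; lia].
- by have := fhom_deg H (fdeg_d mx); rewrite addrK.
- by apply: ffilW hdx; lia.
- by move: dfx; rewrite ddhx -(fmap_d F) => dfx; apply: ffilB.
Qed.

Lemma fhom_ssBH (f h : X -> X) m x : filtered_homotopy f h ->
  fdeg X m x -> fd X x = 0 -> ssBH m (f x - x).
Proof.
move=> H mx dx; exists (h x); first exact: (fhom_deg H mx).
by rewrite (fhomE H) dx (fhom0 H) addr0.
Qed.

End SelfHomotopy.

Lemma ssH_sub (X : fcomplex) i m : subgroup (@ssH X i m).
Proof.
split=> [|x y [mx dx [u mu xu]] [my dy [v mv yv]]].
  by split; rewrite ?raddf0 //; exists 0 => //; rewrite raddf0 subr0.
split; [exact: fdegB|by rewrite raddfB /= dx dy subrr|].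
exists (u - v); first exact: fdegB.
rewrite (_ : _ - _ = x - fd X u - (y - fd X v)); first exact: ffilB.
by rewrite raddfB /=; abel.
Qed.

Lemma ssBH_sub (X : fcomplex) m : subgroup (@ssBH X m).
Proof.
split=> [|x y [u mu ->] [v mv ->]]; first by exists 0; rewrite ?raddf0 //.
by exists (u - v); rewrite ?raddfB //; apply: fdegB.
Qed.

Lemma ssBH_ssH (X : fcomplex) i m (x : X) : ssBH m x -> ssH i m x.
Proof.
move=> [y my ->]; split; [exact: fdeg_pred|exact: fdd|].
by exists y; rewrite ?subrr.
Qed.

Lemma filtered_equiv_page X Y r i j M : filtered_equiv X Y -> (1 < r)%N ->
  page Y r i j M -> page X r i j M.
Proof.
move=> [f [g [h [k [F G H K]]]]] r1.
have GF := filtered_map_comp G F; have FG := filtered_map_comp F G.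
apply: (@subquo_iso_transfer _ _ _ _ _ _ _ f).
- exact: ssZ_sub.
- exact: ssZ_sub.
- by move=> x; apply: fmap_ssZ.
- by move=> x y _ _; rewrite (fmapB F) subrr; apply: subgroup0 (ssB_sub _ _ _ _).
- move=> x Zx; split=> [|Bx]; first exact: fmap_ssB.
  rewrite -[x](subKr (g (f x))); apply: subgroupB; first exact: ssB_sub.
    exact: fmap_ssB.
  exact: (fhom_ssB H GF r1 Zx).
- move=> y Zy; exists (g y); first exact: fmap_ssZ.
  rewrite -opprB; apply: subgroupN; first exact: ssB_sub.
  exact: (fhom_ssB K FG r1 Zy).
Qed.

(** The image in [X] of the cocycle found in [Y] has the right leading part after
    subtraction of the boundary of the homotopy. *)
Lemma filtered_equiv_permanent X Y r : filtered_equiv X Y -> (1 < r)%N ->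
  permanent Y r -> permanent X r.
Proof.
move=> [f [g [h [k [F G H K]]]]] r1 perm i m x Zx.
have [mx ix dx] := Zx.
have [y [my iy dy xy]] := perm _ _ _ (fmap_ssZ F Zx).
have e : x - (g y - fd X (h x)) = g (f x - y) - h (fd X x).
  rewrite (fmapB G) (_ : g (f x) = x + (fd X (h x) + h (fd X x))); first by abel.
  by rewrite -(fhomE H) /=; abel.
have xg : ffil X i.+1 (x - (g y - fd X (h x))).
  rewrite e; apply: ffilB; first exact: (fmap_fil G xy).
  have dx' : ffil X (i + r).-1.+1 (fd X x) by rewrite prednK //; lia.
  by apply: ffilW (fhom_fil H dx'); lia.
exists (g y - fd X (h x)); split=> //.
- apply: fdegB; first exact: (fmap_deg G my).
  by apply: fdeg_pred; apply: (fhom_deg H mx).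
- rewrite -[_ - _](subKr x); apply: ffilB => //; exact: ffilW xg.
- by rewrite raddfB /= fdd subr0 -(fmap_d G) dy (fmap0 G).
Qed.

Section ExtensionTransport.
Variables (X Y : fcomplex).

(** The composite of a section with [f] and [g] is a section, because [g \o f] is
    the identity up to coboundaries. *)
Lemma fmap_ext_split (f : X -> Y) (g : Y -> X) (h : X -> X) i i' m
    (QX : X -> Prop) (QY : Y -> Prop) :
  filtered_map f -> filtered_map g -> filtered_homotopy (g \o f) h ->
  (forall y, QY y -> QX (g y)) ->
  ext_split (@ssH Y i m) (@ssH Y i' m) QY ->
  ext_split (@ssH X i m) (@ssH X i' m) QX.
Proof.
move=> F G H QG [s [sG sB sK sE]].
exists (fun x => g (s (f x))); split.
- by move=> x Gx; apply/(fmap_ssH G)/sG/(fmap_ssH F).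
- move=> x y Gx Gy; rewrite (fmapB F) -!(fmapB G).
  by apply/QG/sB; apply: fmap_ssH.
- by move=> x Kx; apply/QG/sK/fmap_ssH.
- move=> x Gx; rewrite (_ : _ - x = g (s (f x) - f x) + (g (f x) - x)); last first.
    by rewrite (fmapB G); abel.
  have [mx dx _] := Gx.
  apply: subgroupD; first exact: ssH_sub.
    by apply/(fmap_ssH G)/sE/(fmap_ssH F).
  by apply: ssBH_ssH; apply: (fhom_ssBH H mx dx).
Qed.

Lemma filtered_equiv_step i m : filtered_equiv X Y ->
  stepsplits Y i m -> stepsplits X i m.
Proof.
move=> [f [g [h [k [F G H K]]]]].
by apply: (fmap_ext_split F G H) => y; apply: fmap_ssBH.
Qed.

Lemma filtered_equiv_low m : filtered_equiv X Y ->
  lowsplits Y m -> lowsplits X m.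
Proof.
move=> [f [g [h [k [F G H K]]]]].
by apply: (fmap_ext_split F G H) => y; apply: fmap_ssH.
Qed.

End ExtensionTransport.

(** * The total complex of a bicomplex *)

Section TotComplex.
Variable E : bicomplex.

HB.instance Definition _ :=
  GRing.isZmodMorphism.Build (tot E) (tot E) (@totd E) (@totdB E).

Lemma tot_deg_sub m : subgroup (@tot_deg E m).
Proof.
split=> [i j _ //|x y mx my i j ij].
by rewrite (_ : (x - y) i j = x i j - y i j) // mx // my // subrr.
Qed.

Lemma tot_fil_sub s : subgroup (@tot_fil E s).
Proof.
split=> [i j _ //|x y sx sy i j ij].
by rewrite (_ : (x - y) i j = x i j - y i j) // sx // sy // subrr.
Qed.

Lemma tot_deg_d m (x : tot E) : tot_deg m x -> tot_deg (m + 1) (totd x).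
Proof.
move=> mx i j ij; rewrite /totd [x i (j - 1)]mx ?raddf0 ?mul0rz ?addr0; last lia.
by case: i ij => [//|i] ij; rewrite mx ?raddf0 //; lia.
Qed.

Lemma tot_fil_d s (x : tot E) : tot_fil s x -> tot_fil s (totd x).
Proof.
move=> sx i j si; rewrite /totd [x i (j - 1)]sx // raddf0 mul0rz addr0.
by case: i si => [//|i] si; rewrite sx ?raddf0 //; lia.
Qed.

Lemma tot_filW s t (x : tot E) : (s <= t)%N -> tot_fil t x -> tot_fil s x.
Proof. by move=> st tx i j si; apply: tx; apply: leq_trans st. Qed.

Definition tot_fcomplex : fcomplex :=
  @FComplex (tot E) (@totd E) (@tot_deg E) (@tot_fil E) (@totdd E)
    tot_deg_sub tot_fil_sub tot_deg_d tot_fil_d (fun _ _ _ i0 => False_ind _ (notF i0))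
    tot_filW.

End TotComplex.

(** * Free modules over the group ring and comparison of resolutions *)

Section FreeModule.
Variables (p : nat) (M : cpmod p).

Definition cpspan (V : cpmod p) (I : eqType) (b : I -> V) (s : seq I)
    (c : I -> 'I_p -> int) : V :=
  \sum_(i <- s) \sum_(k < p) iter k (cpgen V) (b i) *~ c i k.

(** Two expansions are compared over a common list of basis elements, after
    extending their coefficients by zero. *)
Definition cutoff (I : eqType) (s : seq I) (c : I -> 'I_p -> int) i k : int :=
  if i \in s then c i k else 0.

Lemma cpspan_cutoff (V : cpmod p) (I : eqType) (b : I -> V) (s s' : seq I) c :
  uniq s -> uniq s' -> {subset s <= s'} ->
  cpspan b s c = cpspan b s' (cutoff s c).
Proof.
move=> us us' ss'; rewrite /cpspan [RHS](bigID (mem s)) /= [X in _ + X]big1.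
  rewrite addr0 -[in RHS]big_filter; symmetry.
  have pe : perm_eq [seq i <- s' | i \in s] s.
    apply: uniq_perm => //; first exact: filter_uniq.
    by move=> i; rewrite mem_filter andb_idr //; apply: ss'.
  rewrite (perm_big _ pe) big_seq [RHS]big_seq; apply: eq_bigr => i si.
  by rewrite /cutoff si.
by move=> i /negPf si; rewrite big1 // => k _; rewrite /cutoff si mulr0z.
Qed.

Lemma cpspanB (V : cpmod p) (I : eqType) (b : I -> V) (s : seq I) c c' :
  cpspan b s (fun i k => c i k - c' i k) = cpspan b s c - cpspan b s c'.
Proof.
rewrite /cpspan -sumrB; apply: eq_bigr => i _; rewrite -sumrB.
by apply: eq_bigr => k _; rewrite mulrzBr.
Qed.

Lemma cpspan_map (V U : cpmod p) (f : cphom V U) (I : eqType) (b : I -> V) s c :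
  f (cpspan b s c) = cpspan (f \o b) s c.
Proof.
rewrite /cpspan raddf_sum; apply: eq_bigr => i _; rewrite raddf_sum.
apply: eq_bigr => k _; rewrite raddfMz; congr (_ *~ _).
by elim: (k : nat) => //= n <-; rewrite cphomE.
Qed.

Lemma cpspan_gen (V : cpmod p) (I : eqType) (b : I -> V) s c :
  cpgen V (cpspan b s c) = cpspan b s (fun i k => c i (ord_pred k)).
Proof.
rewrite /cpspan raddf_sum; apply: eq_bigr => i _; rewrite raddf_sum.
rewrite [RHS](reindex_inj (can_inj (@ordSK p))); apply: eq_bigr => k _.
rewrite ordSK raddfMz -iterS; congr (_ *~ _) => /=.
have := ltn_ord k; rewrite leq_eqVlt => /orP[/eqP kp|kp].
  have -> : (k.+1 %% p)%N = 0%N by rewrite kp modnn.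
  by rewrite -iterS [RHS]/= -[RHS](cpgenX (b i)); move: kp; move: (k.+1) => m ->.
by rewrite modn_small.
Qed.

(** Free modules are projective: the lift prescribed on the basis does not depend
    on the expansion chosen for each element. *)
Lemma cpfree_lift (A B : cpmod p) (u : cphom M B) (v : cphom A B) :
  cpfree M -> (forall x, exists y, v y = u x) ->
  exists w : cphom M A, forall x, v (w x) = u x.
Proof.
move=> [I [b [gen ind]]] uv.
have /choice[a va] i : exists y, v y = u (b i) by apply: uv.
have /choice[s /choice[c sc]] x : exists s c, uniq s /\ x = cpspan b s c.
  exact: gen.
have wE x s' c' : uniq s' -> x = cpspan b s' c' ->
    cpspan a (s x) (c x) = cpspan a s' c'.
  move=> us' xE; have [us xE'] := sc x.
  pose t := undup (s x ++ s'); have ut : uniq t by apply: undup_uniq.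
  have st : {subset s x <= t} by move=> i si; rewrite mem_undup mem_cat si.
  have st' : {subset s' <= t} by move=> i si; rewrite mem_undup mem_cat si orbT.
  rewrite (cpspan_cutoff _ _ us ut st) (cpspan_cutoff _ _ us' ut st').
  rewrite /cpspan; apply: eq_big_seq => i ti; apply: eq_bigr => k _.
  congr (_ *~ _); apply/eqP; rewrite -subr_eq0; apply/eqP.
  apply: (ind t (fun i k => cutoff (s x) (c x) i k - cutoff s' c' i k)) => //.
  rewrite -[LHS]/(cpspan _ _ _) cpspanB -!cpspan_cutoff //.
  by rewrite -xE' -xE subrr.
pose w x := cpspan a (s x) (c x).
have wL : w \in @cplinear p M A.
  apply/asboolP; split=> [x y|x].
    have [ux xE] := sc x; have [uy yE] := sc y.
    pose t := undup (s x ++ s y); have ut : uniq t by apply: undup_uniq.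
    have st : {subset s x <= t} by move=> i si; rewrite mem_undup mem_cat si.
    have st' : {subset s y <= t} by move=> i si; rewrite mem_undup mem_cat si orbT.
    rewrite /w (cpspan_cutoff _ _ ux ut st) (cpspan_cutoff _ _ uy ut st').
    rewrite -cpspanB; apply: wE => //.
    by rewrite cpspanB -!cpspan_cutoff // -xE -yE.
  have [ux xE] := sc x; rewrite /w cpspan_gen; apply: wE => //.
  by rewrite -cpspan_gen -xE.
exists (CpHom wL) => x; rewrite [CpHom wL x]/(cpspan _ _ _) cpspan_map.
have [_ xE] := sc x; rewrite [in RHS]xE cpspan_map /cpspan.
by apply: eq_bigr => i _; apply: eq_bigr => k _; rewrite /= va.
Qed.

End FreeModule.

Lemma dependent_choice_seq (T : nat -> Type) (P : forall i, T i -> Prop)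
    (R : forall i, T i -> T i.+1 -> Prop) (t0 : T 0%N) :
  P 0%N t0 ->
  (forall i t, P i t -> exists t', P i.+1 t' /\ R i t t') ->
  exists f : forall i, T i, f 0%N = t0 /\ forall i, R i (f i) (f i.+1).
Proof.
move=> P0 step.
pose next i (t : {t | P i t}) : {t' | P i.+1 t'} :=
  let s := cid (step i (sval t) (svalP t)) in exist _ (sval s) (svalP s).1.
pose F := nat_rect (fun i => {t | P i t}) (exist _ t0 P0) next.
exists (fun i => sval (F i)); split=> // i.
by rewrite /= /next; case: cid => t' [].
Qed.

Section Comparison.
Variables (p : nat) (W W' : cpresolution p).

Definition chain_map (f : forall i, cphom (W i) (W' i)) : Prop :=
  (forall x, resaug W' (f 0%N x) = resaug W x) /\
  forall i x, resd W' i (f i.+1 x) = f i (resd W i x).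

Lemma res_dd (V : cpresolution p) i x : resd V i (resd V i.+1 x) = 0.
Proof. by apply/res_exact; exists x. Qed.

(** The comparison theorem: the next component exists because its source is free
    and the target resolution is exact. *)
Lemma chain_map_exists : exists f, chain_map f.
Proof.
have [f0 f0E] : exists f0 : cphom (W 0%N) (W' 0%N),
    forall x, resaug W' (f0 x) = resaug W x.
  by apply: cpfree_lift => [|x]; [exact: res_free|exact: resaug_surj].
pose P i (f : cphom (W i) (W' i)) := forall x, exists y, resd W' i y = f (resd W i x).
pose R i (f : cphom (W i) (W' i)) (f' : cphom (W i.+1) (W' i.+1)) :=
  forall x, resd W' i (f' x) = f (resd W i x).
have [||f [fE0 fE]] := @dependent_choice_seq _ P R f0.
- move=> x; apply/res_exact0; rewrite f0E; apply/res_exact0; by exists x.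
- move=> i f Pf; have [f' f'E] : exists f' : cphom (W i.+1) (W' i.+1),
      forall x, resd W' i (f' x) = cpcomp f (resd W i) x.
    by apply: cpfree_lift => //; apply: res_free.
  exists f'; split=> // x; apply/res_exact.
  by rewrite f'E /= res_dd raddf0.
- by exists f; split=> // x; rewrite fE0.
Qed.

Lemma chain_homotopy_exists f f' : chain_map f -> chain_map f' ->
  exists h : forall i, cphom (W i) (W' i.+1),
    (forall x, resd W' 0%N (h 0%N x) = f 0%N x - f' 0%N x) /\
    forall i x, resd W' i.+1 (h i.+1 x) =
      f i.+1 x - f' i.+1 x - h i (resd W i x).
Proof.
move=> [fa fd] [fa' fd'].
have [h0 h0E] : exists h0 : cphom (W 0%N) (W' 1%N),
    forall x, resd W' 0%N (h0 x) = (f 0%N - f' 0%N) x.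
  apply: cpfree_lift => [|x]; first exact: res_free.
  by apply/res_exact0; rewrite /= raddfB /= fa fa' subrr.
pose P i (h : cphom (W i) (W' i.+1)) := forall x, exists y,
  resd W' i.+1 y = f i.+1 x - f' i.+1 x - h (resd W i x).
pose R i (h : cphom (W i) (W' i.+1)) (h' : cphom (W i.+1) (W' i.+2)) :=
  forall x, resd W' i.+1 (h' x) = f i.+1 x - f' i.+1 x - h (resd W i x).
have [||h [hE0 hE]] := @dependent_choice_seq _ P R h0.
- move=> x; apply/res_exact.
  by rewrite !raddfB /= fd fd' h0E /= subrr.
- move=> i h Ph; have [h' h'E] : exists h' : cphom (W i.+1) (W' i.+2),
      forall x, resd W' i.+1 (h' x) = (f i.+1 - f' i.+1 - cpcomp h (resd W i)) x.
    by apply: cpfree_lift => //; apply: res_free.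
  have {}h'E y : resd W' i.+1 (h' y) = f i.+1 y - f' i.+1 y - h (resd W i y).
    exact: h'E.
  exists h'; split=> // x; apply/res_exact.
  by rewrite !raddfB /= fd fd' h'E /= res_dd raddf0 subr0 subrr.
- by exists h; split=> // x; rewrite hE0 h0E.
Qed.

End Comparison.

(** * The norm and the difference operator of a cyclic group *)

Section NormDifference.
Variables (p : nat) (V : cpmod p).
Local Notation t := (cpgen V).

Definition geom (l : nat) (x : V) : V := \sum_(q < l) iter q t x.

(** The two differentials of the periodic resolution: [t - 1] and the norm. *)
Definition hop (b : bool) (x : V) : V := if b then geom p x else t x - x.
Arguments hop : simpl never.

Lemma iter_cpgenB l : {morph iter l t : x y / x - y}.
Proof. by move=> x y; elim: l => //= l ->; rewrite raddfB. Qed.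
HB.instance Definition _ l :=
  GRing.isZmodMorphism.Build V V (iter l t) (@iter_cpgenB l).

Lemma geomB l : {morph geom l : x y / x - y}.
Proof. by move=> x y; rewrite /geom -sumrB; apply: eq_bigr => q _; rewrite raddfB. Qed.
HB.instance Definition _ l := GRing.isZmodMorphism.Build V V (geom l) (@geomB l).

Lemma hopB b : {morph hop b : x y / x - y}.
Proof. by move=> x y; rewrite /hop; case: b; rewrite !raddfB //=; abel. Qed.
HB.instance Definition _ b := GRing.isZmodMorphism.Build V V (hop b) (@hopB b).

Lemma hop0 b : hop b 0 = 0. Proof. exact: raddf0. Qed.
Lemma hopN b x : hop b (- x) = - hop b x. Proof. exact: raddfN. Qed.
Lemma hopD b x y : hop b (x + y) = hop b x + hop b y. Proof. exact: raddfD. Qed.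
Lemma hopMz b x n : hop b (x *~ n) = hop b x *~ n. Proof. exact: raddfMz. Qed.
Lemma hopMn b x n : hop b (x *+ n) = hop b x *+ n. Proof. exact: raddfMn. Qed.
Lemma hop_sum b (I : Type) (r : seq I) (F : I -> V) :
  hop b (\sum_(i <- r) F i) = \sum_(i <- r) hop b (F i).
Proof. exact: raddf_sum. Qed.

Lemma geom_cpgen l x : t (geom l x) = geom l (t x).
Proof. by rewrite raddf_sum; apply: eq_bigr => q _; rewrite -iterS iterSr. Qed.

Lemma geomS l x : geom l.+1 x = geom l x + iter l t x.
Proof. exact: big_ord_recr. Qed.

Lemma geom_diff l x : t (geom l x) - geom l x = iter l t x - x.
Proof.
elim: l => [|l IH]; first by rewrite /geom !big_ord0 raddf0 !subrr.
rewrite geomS raddfD -[t (geom l x)](subrK (geom l x)) IH iterS; abel.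
Qed.

Lemma hop_cpgen b x : t (hop b x) = hop b (t x).
Proof. by case: b; rewrite /hop ?geom_cpgen // raddfB. Qed.

Lemma geom_fixed l x : t x = x -> geom l x = x *+ l.
Proof.
move=> tx; rewrite /geom (eq_bigr (fun=> x)) ?sumr_const ?card_ord // => q _.
by elim: (q : nat) => //= k ->.
Qed.

Lemma hop_hop b x : hop b (hop (~~ b) x) = 0.
Proof.
have tg : t (geom p x) = geom p x.
  by apply/eqP; rewrite -subr_eq0 geom_diff cpgenX subrr.
case: b; rewrite /hop /= ?raddfB /= -?geom_cpgen tg; exact: subrr.
Qed.

(** The group order annihilates the kernel of one operator modulo the image of
    the other, by an explicit element. *)
Definition hop_div (b : bool) (x : V) : V :=
  if b then - \sum_(l < p) geom l x else x.

Lemma hop_divE b x : hop b x = 0 -> x *+ p = hop (~~ b) (hop_div b x).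
Proof.
case: b => /= [Nx|/subr0_eq tx]; last by rewrite /hop geom_fixed.
rewrite hopN hop_sum.
rewrite (eq_bigr (fun l : 'I_p => iter l t x - x)); last first.
  by move=> l _; rewrite -geom_diff.
rewrite sumrB sumr_const card_ord.
by move: Nx; rewrite /hop /geom => ->; rewrite sub0r opprK.
Qed.

(** When the identity is the norm of an endomorphism [f], the kernel of either
    operator is the image of the other. *)
Variable f : {additive V -> V}.

Definition norm_one (x : V) : Prop :=
  \sum_(l < p) iter l t (f (iter (p - l) t x)) = x.

Definition hop_lift (b : bool) (x : V) : V :=
  if b then \sum_(l < p) geom l (f (iter (p - l) t x)) else f x.

Lemma hop_liftB b : {morph hop_lift b : x y / x - y}.
Proof.
move=> x y; rewrite /hop_lift; case: b; rewrite ?raddfB // -sumrB.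
by apply: eq_bigr => l _; rewrite !raddfB.
Qed.

Lemma hop_liftE b x : norm_one x -> hop b x = 0 -> hop (~~ b) (hop_lift b x) = x.
Proof.
move=> nx; case: b => /= [Nx|/subr0_eq tx]; last first.
  rewrite -[RHS]nx /hop /geom; apply: eq_bigr => l _; congr (iter _ _ (f _)).
  by elim: (p - l)%N => //= k <-.
rewrite hop_sum (eq_bigr (fun l : 'I_p =>
    iter l t (f (iter (p - l) t x)) - f (iter (p - l) t x))); last first.
  by move=> l _; rewrite -geom_diff.
rewrite sumrB nx -raddf_sum.
have -> : \sum_(l < p) iter (p - l) t x = t (geom p x).
  rewrite /geom raddf_sum (reindex_inj rev_ord_inj) /=; apply: eq_bigr => l _.
  by rewrite subKn.
by move: Nx; rewrite /hop => ->; rewrite !raddf0 addr0.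
Qed.

End NormDifference.

Lemma iter_cphom p (V U : cpmod p) (f : cphom V U) l x :
  f (iter l (cpgen V) x) = iter l (cpgen U) (f x).
Proof. by elim: l => //= l <-; rewrite cphomE. Qed.

Lemma geom_cphom p (V U : cpmod p) (f : cphom V U) l x :
  f (geom l x) = geom l (f x).
Proof. by rewrite raddf_sum; apply: eq_bigr => q _; apply: iter_cphom. Qed.

Lemma hop_cphom p (V U : cpmod p) (f : cphom V U) b x :
  f (hop b x) = hop b (f x).
Proof. by case: b; rewrite /hop ?geom_cphom // cphomB cphomE. Qed.

Lemma hop_div_cphom p (V U : cpmod p) (f : cphom V U) b x :
  f (hop_div b x) = hop_div b (f x).
Proof.
case: b => //=; rewrite raddfN raddf_sum; congr (- _).
by apply: eq_bigr => l _; apply: geom_cphom.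
Qed.

Lemma hop_linear p (V : cpmod p) b : @hop p V b \in @cplinear p V V.
Proof. by apply/asboolP; split=> [x y|x]; rewrite ?hopB ?hop_cpgen. Qed.

(** * The periodic resolution *)

Section PeriodicResolution.
Variable p : nat.

Definition zcp := {ffun 'I_p -> int}.
Definition zcp_rot (x : zcp) : zcp := [ffun i => x (ord_pred i)].

Lemma zcp_rotB : {morph zcp_rot : x y / x - y}.
Proof. by move=> x y; apply/ffunP => i; rewrite !ffunE. Qed.
HB.instance Definition _ := GRing.isZmodMorphism.Build zcp zcp zcp_rot zcp_rotB.

Lemma iter_zcp_rot l x i : iter l zcp_rot x i = x (iter l (@ord_pred p) i).
Proof. by elim: l i => //= l IH i; rewrite ffunE IH -iterSr. Qed.

Lemma val_iter_ord_pred l (i : 'I_p) :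
  (l <= p)%N -> iter l (@ord_pred p) i = ((i + (p - l)) %% p)%N :> nat.
Proof.
elim: l => [|l IH] lp /=; first by rewrite subn0 modnDr modn_small.
rewrite IH ?(ltnW lp) //.
have -> : (((i + (p - l)) %% p + p).-1 = (i + (p - l)) %% p + p.-1)%N.
    by have := ltn_ord i; lia.
rewrite modnDml -[RHS](modnDr _ p); congr modn; have := ltn_ord i; lia.
Qed.

Lemma zcp_rotX x : iter p zcp_rot x = x.
Proof.
apply/ffunP => i; rewrite iter_zcp_rot; congr (x _); apply: val_inj.
by rewrite /= val_iter_ord_pred // subnn addn0 modn_small.
Qed.

Definition zcp_mod : cpmod p := @CpMod p zcp zcp_rot zcp_rotX.

Definition zcp1 : zcp := [ffun i : 'I_p => (i == 0%N :> nat)%:Z].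

Lemma iter_ord_pred_eq0 (l i : 'I_p) :
  (iter l (@ord_pred p) i == 0%N :> nat) = (l == i).
Proof.
rewrite val_iter_ord_pred ?(ltnW (ltn_ord l)) //.
have := ltn_ord i; have := ltn_ord l.
rewrite -val_eqE /=; have [li|il] := leqP l i => lp ip.
  have -> : (i + (p - l) = i - l + p)%N by lia.
  by rewrite modnDr modn_small; lia.
by rewrite modn_small; lia.
Qed.

Lemma iter_zcp1 (l i : 'I_p) : iter l zcp_rot zcp1 i = (l == i)%:Z.
Proof. by rewrite iter_zcp_rot ffunE iter_ord_pred_eq0. Qed.

Lemma zcp_expand (x : zcp) : x = \sum_(l < p) iter l zcp_rot zcp1 *~ x l.
Proof.
apply/ffunP => i; rewrite sum_ffunE (bigD1 i) //= big1 => [|l /negPf li].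
  by rewrite addr0 ffunMzE iter_zcp1 eqxx intz.
by rewrite ffunMzE iter_zcp1 li mul0rz.
Qed.

(** The coefficient of the unit; its conjugates sum to the identity. *)
Definition zcp_proj (x : zcp) : zcp :=
  [ffun i : 'I_p => if i == 0%N :> nat then x i else 0].

Lemma zcp_projB : {morph zcp_proj : x y / x - y}.
Proof. by move=> x y; apply/ffunP => i; rewrite !ffunE; case: ifP; rewrite ?subr0. Qed.
HB.instance Definition _ := GRing.isZmodMorphism.Build zcp zcp zcp_proj zcp_projB.

Lemma zcp_norm_one (x : zcp_mod) : norm_one (V := zcp_mod) zcp_proj x.
Proof.
apply/ffunP => i; rewrite sum_ffunE.
rewrite (eq_bigr (fun l : 'I_p => if l == i then x i else 0)); last first.
  move=> l _; rewrite iter_zcp_rot ffunE iter_ord_pred_eq0; case: eqP => // _.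
  rewrite -iter_zcp_rot -iterD subnKC ?(ltnW (ltn_ord l)) //.
  by rewrite zcp_rotX.
by rewrite -big_mkcond big_pred1_eq.
Qed.

(** The group ring is free over itself, so [zcp_norm_one] makes the periodic
    complex exact. *)
Lemma zcp_exact b (x : zcp_mod) :
  hop b x = 0 <-> exists y : zcp_mod, hop (~~ b) y = x.
Proof.
split=> [bx|[y <-]]; last exact: hop_hop.
by exists (hop_lift (V := zcp_mod) zcp_proj b x); apply: hop_liftE => //; apply: zcp_norm_one.
Qed.

Lemma zcp_aug_linear :
  (fun x : zcp_mod => \sum_i x i : trivZ p) \in @cplinear p zcp_mod (trivZ p).
Proof.
apply/asboolP; split=> [x y|x].
  by rewrite -sumrB; apply: eq_bigr => i _; rewrite !ffunE.
rewrite [RHS](reindex_inj (can_inj (@ord_predK p))).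
by apply: eq_bigr => i _; rewrite ffunE.
Qed.
Definition zcp_aug := CpHom zcp_aug_linear.

Lemma norm_zcp (x : zcp_mod) : hop true x = [ffun=> zcp_aug x].
Proof.
have N1 : hop true (zcp1 : zcp_mod) = [ffun=> 1].
  apply/ffunP => i; rewrite sum_ffunE ffunE (bigD1 i) //= big1 => [|l /negPf li].
    by rewrite iter_zcp1 eqxx.
  by rewrite iter_zcp1 li.
have Nl l : hop true (iter l (cpgen zcp_mod) zcp1) = [ffun=> 1].
  elim: l => [|l IH]; first exact: N1.
  rewrite iterS -hop_cpgen IH.
  by apply/ffunP => i; rewrite !ffunE.
rewrite {1}(zcp_expand x) hop_sum; apply/ffunP => i; rewrite sum_ffunE ffunE.
by apply: eq_bigr => l _; rewrite hopMz Nl ffunMzE ffunE intz.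
Qed.

Lemma zcp_free : cpfree zcp_mod.
Proof.
exists unit, (fun=> zcp1); split=> [x|s c us s0 [] k si].
  exists [:: tt], (fun _ k => x k); split=> //.
  by rewrite big_seq1; apply: zcp_expand.
move: s0; case: s us si => [|[] [|[] s]] //= _ _; rewrite big_seq1.
move=> /(congr1 (fun x : zcp => x k)); rewrite sum_ffunE ffunE (bigD1 k) //=.
rewrite big1 => [|l /negPf li]; last by rewrite ffunMzE iter_zcp1 li mul0rz.
by rewrite addr0 ffunMzE iter_zcp1 eqxx intz.
Qed.

Variable p_gt0 : (0 < p)%N.

Lemma zcp_aug_surj (z : int) : exists x, zcp_aug x = z.
Proof.
exists (zcp1 *~ z); rewrite raddfMz /= (bigD1 (Ordinal p_gt0)) //= big1 ?addr0.
  by rewrite ffunE eqxx /= intz.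
by move=> i /negPf i0; rewrite ffunE; move: i0; rewrite -val_eqE /= => ->.
Qed.

Lemma zcp_exact0 (x : zcp_mod) :
  zcp_aug x = 0 <-> exists y : zcp_mod, hop false y = x.
Proof.
rewrite -(zcp_exact true) norm_zcp; split=> [->|/ffunP/(_ (Ordinal p_gt0))].
  by apply/ffunP => i; rewrite !ffunE.
by rewrite !ffunE.
Qed.

Definition periodic_resolution : cpresolution p :=
  @CpResolution p (fun=> zcp_mod) (fun i => CpHom (hop_linear zcp_mod (odd i)))
    zcp_aug (fun=> zcp_free) zcp_aug_surj zcp_exact0
    (fun i => zcp_exact (odd i)).

End PeriodicResolution.
(** * Independence of the resolution *)

Lemma cphom_sumE p (V U : cpmod p) (f f' : cphom V U) x :
  (f + f') x = f x + f' x.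
Proof. by []. Qed.
Lemma cphom_oppE p (V U : cpmod p) (f : cphom V U) x : (- f) x = - f x.
Proof. by []. Qed.
Lemma cphom_MzE p (V U : cpmod p) (f : cphom V U) n x : (f *~ n) x = f x *~ n.
Proof.
have MnE m : (f *+ m) x = f x *+ m by elim: m => // m IH; rewrite !mulrS -IH.
by case: n => n; [exact: MnE|rewrite !NegzE !mulrNz cphom_oppE; congr (- _); apply: MnE].
Qed.

Lemma hom_totdE p (W : cpresolution p) (D : cpcomplex p)
    (x : tot (hom_bicomplex W D)) i j (w : W i) :
  (totd x i j : cphom (W i) (D j)) w =
    match i return W i -> D j with
    | 0%N => fun=> 0
    | i'.+1 => fun w => x i' j (resd W i' w)
    end w + cxd D j (x i (j - 1) w) *~ (-1) ^+ i.
Proof.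
rewrite /totd; etransitivity; first exact: cphom_sumE.
congr (_ + _); last exact: (cphom_MzE (hom_v (x i (j - 1)))).
by case: i w.
Qed.

Section ChangeResolution.
Variables (p : nat) (D : cpcomplex p).

Definition hom_pull (W W' : cpresolution p) (f : forall i, cphom (W' i) (W i))
    (x : tot (hom_bicomplex W D)) : tot (hom_bicomplex W' D) :=
  fun i j => cpcomp (x i j) (f i).

Lemma hom_pull_map (W W' : cpresolution p) (f : forall i, cphom (W' i) (W i)) :
  chain_map f ->
  @filtered_map (tot_fcomplex (hom_bicomplex W D))
    (tot_fcomplex (hom_bicomplex W' D)) (hom_pull f).
Proof.
move=> [fa fd]; split=> [x y|x|m x mx i j ij|s x sx i j si].
- by apply: tot_ext => i j; apply: cphom_ext.
- apply: tot_ext => i j; apply: cphom_ext => w.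
  rewrite [RHS]hom_totdE [LHS](hom_totdE x); congr (_ + _).
  by case: i w => [//|i] w; rewrite fd.
- by rewrite /hom_pull (mx _ _ ij); apply: cphom_ext.
- by rewrite /hom_pull (sx _ _ si); apply: cphom_ext.
Qed.

Definition hom_shift (W : cpresolution p) (h : forall i, cphom (W i) (W i.+1))
    (x : tot (hom_bicomplex W D)) : tot (hom_bicomplex W D) :=
  fun i j => cpcomp (x i.+1 j) (h i).

Lemma hom_shift_homotopy (W : cpresolution p) (f : forall i, cphom (W i) (W i))
    (h : forall i, cphom (W i) (W i.+1)) :
  (forall x, resd W 0%N (h 0%N x) = f 0%N x - x) ->
  (forall i x, resd W i.+1 (h i.+1 x) = f i.+1 x - x - h i (resd W i x)) ->
  @filtered_homotopy (tot_fcomplex (hom_bicomplex W D)) (hom_pull f) (hom_shift h).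
Proof.
move=> h0 hE; split=> [|m x mx i j ij|s x sx i j si|x].
- by apply: tot_ext => i j; apply: cphom_ext.
- by rewrite /hom_shift mx; [apply: cphom_ext|lia].
- by rewrite /hom_shift sx; [apply: cphom_ext|lia].
- apply: tot_ext => i j; apply: cphom_ext => w.
  rewrite -[RHS]/(totd (hom_shift h x) i j w + totd x i.+1 j (h i w)).
  rewrite -[LHS]/(x i j (f i w) - x i j w).
  rewrite !hom_totdE exprS mulN1r mulrNz.
  have key0 (a c : D j) : a = 0 + c + (a - c) by abel.
  have key (a b c : D j) : a = b + c + (a - b - c) by abel.
  case: i w => [|i] w; first by rewrite h0 !cphomB; apply: key0.
  by rewrite hE !cphomB; apply: key.
Qed.

Lemma id_cplinear (V : cpmod p) : (fun x => x) \in @cplinear p V V.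
Proof. by apply/asboolP. Qed.

(** Precomposition with chain maps between the resolutions, and with homotopies
    from their composites to the identities, which shift the columns by one. *)
Lemma change_resolution (W W' : cpresolution p) :
  filtered_equiv (tot_fcomplex (hom_bicomplex W D))
    (tot_fcomplex (hom_bicomplex W' D)).
Proof.
have hpt (V V' : cpresolution p) (f : forall i, cphom (V' i) (V i))
    (g : forall i, cphom (V i) (V' i)) : chain_map f -> chain_map g ->
    exists h, @filtered_homotopy (tot_fcomplex (hom_bicomplex V D))
      (hom_pull g \o hom_pull f) h.
  move=> [fa fd] [ga gd].
  have cid : chain_map (fun i => CpHom (id_cplinear (V i))) by [].
  have cfg : chain_map (fun i => cpcomp (f i) (g i)).
    by split=> [x|i x] /=; rewrite ?fa ?fd ?gd.
  have [h [h0 hE]] := chain_homotopy_exists cfg cid.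
  exists (hom_shift h).
  have <- : hom_pull (fun i => cpcomp (f i) (g i)) = hom_pull g \o hom_pull f.
    by apply: funext => x; apply: tot_ext => i j; apply: cphom_ext.
  exact: (hom_shift_homotopy h0 hE).
have [f cf] := chain_map_exists W' W; have [g cg] := chain_map_exists W W'.
have [h hh] := hpt _ _ _ _ cf cg; have [k hk] := hpt _ _ _ _ cg cf.
exists (hom_pull f), (hom_pull g), h, k.
by split=> //; apply: hom_pull_map.
Qed.

End ChangeResolution.

(** * The Koszul complex *)

Section Koszul.
Variables p n : nat.
Local Notation C := (Cn0 n).
Local Notation word := (word p C).

HB.instance Definition _ :=
  GRing.isZmodMorphism.Build (tens p C) (tens p C) (@tens_rot p C) (@tens_rotB p C).

Definition koszul : cpmod p := @CpMod p (tens p C) (@tens_rot p C) (@tens_rotX p C).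
Local Notation L := koszul.

Definition setw (w : word) (i : 'I_p) (b : bool) : word :=
  [ffun k => if k == i then b else w k].

Definition psgn (w : word) (i : 'I_p) : int :=
  Defs.sgz1 (\sum_(k < p | (k < i)%N) bdeg (w k)).

(** The differential of the tensor power of [C(1,0)], which is the contraction
    of the exterior algebra of [Z^p] with [(1, ..., 1)]. *)
Definition bdry (x : L) : L :=
  [ffun w : word => \sum_(i | ~~ (w i : bool)) psgn w i * x (setw w i true)].

Lemma bdryB : {morph bdry : x y / x - y}.
Proof.
move=> x y; apply/ffunP => w; rewrite !ffunE -sumrB.
by apply: eq_bigr => i _; rewrite !ffunE mulrBr.
Qed.
HB.instance Definition _ := GRing.isZmodMorphism.Build L L bdry bdryB.

Lemma bdry0 : bdry 0 = 0. Proof. exact: raddf0. Qed.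
Lemma bdryD x y : bdry (x + y) = bdry x + bdry y. Proof. exact: raddfD. Qed.
Lemma bdryN x : bdry (- x) = - bdry x. Proof. exact: raddfN. Qed.
Lemma bdryMn x m : bdry (x *+ m) = bdry x *+ m. Proof. exact: raddfMn. Qed.
Lemma bdryMz x m : bdry (x *~ m) = bdry x *~ m. Proof. exact: raddfMz. Qed.

Lemma psgn_setw (w : word) i b : psgn (setw w i b) i = psgn w i.
Proof.
rewrite /psgn; congr Defs.sgz1; apply: eq_bigr => k ki; rewrite ffunE.
by case: eqP ki => // ->; rewrite ltnn.
Qed.

Lemma tens_difE (x : L) : tens_dif x = bdry x *+ n.
Proof.
apply/ffunP => w; rewrite ffunMnE !ffunE -sumrMnl.
under eq_bigr do rewrite /wdif mulr_sumr.
rewrite exchange_big [RHS]big_mkcond /=; apply: eq_bigr => i _.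
have at0 u : u != setw w i true -> wdif_at u w i = 0.
  move=> nu; apply/eqP; apply: contraNT nu => /[dup] nz /wdif_at_deg[_ ag _].
  apply/eqP/ffunP => k; rewrite ffunE; case: eqP => [->|/eqP ki]; last exact: ag.
  move: nz; rewrite /wdif_at /= /Cn0_dif; case: (u i : bool) => //=.
  by rewrite mulr0 mul0r eqxx.
rewrite (bigD1 (setw w i true)) //= big1 ?addr0; last first.
  by move=> u /at0 ->; rewrite mulr0.
have -> : wdif_at (setw w i true) w i =
    psgn w i * (if ~~ (w i : bool) then n%:Z else 0).
  rewrite /wdif_at -/(psgn _ i) psgn_setw ffunE eqxx /=.
  have -> : [forall k, (k != i) ==> (setw w i true k == w k)].
    by apply/forallP => k; apply/implyP => /negPf ki; rewrite ffunE ki.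
  by rewrite mulr1.
case: (w i : bool) => /=; first by rewrite !mulr0.
by rewrite mulrA [x _ * _]mulrC -[in LHS]natz mulr_natr.
Qed.

Lemma koszul_MnI (x : L) m : (0 < m)%N -> x *+ m = 0 -> x = 0.
Proof.
move=> m0 /ffunP xm; apply/ffunP => w; have := xm w.
rewrite ffunMnE !ffunE => /eqP.
by rewrite mulrn_eq0 => /orP[/eqP|/eqP//]; lia.
Qed.

Lemma koszul_MnI2 (x y : L) m : (0 < m)%N -> x *+ m = y *+ m -> x = y.
Proof.
by move=> m0 /eqP; rewrite -subr_eq0 -mulrnBl => /eqP/(koszul_MnI m0)/subr0_eq.
Qed.

Lemma tens_difMn (x : L) m : tens_dif (x *+ m) = tens_dif x *+ m.
Proof. by rewrite !tens_difE raddfMn /= mulrnAC. Qed.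

(** ** The grading *)

Lemma grade_cpgen j (x : L) : x \in homog j -> cpgen L x \in homog j.
Proof. by move=> xj; apply: (tens_rot_homog (Tensor xj)). Qed.

Lemma grade_iter j l (x : L) : x \in homog j -> iter l (cpgen L) x \in homog j.
Proof. by move=> xj; elim: l => //= l IH; apply: grade_cpgen. Qed.

Lemma grade_sum j (I : Type) (r : seq I) (F : I -> L) :
  (forall i, F i \in homog j) -> \sum_(i <- r) F i \in homog j.
Proof. by move=> Fj; apply: rpred_sum. Qed.

Lemma grade_geom j l (x : L) : x \in homog j -> geom l x \in homog j.
Proof. by move=> xj; apply: grade_sum => q; apply: grade_iter. Qed.

Lemma grade_hop j b (x : L) : x \in homog j -> hop b x \in homog j.
Proof.
move=> xj; case: b; first exact: grade_geom.
by rewrite /hop rpredB // grade_cpgen.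
Qed.

Lemma grade_hop_div j b (x : L) : x \in homog j -> hop_div b x \in homog j.
Proof.
move=> xj; rewrite /hop_div; case: b => //.
by rewrite rpredN grade_sum // => l; apply: grade_geom.
Qed.

Lemma wdeg_setw (w : word) i :
  ~~ (w i : bool) -> wdeg (setw w i true) = wdeg w - 1.
Proof.
move=> wi; rewrite /wdeg (bigD1 i) //= [in RHS](bigD1 i) //= ffunE eqxx.
rewrite (negPf wi) add0r addrC; congr (_ + _); apply: eq_bigr => k /negPf ki.
by rewrite ffunE ki.
Qed.

Lemma grade_bdry j (x : L) : x \in homog (j - 1) -> bdry x \in homog j.
Proof.
move=> /homogP xj; apply/homogP => w; rewrite ffunE => s0.
have [i wi xi] : exists2 i, ~~ (w i : bool) & x (setw w i true) != 0.
  have [/existsP[i /andP[wi xi]]|] :=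
    boolP [exists i, ~~ (w i : bool) && (x (setw w i true) != 0)].
    by exists i.
  rewrite negb_exists => /forallP a; case/eqP: s0; rewrite big1 // => i wi.
  by have := a i; rewrite wi negbK => /eqP ->; rewrite mulr0.
by have := xj _ xi; rewrite wdeg_setw //; lia.
Qed.

Definition wcard (w : word) : nat := #|[set i | (w i : bool)]|.

Lemma wdegE (w : word) : wdeg w = - (wcard w)%:Z.
Proof.
have -> : (wcard w)%:Z = \sum_i (w i : bool)%:Z.
  rewrite /wcard -sum1dep_card big_mkcond /=.
  rewrite (big_morph Posz PoszD (erefl : Posz 0 = 0)).
  by apply: eq_bigr => i _; case: (w i : bool).
by rewrite -sumrN; apply: eq_bigr => i _ /=; rewrite /Cn0_deg; case: (w i : bool).
Qed.

Lemma wcard_le (w : word) : (wcard w <= p)%N.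
Proof. by rewrite -[X in (_ <= X)%N]card_ord max_card. Qed.

Lemma grade_out j (x : L) : x \in homog j -> ~~ (- p%:Z <= j <= 0) -> x = 0.
Proof.
move=> /homogP xj jp; apply/ffunP => w; rewrite ffunE; apply/eqP.
by apply: contraNT jp => /xj <-; rewrite wdegE; have := wcard_le w; lia.
Qed.

Section Equivariance.
Variable n_gt0 : (0 < n)%N.

(** The identities for [bdry] are those for the differential of the tensor power,
    which is [n] times [bdry], in a torsion-free group. *)
Lemma bdry_bdry x : bdry (bdry x) = 0.
Proof.
apply: (koszul_MnI n_gt0); apply: (koszul_MnI n_gt0).
by rewrite -tens_difE -tens_difMn -tens_difE tens_difdif.
Qed.

Lemma bdry_linear : bdry \in @cplinear p L L.
Proof.
apply/asboolP; split=> [x y|x]; first exact: bdryB.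
apply: (koszul_MnI2 n_gt0); rewrite -tens_difE tens_dif_rot tens_difE.
by rewrite [LHS]raddfMn.
Qed.
Definition koszul_d : cphom L L := CpHom bdry_linear.

Lemma hop_bdry b x : bdry (hop b x) = hop b (bdry x).
Proof. exact: (hop_cphom koszul_d). Qed.

End Equivariance.

Variable p_gt0 : (0 < p)%N.

(** A rotation moves the last of [p] generators of degree [- 1] past the [p - 1]
    others, with sign [1] as [p] is odd. *)
Lemma koszul_fixed j (x : L) : odd p -> x \in homog j -> (j == 0) || (j == - p%:Z) ->
  cpgen L x = x.
Proof.
move=> p_odd /homogP xj jE; apply/ffunP => w; rewrite ffunE.
have [wj|nwj] := eqVneq (wdeg w) j; last first.
  have x0 u : wdeg u = wdeg w -> x u = 0.
    by move=> uw; apply/eqP; apply: contraNT nwj => /xj <-; rewrite uw.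
  by rewrite !x0 ?mulr0 ?wdeg_unrotw.
pose b : bool := (j != 0).
have wb i : w i = b.
  move: wj; rewrite wdegE => wj; rewrite /b.
  have [j0|/negPf nj0] := eqVneq j 0; last first.
    move: jE; rewrite nj0 /= => /eqP jp.
    have wp : wcard w = p by lia.
    have /eqP/setP/(_ i) : [set i | (w i : bool)] == setT.
      by rewrite eqEcard subsetT cardsT card_ord -/(wcard w) wp leqnn.
    by rewrite !inE.
  have w0 : wcard w = 0%N by lia.
  have /eqP := w0; rewrite /wcard cards_eq0 => /eqP/setP/(_ i).
  by rewrite !inE.
have -> : unrotw w = w by apply/ffunP => i; rewrite ffunE !wb.
suff -> : Defs.sgz1 (rot_exp w) = 1 by rewrite mul1r.
have p0 : (p.-1 < p)%N by rewrite prednK.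
rewrite rot_expE (big_pred1 (Ordinal p0)) => [|i]; last first.
  apply/eqP/eqP => [ip|->] /=; last by rewrite prednK.
  by apply: val_inj => /=; lia.
rewrite wj wb /b /= /Cn0_deg; case: eqP jE => [->//|_ /= /eqP ->].
rewrite /Defs.sgz1 -signr_odd (_ : odd _ = false) //; lia.
Qed.

(** ** Exactness *)

Let o : 'I_p := Ordinal p_gt0.

(** Multiplication by the first exterior generator, a contracting homotopy. *)
Definition cone (x : L) : L :=
  [ffun w : word => if (w o : bool) then x (setw w o false) else 0].

Lemma coneB : {morph cone : x y / x - y}.
Proof. by move=> x y; apply/ffunP => w; rewrite !ffunE; case: ifP; rewrite ?subr0. Qed.
HB.instance Definition _ := GRing.isZmodMorphism.Build L L cone coneB.

Lemma grade_cone j (x : L) : x \in homog j -> cone x \in homog (j - 1).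
Proof.
move=> /homogP xj; apply/homogP => w; rewrite ffunE.
have [wo|//] := boolP (w o : bool); move=> /xj <-.
have e : setw (setw w o false) o true = w.
  apply/ffunP => k; rewrite !ffunE; case: eqP => // ->.
  by rewrite -[LHS]/true; case: (w o : bool) wo.
by rewrite -[in LHS]e wdeg_setw // ffunE eqxx.
Qed.

Lemma bdry_cone x : bdry (cone x) + cone (bdry x) = x.
Proof.
apply/ffunP => w; rewrite !ffunE.
have psgn_o (u : word) : psgn u o = 1 by rewrite /psgn big_pred0.
have [wo|wo] := boolP (w o : bool); last first.
  rewrite addr0 (bigD1 o) //= psgn_o mul1r !ffunE eqxx big1 ?addr0.
    congr (x _); apply/ffunP => k; rewrite !ffunE; case: eqP => // ->.
    by case: (w o : bool) wo.
  move=> i /andP[wi io]; rewrite !ffunE eq_sym (negPf io) (negPf wo).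
  by rewrite mulr0.
rewrite [X in _ + X](bigD1 o) /=; last by rewrite ffunE eqxx.
rewrite psgn_o mul1r addrCA [X in _ + X](_ : _ = 0) ?addr0.
  congr (x _); apply/ffunP => k; rewrite !ffunE; case: eqP => // ->.
  by case: (w o : bool) wo.
rewrite [X in _ + X](eq_bigl (fun i => ~~ (w i : bool))) -?big_split /=; last first.
  move=> i; rewrite ffunE; case: eqP => [->|_]; last by rewrite andbT.
  by rewrite wo andbF.
rewrite big1 // => i wi.
have io : i != o by apply: contraNneq wi => ->.
rewrite ffunE ffunE eq_sym (negPf io) wo.
have -> : setw (setw w i true) o false = setw (setw w o false) i true.
  apply/ffunP => k; rewrite !ffunE.
  by case: eqP => [->|//]; rewrite eq_sym (negPf io).
suff -> : psgn (setw w o false) i = - psgn w i by rewrite mulNr subrr.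
rewrite /psgn (bigD1 o) /=; last by rewrite lt0n.
rewrite [in RHS](bigD1 o) /=; last by rewrite lt0n.
rewrite ffunE eqxx /= /Cn0_deg wo add0r sgz1D mulN1r opprK; congr Defs.sgz1.
by apply: eq_bigr => k /andP[_ /negPf ko]; rewrite ffunE ko.
Qed.

(** ** Freeness of the inner terms *)

(** The rotation changes the sum of the positions of the generator of degree
    [- 1] by their number. If [p] does not divide the latter, then the words
    whose sum is divisible by [p] represent the orbits of rotation. *)
Definition wsum (w : word) : nat := \sum_(i | (w i : bool)) i.

Definition wproj (x : L) : L := [ffun w => if (p %| wsum w)%N then x w else 0].

Lemma wprojB : {morph wproj : x y / x - y}.
Proof. by move=> x y; apply/ffunP => w; rewrite !ffunE; case: ifP; rewrite ?subr0. Qed.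
HB.instance Definition _ := GRing.isZmodMorphism.Build L L wproj wprojB.

Lemma wcard_unrotw w : wcard (unrotw w) = wcard w.
Proof. by have := wdeg_unrotw w; rewrite !wdegE; lia. Qed.

Lemma wsum_unrotw w : (wsum (unrotw w) + wcard w = wsum w %[mod p])%N.
Proof.
rewrite -wcard_unrotw /wcard -sum1dep_card /wsum -big_split /=.
rewrite [in RHS](reindex_inj (can_inj (@ordSK p))).
rewrite (eq_bigl (fun i => (w (ordS i) : bool))); last by move=> i; rewrite ffunE.
rewrite -modn_summ [in RHS]/= -[RHS]modn_summ; congr modn.
by apply: eq_bigr => i _; rewrite addn1 modn_mod.
Qed.

Lemma wsum_iter l w : (wsum (iter l (@unrotw p C) w) + l * wcard w = wsum w %[mod p])%N.
Proof.
elim: l => [|l IH]; first by rewrite mul0n addn0.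
have wc : wcard (iter l (@unrotw p C) w) = wcard w.
  by elim: (l) => //= k; rewrite wcard_unrotw.
rewrite iterS -IH mulSn addnA -modnDml; rewrite -{1}wc wsum_unrotw modnDml //.
Qed.

(** Modulo [p], the sums of the rotates of a word are an arithmetic progression
    with an invertible step. *)
Lemma unique_rotation w : prime p -> (0 < wcard w < p)%N ->
  exists l0 : 'I_p, forall l : 'I_p, (p %| wsum (iter l (@unrotw p C) w))%N = (l == l0).
Proof.
move=> pp wc; set k := wcard w.
have kp : coprime p k.
  by rewrite prime_coprime //; apply/negP => /dvdn_leq; lia.
pose f (l : 'I_p) : 'I_p := Ordinal (ltn_pmod (l * k) p_gt0).
have f_inj : injective f.
  have wl (l l' : 'I_p) : (l' <= l)%N -> f l = f l' -> l = l'.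
    move=> ll /(congr1 val) /= /eqP; rewrite eqn_mod_dvd ?leq_mul //.
    rewrite -mulnBl Gauss_dvdl // => /dvdn_leq; have := ltn_ord l.
    by move=> lp d; apply: val_inj => /=; lia.
  move=> l l' ff; case: (leqP l' l) => ll; first exact: wl.
  by symmetry; apply: wl => //; apply: ltnW.
have [h fh hf] := injF_bij f_inj.
exists (h (Ordinal (ltn_pmod (wsum w) p_gt0))) => l.
rewrite -(can_eq fh) hf -val_eqE /= -(wsum_iter l w) -/k.
by rewrite -{1}[(l * k)%N]add0n eqn_modDr mod0n eq_sym.
Qed.

(** The conjugates of [wproj] by rotations are the projections onto the rotates of
    the set of orbit representatives, which partition the words. *)
Lemma koszul_norm_one j (x : L) : prime p -> x \in homog j -> - p%:Z < j < 0 ->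
  norm_one wproj x.
Proof.
move=> pp /homogP xj jp; apply/ffunP => w; rewrite sum_ffunE.
rewrite (eq_bigr (fun l : 'I_p =>
    if (p %| wsum (iter l (@unrotw p C) w))%N then x w else 0)); last first.
  move=> l _; rewrite iter_tens_rot ffunE; case: ifP => _; last by rewrite mulr0.
  rewrite -iter_tens_rot -iterD subnKC ?(ltnW (ltn_ord l)) //.
  by rewrite tens_rotX.
have [x0|/xj wj] := eqVneq (x w) 0.
  by rewrite x0 big1 // => l _; case: ifP.
have [l0 l0P] : exists l0 : 'I_p, forall l : 'I_p,
    (p %| wsum (iter l (@unrotw p C) w))%N = (l == l0).
  by apply: unique_rotation => //; move: jp; rewrite -wj wdegE; lia.
by rewrite -big_mkcond (eq_bigl (fun l => l == l0)) ?big_pred1_eq.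
Qed.

End Koszul.
(** * The periodic model of the double complex *)

Section Model.
Variables (p n : nat) (n_gt0 : (0 < n)%N).
Local Notation C := (Cn0 n).
Local Notation L := (koszul p n).

(** The columns of [Hom] out of the periodic resolution are all the Koszul
    complex, so that a cochain is a sequence of its elements; the rows are found in
    the grading. *)
Definition model := nat -> L.

Definition model_d (x : model) : model := fun i =>
  match i with
  | 0%N => 0
  | i'.+1 => hop (odd i') (x i')
  end + bdry (x i) *+ n *~ (-1) ^+ i.

Lemma model_subE (x y : model) i : (x - y) i = x i - y i. Proof. by []. Qed.
Lemma model_addE (x y : model) i : (x + y) i = x i + y i. Proof. by []. Qed.

Lemma model_dB : {morph model_d : x y / x - y}.
Proof.
move=> x y; apply: funext => i; rewrite model_subE /model_d model_subE.
rewrite bdryB mulrnBl mulrzBl.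
by case: i => [|i]; rewrite ?model_subE ?hopB; abel.
Qed.
HB.instance Definition _ := GRing.isZmodMorphism.Build model model model_d model_dB.

Lemma model_dd x : model_d (model_d x) = 0.
Proof.
apply: funext => i; rewrite /model_d !bdryD !bdryMz !bdryMn.
rewrite (bdry_bdry n_gt0) mul0rn mul0rz addr0.
case: i => [|i]; first by rewrite bdry0 mul0rn mul0rz add0r.
rewrite hopD hopMz hopMn (hop_bdry n_gt0) exprS mulN1r mulrNz.
have -> : hop (odd i) (match i with 0%N => 0 | i'.+1 => hop (odd i') (x i') end) = 0.
  by case: i => [|i]; rewrite ?hop0 //= -{2}[odd i]negbK hop_hop.
by rewrite add0r subrr.
Qed.

Definition model_deg (m : int) (x : model) : Prop :=
  forall i, x i \in @homog p C (m - i%:Z).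

Definition model_fil (s : nat) (x : model) : Prop :=
  forall i, (i < s)%N -> x i = 0.

Lemma model_deg_sub m : subgroup (model_deg m).
Proof. by split=> [i|x y mx my i]; [apply: rpred0|apply: rpredB]. Qed.

Lemma model_fil_sub s : subgroup (model_fil s).
Proof. by split=> [//|x y sx sy i si]; rewrite model_subE sx // sy // subrr. Qed.

Lemma model_deg_d m x : model_deg m x -> model_deg (m + 1) (model_d x).
Proof.
move=> mx i; rewrite /model_d rpredD //.
  case: i => [|i]; first exact: rpred0.
  by apply: grade_hop; have -> : m + 1 - i.+1%:Z = m - i%:Z by lia.
apply: rpredMz; apply: rpredMn; apply: grade_bdry.
by have -> : m + 1 - i%:Z - 1 = m - i%:Z by lia.
Qed.

Lemma model_fil_d s x : model_fil s x -> model_fil s (model_d x).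
Proof.
move=> sx i si; rewrite /model_d [x i]sx // bdry0 mul0rn mul0rz addr0.
by case: i si => [//|i] si; rewrite sx ?hop0 //; lia.
Qed.

Lemma model_filW s t x : (s <= t)%N -> model_fil t x -> model_fil s x.
Proof. by move=> st tx i si; apply: tx; apply: leq_trans st. Qed.

Lemma model_fil0 x : model_fil 0 x. Proof. by []. Qed.

Definition model_fcomplex : fcomplex :=
  @FComplex model model_d model_deg model_fil model_dd
    model_deg_sub model_fil_sub model_deg_d model_fil_d model_fil0 model_filW.

(** ** The model computes [Hom] out of the periodic resolution *)

Variable p_gt0 : (0 < p)%N.
Local Notation W := (periodic_resolution p_gt0).
Local Notation E := (hom_bicomplex W (Dn0 p n)).

Lemma hop_local b (x y : L) w : (forall u, wdeg u = wdeg w -> x u = y u) ->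
  hop b x w = hop b y w.
Proof.
have it l (z : L) : iter l (cpgen L) z w = (\prod_(j < l)
    Defs.sgz1 (rot_exp (iter j.+1 (@unrotw p C) w))) * z (iter l (@unrotw p C) w).
  exact: iter_tens_rot.
move=> xy; case: b; rewrite /hop.
  rewrite !sum_ffunE; apply: eq_bigr => l _; rewrite !it xy //.
  exact: wdeg_iter.
have := it 1%N x; have := it 1%N y; rewrite /= !ffunE => -> ->.
by rewrite !xy // wdeg_unrotw.
Qed.

Lemma tens_dif_local (x y : L) w : (forall u, wdeg u = wdeg w - 1 -> x u = y u) ->
  tens_dif x w = tens_dif y w.
Proof.
move=> xy; rewrite !ffunE; apply: eq_bigr => u _.
have [->|/wdif_deg uw] := eqVneq (wdif u w) 0; first by rewrite !mulr0.
by rewrite xy // uw addrK.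
Qed.

Lemma tval_linear j :
  (@Defs.tval p C j : tensor_cpmod p C j -> L) \in @cplinear p (tensor_cpmod p C j) L.
Proof. by apply/asboolP. Qed.
Definition tval_hom j := CpHom (tval_linear j).

Lemma zcp_ev_linear (V : cpmod p) (v : V) :
  (fun z : zcp_mod p => cpspan (fun=> v) [:: tt] (fun=> z : zcp p)) \in
  @cplinear p (zcp_mod p) V.
Proof.
apply/asboolP; split=> [x y|x]; last first.
  rewrite cpspan_gen; congr cpspan; apply: funext => _; apply: funext => k.
  by rewrite ffunE.
rewrite -cpspanB; congr cpspan; apply: funext => _; apply: funext => k.
by rewrite !ffunE.
Qed.
Definition zcp_ev (V : cpmod p) (v : V) := CpHom (zcp_ev_linear v).

Lemma zcp_ev1 (V : cpmod p) (v : V) : zcp_ev v (zcp1 p) = v.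
Proof.
rewrite /= /cpspan big_seq1 (bigD1 (Ordinal p_gt0)) //= ffunE mulr1z.
rewrite big1 ?addr0 // => i i0; rewrite ffunE.
by move: i0; rewrite -val_eqE /= => /negPf ->.
Qed.

Lemma zcp_hom_ext (V : cpmod p) (f f' : cphom (zcp_mod p) V) :
  f (zcp1 p) = f' (zcp1 p) -> f = f'.
Proof.
move=> e; apply: cphom_ext => x; rewrite (zcp_expand x) !raddf_sum.
apply: eq_bigr => l _; rewrite !raddfMz; congr (_ *~ _).
by rewrite [LHS](iter_cphom f) [RHS](iter_cphom f') e.
Qed.

Definition glue (X : forall j, tensor p C j) : L :=
  [ffun w => Defs.tval (X (wdeg w)) w].

Definition to_model (x : tot E) : model :=
  fun i => glue (fun j => (x i j : cphom _ _) (zcp1 p)).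

Lemma homog_part_homog j (x : L) :
  [ffun w => if wdeg w == j then x w else 0] \in @homog p C j.
Proof. by apply/homogP => w; rewrite ffunE; case: ifP => [/eqP|]; rewrite ?eqxx. Qed.

Definition homog_part j (x : L) : tensor p C j := Tensor (homog_part_homog j x).

Definition of_model (y : model) : tot E :=
  fun i j => zcp_ev (homog_part j (y i) : tensor_cpmod p C j).

Lemma to_modelK y : to_model (of_model y) = y.
Proof.
apply: funext => i; apply/ffunP => w; rewrite ffunE.
by rewrite (zcp_ev1 (homog_part (wdeg w) (y i) : tensor_cpmod p C _)) /= ffunE eqxx.
Qed.

Lemma of_modelK x : of_model (to_model x) = x.
Proof.
apply: tot_ext => i j; apply: zcp_hom_ext; rewrite zcp_ev1.
apply: val_inj; apply/ffunP => w; rewrite !ffunE.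
case: eqP => [<-//|/eqP wj]; symmetry; apply/eqP; apply: contraNT wj.
by move/(homogP _ _ (Defs.tvalP _)) => ->.
Qed.

Lemma to_modelB : {morph to_model : x y / x - y}.
Proof. by move=> x y; apply: funext => i; apply/ffunP => w; rewrite !ffunE. Qed.

Lemma to_model_d x : to_model (totd x) = model_d (to_model x).
Proof.
apply: funext => i; apply/ffunP => w; rewrite ffunE.
have -> : Defs.tval ((totd x i (wdeg w) : cphom _ _) (zcp1 p)) w =
    (match i with 0%N => 0 | i'.+1 =>
       Defs.tval (hop (odd i') ((x i' (wdeg w) : cphom _ _) (zcp1 p) : tensor_cpmod p C _)) w end) +
    tens_dif (Defs.tval ((x i (wdeg w - 1) : cphom _ _) (zcp1 p))) w *~ (-1) ^+ i.
  rewrite hom_totdE -[Defs.tval _]/(tval_hom _ _) raddfD raddfMz /= ffunE ffunMzE.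
  congr (_ + _).
  case: i => [|i]; first by rewrite ffunE.
  by rewrite -hop_cphom.
have addE (a b : L) s : (a + b *~ s) w = a w + b w *~ s.
  by rewrite ffunE ffunMzE.
rewrite /model_d -tens_difE addE; congr (_ + _ *~ _).
  case: i => [|i]; first by rewrite ffunE.
  rewrite -[Defs.tval _]/(tval_hom _ _) hop_cphom; apply: hop_local => u uw.
  by rewrite ffunE -uw.
by apply: tens_dif_local => u uw; rewrite ffunE uw.
Qed.

Lemma model_equiv : filtered_equiv (tot_fcomplex E) model_fcomplex.
Proof.
exists to_model, of_model, (fun=> 0), (fun=> 0); split.
- split=> [||m x mx i|s x sx i si]; [exact: to_modelB|exact: to_model_d| |].
    apply/homogP => w; rewrite ffunE => x0; apply/eqP; apply: contraNT x0 => wm.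
    have -> : x i (wdeg w) = 0 by apply: mx; lia.
    by rewrite ffunE.
  by apply/ffunP => w; rewrite ffunE (sx _ _ si) !ffunE.
- have ofB : {morph of_model : x y / x - y}.
    by move=> x y; rewrite -{1}[x]to_modelK -{1}[y]to_modelK -to_modelB of_modelK.
  split=> [|x|m x mx i j ij|s x sx i j si]; first exact: ofB.
  + by rewrite -{1}[x]to_modelK -[RHS]of_modelK to_model_d.
  + apply: zcp_hom_ext; rewrite zcp_ev1; apply: val_inj; apply/ffunP => w.
    rewrite !ffunE; case: eqP => // wj; apply/eqP; apply: contraNT ij.
    by move/(homogP _ _ (mx i)) => e; apply/eqP; lia.
  + apply: zcp_hom_ext; rewrite zcp_ev1; apply: val_inj; apply/ffunP => w.
    by rewrite !ffunE sx // ffunE; case: ifP.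
- split=> [//|m x _|s x _|x]; [exact: fdeg0|exact: ffil_0|].
  by rewrite /= of_modelK raddf0 addr0 subrr.
- split=> [//|m x _|s x _|x]; [exact: fdeg0|exact: ffil_0|].
  by rewrite /= to_modelK raddf0 addr0 subrr.
Qed.

End Model.

Lemma hom_model_equiv (p n : nat) (W : cpresolution p)
    (p_gt0 : (0 < p)%N) (n_gt0 : (0 < n)%N) :
  filtered_equiv (tot_fcomplex (hom_bicomplex W (Dn0 p n)))
    (model_fcomplex p n_gt0).
Proof.
exact: filtered_equiv_trans (change_resolution _ W (periodic_resolution p_gt0))
  (model_equiv n_gt0 p_gt0).
Qed.
(** * Lattices *)

Lemma additive_mx (r b : nat) (f : 'rV[int]_r -> 'rV[int]_b) :
  {morph f : x y / x - y} -> exists M, forall v, f v = v *m M.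
Proof.
move=> fB; pose F := GRing.isZmodMorphism.Build _ _ f fB.
pose fA : {additive 'rV[int]_r -> 'rV[int]_b} := HB.pack f F.
exists (\matrix_i f (delta_mx 0 i)) => v.
rewrite {1}(row_sum_delta v) -[f]/(fA : _ -> _) raddf_sum; apply/rowP => k.
rewrite !mxE summxE; apply: eq_bigr => i _.
by rewrite mxE -[v 0 i]intz scaler_int raddfMz -scaler_int !mxE.
Qed.

Lemma zmod_genMz (m : nat) (z : int) : (0 < m)%N ->
  (inZp 1 : Zmod m) *~ z = 0 <-> (m %| z)%Z.
Proof.
move=> m0; have mE : m.-1.+1 = m by rewrite prednK.
have gen k : (inZp 1 : Zmod m) *+ k = inZp k.
  by rewrite Zp_mulrn /=; apply: val_inj; rewrite /= modnMml mul1n.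
have gen0 k : (inZp 1 : Zmod m) *+ k = 0 <-> (m %| k)%N.
  rewrite gen; split=> [/(congr1 val) /=|mk].
    by move=> e; rewrite /dvdn -{1}mE e.
  by apply: val_inj; rewrite /= mE; apply/eqP.
rewrite dvdzE; case: z => k; first exact: gen0.
rewrite {1}NegzE mulrNz; split=> [/eqP|/gen0]; last by rewrite pmulrn => ->; rewrite oppr0.
by rewrite oppr_eq0 => /eqP/gen0.
Qed.

Lemma zmod_gen_surj (m : nat) (u : Zmod m) : (inZp 1 : Zmod m) *~ (u : nat)%:Z = u.
Proof.
by rewrite -pmulrn Zp_mulrn; apply: val_inj; rewrite /= modnMml mul1n modn_small.
Qed.

Definition lattice (A : zmodType) (N : A -> Prop) (r : nat) : Prop :=
  subquo_iso N (fun x => x = 0) 'rV[int]_r.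

(** In Smith normal form all the diagonal entries of a matrix whose image has
    finite index are nonzero, and the kernel is spanned by the rows of [L^-1] past
    the last of them. *)
Lemma lattice_kermx (r b q : nat) (M : 'M[int]_(r, b)) : (0 < q)%N ->
  (forall w : 'rV_b, exists v : 'rV_r, v *m M = w *+ q) ->
  (b <= r)%N /\ lattice (fun v : 'rV[int]_r => v *m M = 0) (r - b).
Proof.
move=> q0 fin; have [L uL [R uR [d _ ME]]] := int_Smith_normal_form M.
set D := (X in L *m X *m R) in ME.
have DE (x : 'rV_r) (j : 'I_b) : (x *m D) 0 j = 
    \sum_(i < r) x 0 i * (d`_i *+ (i == j :> nat)).
  by rewrite mxE; apply: eq_bigr => i _; rewrite mxE.
(* A preimage of [q] times the [j]-th row of [R] shows that [d_j] divides [q]. *)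
have D0 (j : 'I_b) : (j < r)%N /\ d`_j != 0.
  have [v] := fin (delta_mx 0 j *m R).
  rewrite ME mulmxA -scaler_nat scalemxAl => /(can_inj (mulmxK uR)).
  move=> /rowP/(_ j); rewrite mulmxA DE !mxE !eqxx mulr1 => e.
  have [i ij] : exists i : 'I_r, (v *m L) 0 i * (d`_i *+ (i == j :> nat)) != 0.
    apply/existsP; apply: contraTT isT; rewrite negb_exists => /forallP a.
    move: e; rewrite big1 => [|i _]; last by apply/eqP; have := a i; rewrite negbK.
    by rewrite natz => /eqP; rewrite eq_sym; lia.
  move: ij; have [<-|] := eqVneq (i : nat) j; last by rewrite mulr0n mulr0 eqxx.
  by rewrite mulr1n mulf_eq0 negb_or => /andP[_ ->].
have br : (b <= r)%N.
  case: (posnP b) => [-> //|b0]; have bl : (b.-1 < b)%N by rewrite prednK.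
  by have [/= + _] := D0 (Ordinal bl); lia.
split=> //.
have ker (v : 'rV_r) : v *m M = 0 <-> forall i : 'I_r, (i < b)%N -> (v *m L) 0 i = 0.
  rewrite ME !mulmxA; split=> [v0 i ib|v0].
    have : v *m L *m D = 0 by rewrite -[LHS](mulmxK uR) v0 mul0mx.
    move/rowP/(_ (Ordinal ib)); rewrite DE mxE (bigD1 i) //= eqxx mulr1n big1.
      move/eqP; rewrite addr0 mulf_eq0 => /orP[/eqP//|].
      by have [_ /negPf /= ->] := D0 (Ordinal ib).
    by move=> k; rewrite -val_eqE /= => /negPf ->; rewrite mulr0n mulr0.
  rewrite (_ : v *m L *m D = 0) ?mul0mx //; apply/rowP => j; rewrite DE mxE big1 //.
  move=> i _; have [ij|] := eqVneq (i : nat) j; last by rewrite mulr0n mulr0.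
  by rewrite v0 ?mul0r // ij.
have idx (k : 'I_(r - b)) : (b + k < r)%N by have := ltn_ord k; lia.
exists (fun v => \row_k (v *m L) 0 (Ordinal (idx k))); split.
- by move=> x y _ _; apply/rowP => k; rewrite mulmxBl !mxE.
- move=> u; pose x : 'rV[int]_r := \row_i
    (if insub (i - b)%N is Some k then if (b <= i)%N then u 0 k else 0 else 0).
  exists (x *m invmx L).
    apply/ker => i ib; rewrite mulmxKV // mxE.
    by case: insub => // k; rewrite leqNgt ib.
  apply/rowP => k; rewrite mxE mulmxKV // mxE /= addKn leq_addr.
  by rewrite (valK k).
- move=> v /ker v0; split=> [/rowP f0|->]; last first.
    by apply/rowP => k; rewrite mul0mx !mxE.
  rewrite -[v](mulmxK uL) (_ : v *m L = 0) ?mul0mx //; apply/rowP => i.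
  have [ib|bi] := ltnP i b; first by rewrite v0 // mxE.
  have ki : (i - b < r - b)%N by have := ltn_ord i; lia.
  have ei : i = Ordinal (idx (Ordinal ki)) by apply: val_inj; rewrite /= subnKC.
  by have := f0 (Ordinal ki); rewrite mxE -ei => ->; rewrite !mxE.
Qed.

Lemma subquo_iso_eq0_inj (A M : zmodType) (N : A -> Prop) (f : A -> M) x y :
  subgroup N -> (forall x y, N x -> N y -> f (x - y) = f x - f y) ->
  (forall x, N x -> (f x = 0 <-> x = 0)) -> N x -> N y -> f x = f y -> x = y.
Proof.
move=> sN fB fK Nx Ny fxy; apply/subr0_eq/fK; first exact: subgroupB.
by rewrite fB // fxy subrr.
Qed.

(** In coordinates, this is [lattice_kermx] for the matrix of [d]. *)
Lemma lattice_exact (A A' : zmodType) (N : A -> Prop) (J : A' -> Prop)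
    (d : A -> A') (r b q : nat) :
  subgroup N -> subgroup J -> (0 < q)%N ->
  (forall x y, N x -> N y -> d (x - y) = d x - d y) ->
  (forall x, N x -> J (d x)) ->
  (forall z, J z -> exists2 x, N x & d x = z *+ q) ->
  lattice N r -> lattice J b ->
  (b <= r)%N /\ lattice (fun x => N x /\ d x = 0) (r - b).
Proof.
move=> sN sJ q0 dB dJ dq [f [fB fS fK]] [e [eB eS eK]].
have f_inj := subquo_iso_eq0_inj sN fB fK.
have /choice[h hP] v : exists x, N x /\ f x = v by have [x] := fS v; exists x.
have hB : {morph (fun v => e (d (h v))) : u v / u - v}.
  move=> u v; have [Nu fu] := hP u; have [Nv fv] := hP v.
  rewrite -eB ?(dJ _ _) //; try exact: dJ.
  rewrite -dB //; congr (e (d _)); have [Nuv fuv] := hP (u - v).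
  apply: f_inj => //; first exact: subgroupB.
  by rewrite fB // fu fv.
have [M ME] := additive_mx hB.
have fM x : N x -> f x *m M = e (d x).
  move=> Nx; rewrite -ME; congr (e (d _)); have [Nh fh] := hP (f x).
  by apply: f_inj.
have fin (w : 'rV[int]_b) : exists v, v *m M = w *+ q.
  have [z Jz <-] := eS w; have [x Nx dx] := dq z Jz.
  by exists (f x); rewrite fM // dx (subquo_morphMn q sJ eB Jz).
have [br lat] := lattice_kermx q0 fin; split=> //.
apply: (subquo_iso_transfer (f := f) _ _ _ _ _ _ lat).
- by split=> [|x y x0 y0]; rewrite ?mul0mx // mulmxBl x0 y0 subrr.
- split=> [|x y [Nx dx] [Ny dy]].
    split; first exact: subgroup0.
    by rewrite (subquo_morph0 sN dB).
  by split; [apply: subgroupB|rewrite dB // dx dy subrr].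
- by move=> x [Nx dx]; rewrite fM // dx (subquo_morph0 sJ eB).
- by move=> x y [Nx _] [Ny _]; rewrite fB // subrr.
- by move=> x [Nx _]; have := fK x Nx => -[? ?]; split.
- move=> v vM; have [Nh fh] := hP v; exists (h v); last by rewrite fh subrr.
  split=> //; apply/eK; first exact: dJ.
  by rewrite -fM // fh.
Qed.

Lemma lattice_mod (A : zmodType) (N : A -> Prop) (r n : nat) : (0 < n)%N ->
  subgroup N -> lattice N r ->
  subquo_iso N (fun x => exists2 c, N c & x = c *+ n) (Zmod_pow n r).
Proof.
move=> n0 sN [f [fB fS fK]]; have f_inj := subquo_iso_eq0_inj sN fB fK.
exists (fun x => \row_i ((inZp 1 : Zmod n) *~ f x ord0 i)); split.
- move=> x y Nx Ny; apply/rowP => i; rewrite fB // !mxE.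
  exact: mulrzBr.
- move=> u; have [x Nx fx] := fS (\row_i (u 0 i : nat)%:Z).
  by exists x => //; apply/rowP => i; rewrite mxE fx mxE zmod_gen_surj.
- move=> x Nx; split=> [/rowP fx|[c Nc ->]].
    have dv i : (n %| f x ord0 i)%Z by have := fx i; rewrite !mxE => /(zmod_genMz _ n0).
    have [c Nc fc] := fS (\row_i (f x ord0 i %/ n)%Z); exists c => //.
    apply: f_inj => //; first exact: subgroupMn.
    rewrite (subquo_morphMn n sN fB Nc) fc; apply/rowP => i.
    rewrite mulmxnE mxE -mulr_natr natz divzK //.
  apply/rowP => i; rewrite !mxE (subquo_morphMn n sN fB Nc).
  by apply/(zmod_genMz _ n0); rewrite mulmxnE -mulr_natr natz dvdz_mull.
Qed.

(** * Cycles of the Koszul complex and their Tate cohomology *)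

Lemma bezout_prime (p n : nat) : prime p -> ~~ (p %| n)%N ->
  exists u v : int, u * p%:Z + v * n%:Z = 1.
Proof.
move=> pp pn; have /coprimezP[[u v] /= uv] : coprimez p n.
  by rewrite coprimezE prime_coprime.
by exists u, v.
Qed.

Section Cycles.
Variables (p n : nat) (pp : prime p) (p_odd : odd p) (n_gt0 : (0 < n)%N).
Local Notation L := (koszul p n).
Local Notation C := (Cn0 n).
Implicit Types (x y a c u v w : L) (j : int) (b : bool).
Let p_gt0 : (0 < p)%N := prime_gt0 pp.

(** The cycles [Z_j]; the cohomology of the tensor power is [Z_j / n Z_j]. *)
Definition Zc j (a : L) : Prop := a \in @homog p C j /\ bdry a = 0.

Lemma Zc_sub j : subgroup (Zc j).
Proof.
split=> [|x y [xj dx] [yj dy]]; first by split; [apply: rpred0|apply: bdry0].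
by split; [apply: rpredB|rewrite bdryB dx dy subrr].
Qed.
Lemma Zc0 j : Zc j 0. Proof. exact: subgroup0 (Zc_sub j). Qed.
Lemma ZcB j x y : Zc j x -> Zc j y -> Zc j (x - y).
Proof. exact: subgroupB (Zc_sub j). Qed.
Lemma ZcD j x y : Zc j x -> Zc j y -> Zc j (x + y).
Proof. exact: subgroupD (Zc_sub j). Qed.
Lemma ZcMn j x m : Zc j x -> Zc j (x *+ m).
Proof. exact: subgroupMn (Zc_sub j). Qed.
Lemma ZcMz j x m : Zc j x -> Zc j (x *~ m).
Proof. exact: subgroupMz (Zc_sub j). Qed.

Lemma Zc_hop j b x : Zc j x -> Zc j (hop b x).
Proof.
move=> [xj dx]; split; first exact: grade_hop.
by rewrite (hop_bdry n_gt0) dx hop0.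
Qed.

Lemma bdry_hop_div b x : bdry (hop_div b x) = hop_div b (bdry x).
Proof. exact: (hop_div_cphom (koszul_d p n_gt0)). Qed.

Lemma hop_div0 (V : cpmod p) b : hop_div b (0 : V) = 0.
Proof.
by case: b => //=; rewrite big1 ?oppr0 // => l _; rewrite /geom big1 // => q _; exact: raddf0.
Qed.

Lemma Zc_hop_div j b x : Zc j x -> Zc j (hop_div b x).
Proof.
move=> [xj dx]; split; first exact: grade_hop_div.
by rewrite bdry_hop_div dx hop_div0.
Qed.

Lemma Zc_bdry j x : x \in @homog p C (j - 1) -> Zc j (bdry x).
Proof. by move=> xj; split; [apply: grade_bdry|apply: (bdry_bdry n_gt0)]. Qed.

Lemma bdry_coneE j a : Zc j a -> bdry (cone p_gt0 a) = a.
Proof. by move=> [_ da]; have := bdry_cone p_gt0 a; rewrite da raddf0 addr0. Qed.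

Lemma Zc_cone j a : Zc j a -> cone p_gt0 a \in @homog p C (j - 1).
Proof. by move=> [aj _]; apply: (grade_cone p_gt0). Qed.

Lemma Zc_out j a : Zc j a -> ~~ (1 - p%:Z <= j <= 0) -> a = 0.
Proof.
move=> Za jp; have [aj _] := Za.
have [ej|nej] := eqVneq j (- p%:Z); last by apply: (grade_out aj); lia.
by rewrite -(bdry_coneE Za) (grade_out (Zc_cone Za)) ?bdry0 //; lia.
Qed.

Lemma Zc_fixed j a : Zc j a -> (j == 0) || (j == 1 - p%:Z) -> cpgen L a = a.
Proof.
move=> Za; have [aj _] := Za; case/orP => /eqP ej.
  by apply: (koszul_fixed p_gt0 p_odd aj); rewrite ej eqxx.
rewrite -{1}(bdry_coneE Za) -[cpgen L _](cphomE (koszul_d p n_gt0)).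
rewrite /= (koszul_fixed p_gt0 p_odd (Zc_cone Za)) ?(bdry_coneE Za) //.
by rewrite ej addrC addKr eqxx orbT.
Qed.

Lemma hop_true_fixed (V : cpmod p) (x : V) : cpgen V x = x -> hop true x = x *+ p.
Proof. by move=> tx; rewrite /hop geom_fixed. Qed.
Lemma hop_false_fixed (V : cpmod p) (x : V) : cpgen V x = x -> hop false x = 0.
Proof. by move=> tx; rewrite /hop tx subrr. Qed.

Definition inner_lift b x : L := hop_lift (@wproj p n) b x.

Lemma grade_lift j b x : x \in @homog p C j -> inner_lift b x \in @homog p C j.
Proof.
move=> xj; have wp (y : L) : y \in @homog p C j -> wproj y \in @homog p C j.
  move=> /homogP yj; apply/homogP => w; rewrite ffunE; case: ifP => // _.
  exact: yj.
rewrite /inner_lift /hop_lift; case: b; last exact: wp.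
by apply: grade_sum => l; apply: grade_geom; apply: wp; apply: grade_iter.
Qed.

Lemma liftE j b x : x \in @homog p C j -> - p%:Z < j < 0 -> hop b x = 0 ->
  hop (~~ b) (inner_lift b x) = x.
Proof.
by move=> xj jp; apply: hop_liftE; apply: (koszul_norm_one p_gt0 pp xj jp).
Qed.

Definition Zker b j (a : L) : Prop := Zc j a /\ hop b a = 0.
Definition Zim b j (a : L) : Prop := exists2 c, Zc j c & a = hop b c.

Lemma Zker_sub b j : subgroup (Zker b j).
Proof.
split=> [|x y [Zx hx] [Zy hy]]; first by split; [apply: Zc0|apply: hop0].
by split; [apply: ZcB|rewrite hopB hx hy subrr].
Qed.

Lemma Zim_sub b j : subgroup (Zim b j).
Proof.
split=> [|x y [u Zu ->] [v Zv ->]]; first by exists 0; [apply: Zc0|rewrite hop0].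
by exists (u - v); [apply: ZcB|rewrite hopB].
Qed.

Definition tate b j (M : zmodType) := subquo_iso (Zker b j) (Zim (~~ b) j) M.

(** Since the inner terms of the Koszul complex are cohomologically trivial, its
    short exact sequences of cycles shift Tate cohomology by one. *)
Lemma tate_shift b j M : - p%:Z < j < 0 -> tate (~~ b) (j + 1) M -> tate b j M.
Proof.
move=> jp; have E : j + 1 - 1 = j by lia.
rewrite /tate negbK; apply: (@subquo_iso_transfer _ _ _ _ _ _ _ (fun x => bdry (inner_lift b x))).
- exact: Zker_sub.
- exact: Zker_sub.
- move=> x [[xj dx] hx]; split; first by apply: Zc_bdry; rewrite E grade_lift.
  by rewrite -(hop_bdry n_gt0) (liftE xj jp hx) dx.
- move=> x y _ _; rewrite /inner_lift hop_liftB bdryB subrr.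
  exact: subgroup0 (Zim_sub _ _).
- move=> x [[xj dx] hx]; have lx := liftE xj jp hx; have gl := grade_lift b xj.
  split=> [[c [cj dc] e]|[c Zc e]].
    have l0 : hop (~~ b) (inner_lift b x - c) = 0 by rewrite hopB lx e subrr.
    have gc : inner_lift b x - c \in @homog p C j by apply: rpredB.
    have := liftE gc jp l0; rewrite negbK => ll.
    exists (bdry (inner_lift (~~ b) (inner_lift b x - c))).
      by apply: Zc_bdry; rewrite E grade_lift.
    by rewrite -(hop_bdry n_gt0) ll bdryB dc subr0.
  have gc : cone p_gt0 c \in @homog p C j by have := Zc_cone Zc; rewrite E.
  exists (inner_lift b x - hop b (cone p_gt0 c)).
    split; first by apply: rpredB => //; apply: grade_hop.
    by rewrite bdryB (hop_bdry n_gt0) (bdry_coneE Zc) e subrr.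
  by rewrite hopB lx -{2}[b]negbK hop_hop subr0.
- move=> y [Zy hy]; have gc : cone p_gt0 y \in @homog p C j.
    by have := Zc_cone Zy; rewrite E.
  have gh : hop (~~ b) (cone p_gt0 y) \in @homog p C j by apply: grade_hop.
  have hh : hop b (hop (~~ b) (cone p_gt0 y)) = 0 by apply: hop_hop.
  exists (hop (~~ b) (cone p_gt0 y)).
    by do !split=> //; rewrite (hop_bdry n_gt0) (bdry_coneE Zy).
  have l0 : hop (~~ b) (cone p_gt0 y - inner_lift b (hop (~~ b) (cone p_gt0 y))) = 0.
    by rewrite hopB (liftE gh jp hh) subrr.
  have gl : cone p_gt0 y - inner_lift b (hop (~~ b) (cone p_gt0 y)) \in @homog p C j.
    by apply: rpredB => //; apply: grade_lift.
  have := liftE gl jp l0; rewrite negbK => ll.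
  exists (bdry (inner_lift (~~ b) (cone p_gt0 y - inner_lift b (hop (~~ b) (cone p_gt0 y))))).
    by apply: Zc_bdry; rewrite E grade_lift.
  by rewrite -(hop_bdry n_gt0) ll bdryB (bdry_coneE Zy).
Qed.

Let w0 : word p C := [ffun=> false].

Lemma wdeg_w0 : wdeg w0 = 0.
Proof. by rewrite /wdeg big1 // => i _; rewrite ffunE. Qed.

Lemma wdeg_eq0 (w : word p C) : wdeg w = 0 -> w = w0.
Proof.
rewrite wdegE => w_0; have /eqP : wcard w = 0%N by lia.
rewrite /wcard cards_eq0 => /eqP/setP w_1; apply/ffunP => i; rewrite ffunE.
by have := w_1 i; rewrite !inE.
Qed.

Definition koszul1 : L := [ffun w => (w == w0)%:Z].

Lemma Zc_koszul1 : Zc 0 koszul1.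
Proof.
have g1 : koszul1 \in @homog p C 0.
  by apply/homogP => w; rewrite ffunE; have [->|//] := eqVneq w w0; rewrite wdeg_w0.
split=> //; have : bdry koszul1 \in @homog p C 1 by apply: grade_bdry.
by move=> g0; apply: (grade_out g0); lia.
Qed.

Lemma Zc_top a : Zc 0 a -> a = koszul1 *~ a w0.
Proof.
move=> [/homogP a0 _]; apply/ffunP => w; rewrite ffunMzE ffunE.
have [->|ww] := eqVneq w w0; first by rewrite intz.
rewrite mul0rz; have [//|nz] := eqVneq (a w) 0.
by rewrite (wdeg_eq0 (a0 _ nz)) eqxx in ww.
Qed.

(** The top cycles are the trivial module [Z]. *)
Lemma tate_top b : tate b 0 (if b then zmod0 else Zmod p).
Proof.
have fx a : Zc 0 a -> cpgen L a = a by move=> Za; apply: (Zc_fixed Za).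
case: b.
  apply: subquo_iso_zmod0; first exact: Zker_sub.
  move=> x [Zx]; rewrite hop_true_fixed ?fx // => /(koszul_MnI p_gt0) ->.
  exact: subgroup0 (Zim_sub _ _).
exists (fun x : L => (inZp 1 : Zmod p) *~ (x w0)); split.
- by move=> x y _ _; rewrite !ffunE mulrzBr.
- move=> u; exists (koszul1 *~ (u : nat)%:Z).
    have Z1 := ZcMz (u : nat)%:Z Zc_koszul1.
    by split=> //; apply: hop_false_fixed; apply: fx.
  by rewrite ffunMzE ffunE eqxx intz zmod_gen_surj.
- move=> x [Zx hx]; split=> [/(zmod_genMz _ p_gt0)/dvdzP[q xq]|[c Zc ->]].
    exists (koszul1 *~ q); first exact: ZcMz Zc_koszul1.
    rewrite hop_true_fixed; last by apply: fx; apply: ZcMz Zc_koszul1.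
    by rewrite {1}(Zc_top Zx) xq pmulrn mulrzA.
  rewrite hop_true_fixed ?fx //; apply/(zmod_genMz _ p_gt0).
  by rewrite ffunMnE -mulr_natr natz dvdz_mull.
Qed.

Lemma tate_cycles b (k : nat) : (k < p)%N ->
  tate b (- k%:Z) (if b == odd k then Zmod p else zmod0).
Proof.
elim: k b => [|k IH] b kp; first by have := tate_top b; case: b.
apply: tate_shift; first by lia.
have -> : - k.+1%:Z + 1 = - k%:Z by lia.
have := IH (~~ b) (ltnW kp); rewrite /= eqb_negLR.
by case: b; case: (odd k).
Qed.

Lemma tate_degree b j : 1 - p%:Z <= j <= 0 ->
  tate b j (if b == odd `|j|%N then Zmod p else zmod0).
Proof.
move=> jp; have {1}-> : j = - (`|j|%N)%:Z by lia.
by apply: tate_cycles; lia.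
Qed.

Lemma tate_vanish b j : 1 - p%:Z <= j <= 0 -> b != odd `|j|%N ->
  forall a, Zker b j a -> Zim (~~ b) j a.
Proof.
move=> jp /negPf bj; have := tate_degree b jp; rewrite bj.
exact: subquo_iso_zmod0_sub.
Qed.

(** * The pages on leading parts *)

(** In terms of leading parts, [E_2] is [numer2 / denom2] in a positive column of
    parity [b], and [numer2 / nZ] in column [0], which no horizontal differential
    enters. *)
Definition nZ j (a : L) : Prop := exists2 c, Zc j c & a = c *+ n.
Definition numer2 b j (a : L) : Prop :=
  Zc j a /\ exists2 c, Zc j c & hop b a = c *+ n.
Definition denom2 b j (a : L) : Prop :=
  exists u v, [/\ Zc j u, Zc j v & a = hop (~~ b) u + v *+ n].
(** The leading parts of the cocycles whose leading part is killed by the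
    horizontal differential, modulo vertical coboundaries. *)
Definition kernel_nZ b j (a : L) : Prop :=
  exists u v, [/\ Zker b j u, Zc j v & a = u + v *+ n].

Lemma nZ_sub j : subgroup (nZ j).
Proof.
split=> [|x y [u Zu ->] [v Zv ->]]; first by exists 0; [apply: Zc0|rewrite mul0rn].
by exists (u - v); [apply: ZcB|rewrite mulrnBl].
Qed.

Lemma numer2_sub b j : subgroup (numer2 b j).
Proof.
split=> [|x y [Zx [u Zu hu]] [Zy [v Zv hv]]].
  by split; [apply: Zc0|exists 0; [apply: Zc0|rewrite hop0 mul0rn]].
split; first exact: ZcB.
by exists (u - v); [apply: ZcB|rewrite hopB hu hv mulrnBl].
Qed.

Lemma denom2_sub b j : subgroup (denom2 b j).
Proof.
split=> [|x y [u [v [Zu Zv ->]]] [u' [v' [Zu' Zv' ->]]]].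
  by exists 0, 0; split; rewrite ?hop0 ?mul0rn ?addr0 //; apply: Zc0.
exists (u - u'), (v - v'); split; [exact: ZcB..|].
by rewrite hopB mulrnBl; abel.
Qed.

Lemma kernel_nZ_sub b j : subgroup (kernel_nZ b j).
Proof.
split=> [|x y [u [v [Zu Zv ->]]] [u' [v' [Zu' Zv' ->]]]].
  exists 0, 0; split; rewrite ?mul0rn ?addr0 //; last exact: Zc0.
  exact: subgroup0 (Zker_sub b j).
exists (u - u'), (v - v'); split; first exact: subgroupB (Zker_sub b j) Zu Zu'.
  exact: ZcB.
by rewrite mulrnBl; abel.
Qed.

Lemma hop_MnI b c a : hop b a = c *+ n -> hop (~~ b) c = 0.
Proof.
move=> hc; apply: (koszul_MnI n_gt0).
by rewrite -hopMn -hc -{2}[b]negbK hop_hop.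
Qed.

Lemma kernel_nZ_numer2 b j a : kernel_nZ b j a -> numer2 b j a.
Proof.
move=> [u [v [[Zu hu] Zv ->]]]; split; first by apply: ZcD => //; apply: ZcMn.
by exists (hop b v); [apply: Zc_hop|rewrite hopD hu add0r hopMn].
Qed.

Lemma denom2_kernel b j a : denom2 b j a -> kernel_nZ b j a.
Proof.
move=> [u [v [Zu Zv ->]]]; exists (hop (~~ b) u), v; split=> //.
by split; [apply: Zc_hop|rewrite hop_hop].
Qed.

Lemma nZ_denom2 b j a : nZ j a -> denom2 b j a.
Proof.
move=> [c cc ->]; exists 0, c; split=> //; first exact: Zc0.
by rewrite hop0 add0r.
Qed.

Lemma nZ_kernel b j a : nZ j a -> kernel_nZ b j a.
Proof. by move/(nZ_denom2 b)/denom2_kernel. Qed.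

Lemma Zker_kernel b j a : Zker b j a -> kernel_nZ b j a.
Proof. by move=> Za; exists a, 0; rewrite mul0rn addr0; split=> //; apply: Zc0. Qed.

(** ** The case [p] prime to [n] *)

(** The quotient of [hop b a] by [n] is killed by [n] in the Tate group, as it is
    by [p]; hence it is the image of a cycle. *)
Lemma coprime_kernel b j a : ~~ (p %| n)%N -> numer2 b j a -> kernel_nZ b j a.
Proof.
move=> pn [Za [c cc hac]]; have [al [be ab]] := bezout_prime pp pn.
have hc := hop_MnI hac; have := hop_divE hc; rewrite negbK => pc.
pose c' := hop_div (~~ b) c *~ al + a *~ be.
have Zc' : Zc j c'.
  by apply: ZcD; apply: ZcMz => //; apply: Zc_hop_div.
have hc' : hop b c' = c.
  rewrite hopD !hopMz -pc hac !pmulrn -!mulrzA -mulrzDr.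
  by rewrite [p%:Z * _]mulrC [n%:Z * _]mulrC ab mulr1z.
exists (a - c' *+ n), c'; split=> //; last by rewrite subrK.
by split; [apply: ZcB => //; apply: ZcMn|rewrite hopB hopMn hc' hac subrr].
Qed.

Lemma coprime_denom2 b j a : ~~ (p %| n)%N -> kernel_nZ b j a -> denom2 b j a.
Proof.
move=> pn [u [v [[Zu hu] Zv ->]]]; have [al [be ab]] := bezout_prime pp pn.
have pu := hop_divE hu.
exists (hop_div b u *~ al), (u *~ be + v); split.
- by apply: ZcMz; apply: Zc_hop_div.
- by apply: ZcD => //; apply: ZcMz.
rewrite hopMz -pu mulrnDl addrA; congr (_ + _).
by rewrite !pmulrn -!mulrzA -mulrzDr [p%:Z * _]mulrC ab mulr1z.
Qed.

Lemma Zc_kernel_low a : Zc (1 - p%:Z) a -> kernel_nZ false (1 - p%:Z) a.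
Proof.
move=> Za; apply: Zker_kernel; split=> //; apply: hop_false_fixed.
by apply: (Zc_fixed Za); rewrite eqxx orbT.
Qed.

(** ** The case [p] dividing [n] *)

Section Divisible.
Hypothesis pn : (p %| n)%N.
Let m := (n %/ p)%N.

Lemma n_mulp x : x *+ n = x *+ p *+ m.
Proof. by rewrite -mulrnA mulnC divnK. Qed.

Lemma Zker_denom2 b j a : Zker b j a -> (Zim (~~ b) j a <-> denom2 b j a).
Proof.
move=> [Za ha]; split=> [[c cc ->]|[u [v [Zu Zv e]]]].
  by exists c, 0; rewrite mul0rn addr0; split=> //; apply: Zc0.
have hv : hop b v = 0.
  apply: (koszul_MnI n_gt0); rewrite -hopMn; have := ha.
  by rewrite e hopD hop_hop add0r.
exists (u + hop_div b v *+ m); first by apply: ZcD => //; apply/ZcMn/Zc_hop_div.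
by rewrite e n_mulp (hop_divE hv) hopD hopMn.
Qed.

(** An element of [Zker b j] in [nZ j] is [n] times an element of [Zker b j], and
    [p] maps the latter into the image of the other operator. *)
Lemma kernel_nZ_iso b j M : tate b j M -> subquo_iso (kernel_nZ b j) (denom2 b j) M.
Proof.
apply: subquo_iso_extend.
- exact: Zker_sub.
- exact: kernel_nZ_sub.
- exact: denom2_sub.
- exact: Zker_kernel.
- move=> x [u [v [Zu Zv ->]]]; exists u => //.
  by rewrite addrC addKr; apply: nZ_denom2; exists v.
- exact: Zker_denom2.
Qed.

Definition quo_n (x : L) : L := [ffun w => (x w %/ n%:Z)%Z].

Lemma quo_nK c : quo_n (c *+ n) = c.
Proof.
apply/ffunP => w; rewrite ffunE ffunMnE -mulr_natr natz mulzK //; lia.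
Qed.

Lemma numer2_quo b j x : numer2 b j x ->
  Zker (~~ b) j (quo_n (hop b x)) /\ hop b x = quo_n (hop b x) *+ n.
Proof.
by move=> [Zx [c cc hc]]; rewrite hc quo_nK; split=> //; split=> //; apply: hop_MnI hc.
Qed.

(** The connecting homomorphism of multiplication by [n], that is division of
    [hop b a] by [n], identifies [numer2 / kernel_nZ] with the other Tate
    group. *)
Lemma numer2_kernel_iso b j M : tate (~~ b) j M ->
  subquo_iso (numer2 b j) (kernel_nZ b j) M.
Proof.
rewrite /tate negbK.
apply: (@subquo_iso_transfer _ _ _ _ _ _ _ (fun x => quo_n (hop b x))).
- exact: Zker_sub.
- exact: numer2_sub.
- by move=> x /numer2_quo[].
- move=> x y /numer2_quo[_ hx] /numer2_quo[_ hy].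
  by rewrite hopB {1}hx {1}hy -mulrnBl quo_nK subrr; apply: subgroup0 (Zim_sub _ _).
- move=> x Nx; have [[Zq hq] hx] := numer2_quo Nx; have [Zx _] := Nx.
  split=> [[u [v [[Zu hu] Zv e]]]|[c cc e]].
    by exists v => //; rewrite e hopD hu add0r hopMn quo_nK.
  exists (x - c *+ n), c; split=> //; last by rewrite subrK.
  split; first by apply: ZcB => //; apply: ZcMn.
  by rewrite hopB hopMn -e -hx subrr.
- move=> y [Zy hy]; have := hop_divE hy; rewrite negbK => py.
  have hn : hop b (hop_div (~~ b) y *+ m) = y *+ n by rewrite hopMn -py n_mulp.
  exists (hop_div (~~ b) y *+ m).
    by split; [apply/ZcMn/Zc_hop_div|exists y].
  by rewrite hn quo_nK subrr; apply: subgroup0 (Zim_sub _ _).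
Qed.

(** Only one of the two Tate groups is nonzero, and it accounts for the whole
    term, either as a kernel or as a quotient. *)
Lemma E2_positive b j : 1 - p%:Z <= j <= 0 ->
  subquo_iso (numer2 b j) (denom2 b j) (Zmod p).
Proof.
move=> jp; have [bj|nbj] := boolP (b == odd `|j|%N).
  have nbj : ~~ b != odd `|j|%N by move: bj; case: b; case: odd.
  have NK : forall a, numer2 b j a -> kernel_nZ b j a.
    have := numer2_kernel_iso (tate_degree (~~ b) jp).
    by rewrite (negPf nbj) => /subquo_iso_zmod0_sub.
  apply: (subquo_iso_ext (N := kernel_nZ b j) (B := denom2 b j)) => //.
    by move=> x; split=> [/kernel_nZ_numer2|/NK].
  by apply: kernel_nZ_iso; have := tate_degree b jp; rewrite bj.
apply: (subquo_iso_ext (N := numer2 b j) (B := kernel_nZ b j)) => //.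
  move=> x _; split=> [[u [v [Zu Zv ->]]]|/denom2_kernel//].
  apply: subgroupD; first exact: denom2_sub.
    by apply/(Zker_denom2 Zu)/tate_vanish.
  by apply: nZ_denom2; exists v.
apply: numer2_kernel_iso; have := tate_degree (~~ b) jp.
have -> // : ~~ b == odd `|j|%N by move: nbj; case: b; case: odd.
Qed.

Lemma numer2_even j : ~~ odd `|j|%N -> forall a, numer2 false j a -> kernel_nZ false j a.
Proof.
move=> jo a Na; have [jp|jp] := boolP (1 - p%:Z <= j <= 0).
  have := tate_degree true jp; rewrite (negPf jo).
  by move/(@numer2_kernel_iso false)/subquo_iso_zmod0_sub; apply.
have [Za _] := Na; rewrite (Zc_out Za jp).
exact: subgroup0 (kernel_nZ_sub _ _).
Qed.

(** For [c] killed by the norm, [p c = hop false u] with [u = hop_div true c]; then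
    [(n / p) u] has order [p] in [E_2] and is sent to the class of [c]. *)
Lemma E2_zero_odd j M : odd `|j|%N -> 1 - p%:Z < j < 0 ->
  subquo_iso (kernel_nZ false j) (nZ j) M ->
  subquo_iso (numer2 false j) (nZ j) (dsum M (Zmod p)).
Proof.
move=> jo jp iM; have jp' : 1 - p%:Z <= j <= 0 by lia.
apply: (subquo_iso_dsum p_gt0 (K := kernel_nZ false j)) => //.
- exact: numer2_sub.
- exact: kernel_nZ_sub.
- exact: nZ_sub.
- exact: nZ_kernel.
- exact: kernel_nZ_numer2.
- move=> x Nx; have [[Zq hq] hx] := numer2_quo Nx; have [Zx _] := Nx.
  have pq := hop_divE hq; set y := hop_div true _ in pq.
  have Zy : Zc j y by apply: Zc_hop_div.
  have hy : hop false (y *+ m) = hop false x by rewrite hopMn -pq -n_mulp -hx.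
  exists (y *+ m); split.
  + split; first exact: ZcMn.
    by exists (quo_n (hop false x)) => //; rewrite hy.
  + by apply: Zker_kernel; split; [apply: ZcB => //; apply: ZcMn|rewrite hopB hy subrr].
  + by exists y => //; rewrite n_mulp mulrnAC.
- by apply: (@numer2_kernel_iso false); have := tate_degree true jp'; rewrite jo.
Qed.

(** A class of [E_2] survives to [E_3] when the chain [y] that witnesses it can
    be continued one step further. *)
Definition numer3 b j (a : L) : Prop :=
  Zc j a /\ exists y z, [/\ y \in @homog p C (j - 1), z \in @homog p C (j - 2),
    hop b a = bdry y *+ n & hop (~~ b) y = bdry z *+ n].

Definition denom3 b j (a : L) : Prop :=
  exists u v w, [/\ Zc (j + 1) u, v \in @homog p C j, Zc j w,
    hop b u = bdry v *+ n & a = hop (~~ b) v + w *+ n].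

Lemma numer3_numer2 b j a : numer3 b j a -> numer2 b j a.
Proof. by move=> [Za [y [z [yj _ hy _]]]]; split=> //; exists (bdry y) => //; apply: Zc_bdry. Qed.

(** The continuation [z] of [y] shows that the dimension shift of the class of
    [bdry y] in the other Tate group is [n] times a class, hence zero. *)
Lemma numer3_kernel b j a : j != 1 - p%:Z -> numer3 b j a -> kernel_nZ b j a.
Proof.
move=> jn1 Na; have [Za [y [z [yj zj hy hz]]]] := Na.
have [jp|jp] := boolP (1 - p%:Z <= j <= 0); last first.
  by rewrite (Zc_out Za jp); apply: subgroup0 (kernel_nZ_sub _ _).
pose f := bdry z; have E : j - 2 = j - 1 - 1 by lia.
have Zf : Zc (j - 1) f by apply: Zc_bdry; rewrite -E.
have hf : hop b f = 0.
  by have := hop_MnI hz; rewrite negbK.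
have pf := hop_divE hf.
(* The chain [y] is corrected by a cycle so as to be killed by the operator. *)
pose e := y - hop_div b f *+ m.
have ej : e \in @homog p C (j - 1).
  by apply: rpredB => //; apply: rpredMn; have [] := Zc_hop_div b Zf.
have he : hop (~~ b) e = 0 by rewrite hopB hopMn -pf -n_mulp -hz subrr.
have jp1 : - p%:Z < j - 1 < 0 by lia.
have := liftE ej jp1 he; rewrite negbK => le.
have de : bdry e = bdry y.
  by rewrite bdryB bdryMn bdry_hop_div (proj2 Zf) hop_div0 mul0rn subr0.
have Zl : Zc j (bdry (inner_lift (~~ b) e)) by apply: Zc_bdry; apply: grade_lift.
exists (a - bdry (inner_lift (~~ b) e) *+ n), (bdry (inner_lift (~~ b) e)).
split=> //; last by rewrite subrK.
split; first by apply: ZcB => //; apply: ZcMn.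
by rewrite hopB hopMn -(hop_bdry n_gt0) le de hy subrr.
Qed.

(** In an inner term, a cycle killed by [hop b] is [hop (~~ b) v], and [v] continues
    to a chain starting one column further to the left, because [p] kills the Tate
    class of [bdry v] and divides [n]. *)
Lemma kernel_denom3 b j a : - p%:Z < j < 0 -> kernel_nZ b j a -> denom3 b j a.
Proof.
move=> jp [a0 [w [[[aj da] ha] Zw ->]]].
have la := liftE aj jp ha; set v := inner_lift b a0 in la.
have vj : v \in @homog p C j by apply: grade_lift.
have E : j + 1 - 1 = j by lia.
have Zv : Zc (j + 1) (bdry v) by apply: Zc_bdry; rewrite E.
have hv : hop (~~ b) (bdry v) = 0 by rewrite -(hop_bdry n_gt0) la da.
have := hop_divE hv; rewrite negbK => pv.
exists (hop_div (~~ b) (bdry v) *+ m), v, w; split=> //.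
- by apply: ZcMn; apply: Zc_hop_div.
- by rewrite hopMn -pv -n_mulp.
- by rewrite la.
Qed.

Lemma denom2_denom3 b j a : denom2 b j a -> denom3 b j a.
Proof.
move=> [u [v [[uj du] Zv ->]]]; exists 0, u, v; split=> //; first exact: Zc0.
by rewrite hop0 du mul0rn.
Qed.

(** In the top row there is no cycle [u] above, and in the bottom row the norm of
    [hop false v] vanishes and is [p] times it. *)
Lemma denom3_denom2 b j a : Zc j a -> (j == 0) || (b && (j == 1 - p%:Z)) ->
  denom3 b j a -> denom2 b j a.
Proof.
move=> Za jE [u [v [w [Zu vj Zw huv e]]]]; case/orP: jE => [/eqP j0|/andP[bT /eqP j1]].
  have u0 : u = 0 by apply: (Zc_out Zu); lia.
  exists v, w; split=> //; split=> //.
  by apply: (koszul_MnI n_gt0); rewrite -huv u0 hop0.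
have hv : hop (~~ b) v = 0.
  have Zh : Zc j (hop (~~ b) v).
    by rewrite -[hop _ v](addrK (w *+ n)) -e; apply: ZcB => //; apply: ZcMn.
  apply: (koszul_MnI p_gt0); rewrite -hop_true_fixed; last first.
    by apply: (Zc_fixed Zh); rewrite j1 eqxx orbT.
  by rewrite bT -{1}[true]negbK hop_hop.
by apply: nZ_denom2; exists w => //; rewrite e hv add0r.
Qed.

End Divisible.

(** ** Ranks of the invariants *)

Definition wreps (k : nat) : {set word p C} :=
  [set w | (wcard w == k) && (p %| wsum w)%N].

Lemma card_words k : #|[set w : word p C | wcard w == k]| = 'C(p, k).
Proof.
rewrite -[p in 'C(p, k)]card_ord -card_draws -!sum1dep_card.
have inj : injective (fun w : word p C => [set i | (w i : bool)]).
  by move=> u w /setP uw; apply/ffunP => i; have := uw i; rewrite !inE.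
rewrite (reindex_onto (fun A : {set 'I_p} => [ffun i => i \in A] : word p C)
  (fun w : word p C => [set i | (w i : bool)])) /=; last first.
  by move=> w _; apply/ffunP => i; rewrite ffunE inE.
apply: eq_bigl => A.
have -> : [set i | ([ffun i => i \in A] : word p C) i] = A.
  by apply/setP => i; rewrite inE ffunE.
rewrite eqxx andbT /wcard; congr (_ == k); apply: eq_card => i.
by rewrite inE ffunE.
Qed.

(** Each word has exactly one rotate among the representatives. *)
Lemma card_wreps k : (0 < k < p)%N -> (#|wreps k| * p = 'C(p, k))%N.
Proof.
move=> kp; rewrite -card_words -!sum1dep_card.
have wci l (w : word p C) : wcard (iter l (@unrotw p C) w) = wcard w.
  by elim: l => //= l IH; rewrite wcard_unrotw.
have Tl (l : 'I_p) : #|wreps k| =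
    (\sum_(w : word p C | wcard w == k) (p %| wsum (iter l (@unrotw p C) w)))%N.
  rewrite -sum1_card (reindex_inj (h := iter l (@unrotw p C))) /=; last first.
    by elim: (nat_of_ord l) => [|i IH] u w //= /(can_inj (@unrotwK p C))/IH.
  rewrite [LHS]big_mkcond [RHS]big_mkcond /=; apply: eq_bigr => w _.
  by rewrite inE wci; case: (_ == k) => //=; case: (_ %| _)%N.
transitivity (\sum_(l < p) #|wreps k|)%N.
  by rewrite big_const_ord iter_addn_0 sum1dep_card.
rewrite (eq_bigr _ (fun l _ => Tl l)) exchange_big /=; apply: eq_bigr => w /eqP wk.
have wk' : (0 < @wcard p n w < p)%N by rewrite wk.
have [l0 l0P] := unique_rotation p_gt0 pp wk'.
rewrite (bigD1 l0) //= l0P eqxx big1 // => l /negPf ll.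
by rewrite l0P ll.
Qed.

(** In an inner term, an invariant element is the norm of its restriction to the
    orbit representatives. *)
Lemma fixed_lattice k : (0 < k < p)%N ->
  lattice (fun x : L => x \in @homog p C (- k%:Z) /\ hop false x = 0) #|wreps k|.
Proof.
move=> kp; have kp' : - p%:Z < - k%:Z < 0 by lia.
exists (fun x : L => \row_i x (enum_val i)); split.
- by move=> x y _ _; apply/rowP => i; rewrite !mxE !ffunE.
- move=> u; pose y : L := [ffun w : word p C => \sum_(i < #|wreps k|) (w == enum_val i)%:Z * u 0 i].
  have yT (w : word p C) : w \notin wreps k -> y w = 0.
    move=> wT; rewrite ffunE big1 // => i _; case: eqP => [wi|_]; last exact: mul0r.
    by move: wT; rewrite wi enum_valP.
  have yj : y \in @homog p C (- k%:Z).
    apply/homogP => w yw; have : w \in wreps k by apply: contraNT yw => /yT ->.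
    by rewrite inE wdegE => /andP[/eqP ->].
  exists (hop true y); first by split; [apply: grade_hop|exact: (hop_hop false)].
  apply/rowP => i; rewrite mxE sum_ffunE.
  have := enum_valP i; rewrite inE; set w := enum_val i => /andP[/eqP wk wp].
  have wk' : (0 < @wcard p n w < p)%N by rewrite wk.
have [l0 l0P] := unique_rotation p_gt0 pp wk'.
  have l00 : l0 = Ordinal p_gt0.
    by apply/eqP; rewrite eq_sym -l0P.
  rewrite (bigD1 (Ordinal p_gt0)) //= big1 ?addr0.
    rewrite ffunE (bigD1 i) //= eqxx mul1r big1 ?addr0 // => l li.
    by rewrite (inj_eq enum_val_inj) eq_sym (negPf li) mul0r.
  move=> l ll; have -> := iter_tens_rot l (y : tens p C) w; rewrite yT ?mulr0 // inE negb_and orbC l0P l00.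
  by rewrite (negPf ll).
- move=> x [xj hx]; split=> [/rowP x0|->]; last first.
    by apply/rowP => i; rewrite !mxE !ffunE.
  suff px : wproj x = 0 by rewrite -(liftE xj kp' hx) [inner_lift _ _]px hop0.
  apply/ffunP => w; rewrite !ffunE; case: ifP => // wp.
  have [//|xw] := eqVneq (x w) 0.
  have wk : wcard w = k by have := homogP _ _ xj w xw; rewrite wdegE; lia.
  have wT : w \in wreps k by rewrite inE wk eqxx.
  by have := x0 (enum_rank_in wT w); rewrite !mxE enum_rankK_in.
Qed.

Lemma g_recursion k : (k.+1 <= p - 1)%N ->
  (g p k.+1%:Z + g p k%:Z = #|wreps k.+1|)%N.
Proof.
move=> kp; have kp1 : (0 < k.+1 < p)%N by lia.
have p1 := prime_gt1 pp.
have := g_spec pp kp; have := g_spec pp (ltnW kp) => e0 e1.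
apply/eqP; rewrite -(eqr_nat rat) natrD.
have pn0 : (p%:R : rat) != 0 by rewrite pnatr_eq0; lia.
apply/eqP/(mulIf pn0); rewrite -natrM card_wreps //.
have -> : (g p k.+1)%:R = (g p k.+1)%:Q by [].
have -> : (g p k)%:R = (g p k)%:Q by [].
rewrite e0 e1.
have -> : 'C(p, k.+1) = ('C(p - 1, k.+1) + 'C(p - 1, k))%N.
  by rewrite -binS; congr 'C(_, _); lia.
rewrite natrD exprS.
have pn0' : (p%:Q : rat) != 0 by [].
by field.
Qed.

(** The invariants of the exact sequence of cycles are exact up to index [p]: for
    an invariant cycle [z], the norm of [cone z] is sent to [p z]. *)
Lemma invariants_lattice_deg k : (k <= p - 1)%N ->
  lattice (Zker false (- k%:Z)) (g p k%:Z).
Proof.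
elim: k => [_|k IH kp].
  have -> : g p 0%:Z = 1%N.
    rewrite /g /= bin0 expr0 mulr1 subrK divzz.
    by have -> : (p%:Z != 0) by lia.
  exists (fun x : L => \row__ x w0); split.
  - by move=> x y _ _; apply/rowP => i; rewrite !mxE !ffunE.
  - move=> u; exists (koszul1 *~ u 0 0).
      have Z1 := ZcMz (u 0 0) Zc_koszul1.
      by split=> //; apply: hop_false_fixed; apply: (Zc_fixed Z1).
    by apply/rowP => i; rewrite mxE ffunMzE ffunE eqxx intz ord1.
  - move=> x [Zx _]; split=> [/rowP/(_ 0)|->]; last first.
      by apply/rowP => i; rewrite !mxE !ffunE.
    by rewrite !mxE => x0; rewrite (Zc_top Zx) x0 mulr0z.
have E : - k.+1%:Z + 1 = - k%:Z by lia.
have E' : - k%:Z - 1 = - k.+1%:Z by lia.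
have kp1 : (0 < k.+1 < p)%N by have := prime_gt1 pp; lia.
have [|||||_ +] := lattice_exact (N := fun x : L => x \in @homog p C (- k.+1%:Z) /\ hop false x = 0)
  (J := Zker false (- k%:Z)) (d := @bdry p n) _ _ p_gt0 _ _ _ (fixed_lattice kp1) (IH (ltnW kp)).
- split=> [|x y [xj hx] [yj hy]]; first by split; [apply: rpred0|apply: hop0].
  by split; [apply: rpredB|rewrite hopB hx hy subrr].
- exact: Zker_sub.
- by move=> x y _ _; apply: bdryB.
- move=> x [xj hx]; split; first by apply: Zc_bdry; rewrite E'.
  by rewrite -(hop_bdry n_gt0) hx bdry0.
- move=> z [Zz hz]; exists (hop true (cone p_gt0 z)).
    split; last exact: (hop_hop false).
    by apply: grade_hop; have := Zc_cone Zz; rewrite E'.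
  by rewrite (hop_bdry n_gt0) (bdry_coneE Zz); have := hop_divE hz => ->.
rewrite -(g_recursion kp) addnK.
by apply: subquo_iso_ext => x // ; rewrite /Zker /Zc; split=> [[[? ?] ?]|[[? ?] ?]].
Qed.

Lemma invariants_lattice j : lattice (Zker false j) (g p (- j)).
Proof.
have [jp|jp] := boolP (1 - p%:Z <= j <= 0).
  have e : - j = (`|j|%N)%:Z by lia.
  rewrite e; have {1}-> : j = - (`|j|%N)%:Z by lia.
  by apply: invariants_lattice_deg; lia.
have -> : g p (- j) = 0%N.
  rewrite /g; case jE : (- j) => [k|//]; case: ifP => // kp; lia.
exists (fun=> 0); split=> [x y _ _|u|x [Zx _]]; first by rewrite subr0.
  exists 0; first exact: subgroup0 (Zker_sub _ _).
  by apply/rowP => -[].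
by split=> // _; apply: Zc_out Zx jp.
Qed.

(** [Z_j^{C_p} / n Z_j^{C_p} = (Z_j^{C_p} + n Z_j) / n Z_j], because [Z_j] is
    torsion-free. *)
Lemma kernel_nZ_zero j :
  subquo_iso (kernel_nZ false j) (nZ j) (Zmod_pow n (g p (- j))).
Proof.
have := lattice_mod n_gt0 (Zker_sub false j) (invariants_lattice j).
apply: subquo_iso_extend.
- exact: Zker_sub.
- exact: kernel_nZ_sub.
- exact: nZ_sub.
- exact: Zker_kernel.
- by move=> x [u [v [Zu Zv ->]]]; exists u => //; rewrite addrC addKr; exists v.
- move=> x [Zx hx]; split=> [[c [cc _] ->]|[c cc e]]; first by exists c.
  exists c => //; split=> //; apply: (koszul_MnI n_gt0).
  by rewrite -hopMn -e.
Qed.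

End Cycles.
(** * The spectral sequence of the periodic model *)

Section ModelPages.
Variables (p n : nat) (pp : prime p) (p_odd : odd p) (n_gt0 : (0 < n)%N).
Local Notation L := (koszul p n).
Local Notation C := (Cn0 n).
Local Notation X := (model_fcomplex p n_gt0).
Let p_gt0 : (0 < p)%N := prime_gt0 pp.

Definition sng (i : nat) (a : L) : X := fun k => if k == i then a else 0.

Lemma sngE i a : sng i a i = a. Proof. by rewrite /sng eqxx. Qed.
Lemma sng_neq i a k : k != i -> sng i a k = 0. Proof. by rewrite /sng => /negPf ->. Qed.

Lemma sngB i a b : sng i (a - b) = sng i a - sng i b.
Proof. by apply: funext => k; rewrite model_subE /sng; case: eqP; rewrite ?subr0. Qed.

Lemma sng_d i a :
  fd X (sng i a) = sng i.+1 (hop (odd i) a) + sng i (bdry a *+ n *~ (-1) ^+ i).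
Proof.
apply: funext => k; rewrite model_addE [LHS]/(model_d _ k) /model_d.
congr (_ + _).
  case: k => [|k]; first by rewrite sng_neq.
  rewrite /sng eqSS; case: eqP => [->//|_]; exact: hop0.
rewrite /sng; case: eqP => [->//|_].
by rewrite bdry0 mul0rn mul0rz.
Qed.

Lemma model_d0 (x : X) : fd X x 0%N = bdry (x 0%N) *+ n.
Proof. by rewrite [LHS]/(model_d _ _) /model_d add0r expr0 mulr1z. Qed.
Lemma model_dS (x : X) i :
  fd X x i.+1 = hop (odd i) (x i) + bdry (x i.+1) *+ n *~ (-1) ^+ i.+1.
Proof. by []. Qed.

Lemma sng_deg i m a : a \in @homog p C (m - i%:Z) -> fdeg X m (sng i a).
Proof. by move=> am k; rewrite /sng; case: eqP => [->//|_]; apply: rpred0. Qed.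

Lemma sng_fil i s a : (s <= i)%N -> ffil X s (sng i a).
Proof. by move=> si k ks; apply: sng_neq; lia. Qed.

Lemma ffilS i (x : X) : ffil X i x -> x i = 0 -> ffil X i.+1 x.
Proof. by move=> ix xi k; rewrite ltnS leq_eqVlt => /orP[/eqP->//|/ix]. Qed.

Lemma sgn_neq0 (a : L) i : a *~ (-1) ^+ i = 0 -> a = 0.
Proof.
move=> a0; have := congr1 (fun c : L => c *~ (-1) ^+ i) a0.
by rewrite -mulrzA -expr2 sqrr_sign mulr1z mul0rz.
Qed.

Lemma sgnMn (a : L) i : a *+ n *~ (-1) ^+ i = a *~ (-1) ^+ i *+ n.
Proof. by rewrite !pmulrn mulrzAC. Qed.

Lemma sgn_sgn (a : L) i : a *~ (-1) ^+ i *~ (-1) ^+ i = a.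
Proof. by rewrite -mulrzA -expr2 sqrr_sign mulr1z. Qed.

Lemma sgn_sgnMn (a : L) i : a *~ (-1) ^+ i *+ n *~ (-1) ^+ i = a *+ n.
Proof. by rewrite -sgnMn sgn_sgn. Qed.

Lemma bdry_n_neq0 (a : L) i : bdry a *+ n *~ (-1) ^+ i = 0 -> bdry a = 0.
Proof. by move/sgn_neq0/(koszul_MnI n_gt0). Qed.

Lemma ffil_d_lead i (x : X) : ffil X i x -> ffil X i.+1 (fd X x) -> bdry (x i) = 0.
Proof.
move=> ix dx; apply: (@bdry_n_neq0 _ i); have := dx i (leqnn _).
case: i ix {dx} => [|i] ix; first by rewrite model_d0 expr0 mulr1z.
by rewrite model_dS (ix i) // hop0 add0r.
Qed.

Lemma fdeg_Zc i m (x : X) : fdeg X m x -> ffil X i x -> ffil X i.+1 (fd X x) ->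
  Zc (m - i%:Z) (x i).
Proof. by move=> mx ix dx; split; [apply: mx|apply: ffil_d_lead]. Qed.

Lemma ssZ_numer2 r i j (x : X) : (1 < r)%N -> ssZ r i (i%:Z + j) x ->
  numer2 (odd i) j (x i).
Proof.
move=> r1 [mx ix dx]; have E : i%:Z + j - i%:Z = j by lia.
have E1 : i%:Z + j - i.+1%:Z = j - 1 by lia.
have := fdeg_Zc mx ix; rewrite E => Zx; split; first by apply/Zx/ffilW/dx; lia.
exists (bdry (x i.+1) *~ (-1) ^+ i).
  by apply: ZcMz; apply: (Zc_bdry n_gt0); rewrite -E1; apply: mx.
have /eqP : fd X x i.+1 = 0 by apply: dx; lia.
by rewrite model_dS exprS mulN1r mulrNz subr_eq0 => /eqP ->; rewrite sgnMn.
Qed.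

Lemma ssZ_numer3 i j (x : X) : ssZ 3 i (i%:Z + j) x -> numer3 (odd i) j (x i).
Proof.
move=> Zx; have [Z _] := ssZ_numer2 (isT : (1 < 3)%N) Zx; have [mx ix dx] := Zx.
have E1 : i%:Z + j - i.+1%:Z = j - 1 by lia.
have E2 : i%:Z + j - i.+2%:Z = j - 2 by lia.
split=> //; exists (x i.+1 *~ (-1) ^+ i), (- x i.+2); split.
- by apply: rpredMz; rewrite -E1; apply: mx.
- by rewrite rpredN -E2; apply: mx.
- have /eqP : fd X x i.+1 = 0 by apply: dx; lia.
  by rewrite model_dS exprS mulN1r mulrNz subr_eq0 => /eqP ->; rewrite bdryMz sgnMn.
have /eqP : fd X x i.+2 = 0 by apply: dx; lia.
rewrite model_dS !exprS !mulN1r opprK addr_eq0 => /eqP xE.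
by rewrite hopMz xE mulNrz sgn_sgn bdryN mulNrn.
Qed.

(** A class of [E_2] is represented by its leading part and a chain witnessing
    that it is a cycle, which is the obstruction to surviving further. *)
Lemma numer2_chain i j a c : Zc j a -> Zc j c -> hop (odd i) a = c *+ n ->
  exists x : X, [/\ fdeg X (i%:Z + j) x, ffil X i x, x i = a &
    fd X x = sng i.+2 (hop (odd i.+1) (cone p_gt0 c *~ (-1) ^+ i))].
Proof.
move=> [aj da] cc hc.
exists (sng i a + sng i.+1 (cone p_gt0 c *~ (-1) ^+ i)); split.
- apply: fdegD; apply: sng_deg; first by have -> : i%:Z + j - i%:Z = j by lia.
  have -> : i%:Z + j - i.+1%:Z = j - 1 by lia.
  by apply: rpredMz; apply: (Zc_cone pp cc).
- by apply: ffilD; apply: sng_fil.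
- by rewrite model_addE sngE sng_neq ?addr0 //; lia.
rewrite raddfD !sng_d da mul0rn mul0rz bdryMz (bdry_coneE pp cc) hc.
rewrite exprS mulN1r mulrNz sgn_sgnMn.
move: (hop _ _) (c *+ n) => u v; apply: funext => k; rewrite !model_addE /sng.
by case: (k == i.+1); case: (k == i); case: (k == i.+2);
  rewrite ?addr0 ?add0r ?subrr ?addrN //; abel.
Qed.

Lemma numer2_ssZ i j a : numer2 (odd i) j a ->
  exists2 x : X, ssZ 2 i (i%:Z + j) x & x i = a.
Proof.
move=> [Za [c cc hc]]; have [x [mx ix xi dx]] := numer2_chain Za cc hc.
exists x => //; split=> //; rewrite dx addn2; exact: sng_fil.
Qed.

Lemma kernel_cocycle i j a : kernel_nZ (odd i) j a ->
  exists y : X, [/\ fdeg X (i%:Z + j) y, ffil X i y, fd X y = 0 & y i = a].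
Proof.
move=> [u [v [[[uj du] hu] Zv ->]]]; have E : i%:Z + j - i%:Z = j by lia.
pose w : X := sng i (cone p_gt0 v *~ (-1) ^+ i).
have E1 : i%:Z + j - 1 - i%:Z = j - 1 by lia.
exists (sng i u + fd X w); split.
- apply: fdegD; first by apply: sng_deg; rewrite E.
  by apply: fdeg_pred; apply: sng_deg; rewrite E1; apply: rpredMz; apply: Zc_cone.
- by apply: ffilD; [apply: sng_fil|apply: ffil_d; apply: sng_fil].
- rewrite raddfD fdd addr0 sng_d hu du mul0rn mul0rz.
  by apply: funext => k; rewrite model_addE /sng; do 2!case: eqP; rewrite addr0.
- rewrite model_addE sngE sng_d model_addE sng_neq ?add0r; last by lia.
  rewrite sngE bdryMz (bdry_coneE pp Zv) sgn_sgnMn.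
  by [].
Qed.

(** Once the leading part is a boundary, the rest has higher filtration. *)
Lemma ssB_lead r i m (x : X) : ssZ r i m x ->
  (ssB r i m x <-> exists y, [/\ fdeg X (m - 1) y, ffil X (i.+1 - r) y,
      ffil X i (fd X y) & fd X y i = x i]).
Proof.
move=> [mx ix dx]; split=> [[y [z [[my iy dy] [[mz iz dz] ->]]]]|[y [my iy dy yx]]].
  by exists y; split=> //; rewrite model_addE [z i]iz ?addr0.
exists y, (x - fd X y); do !split=> //.
- by apply: fdegB => //; apply: fdeg_pred.
- apply: ffilS; first exact: ffilB.
  by rewrite model_subE yx subrr.
- by rewrite raddfB fdd subr0.
- by rewrite addrC subrK.
Qed.

Lemma nZ_bdry m (x : L) i : x \in @homog p C (m - 1) -> nZ m (bdry x *+ n *~ (-1) ^+ i).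
Proof.
move=> xm; exists (bdry x *~ (-1) ^+ i); last by rewrite sgnMn.
by apply: ZcMz; apply: (Zc_bdry n_gt0).
Qed.

Lemma ssB_column0 r j (x : X) : (0 < r)%N -> ssZ r 0 j x -> (ssB r 0 j x <-> nZ j (x 0%N)).
Proof.
move=> r0 Zx; rewrite ssB_lead //; split=> [[y [my _ _ <-]]|[c cc xc]].
  rewrite model_d0 -[_ *+ n]mulr1z -(expr0 (-1)); apply: nZ_bdry.
  by have := my 0%N; rewrite subr0.
exists (sng 0 (cone p_gt0 c)); split=> //.
- by apply: sng_deg; rewrite subr0; apply: Zc_cone.
- by rewrite (_ : 1 - r = 0)%N //; lia.
- by rewrite model_d0 sngE (bdry_coneE pp cc).
Qed.

Lemma denom2_chain i j a : denom2 (~~ odd i) j a ->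
  exists y : X, [/\ fdeg X (i.+1%:Z + j - 1) y, ffil X i y,
    ffil X i.+1 (fd X y) & fd X y i.+1 = a].
Proof.
move=> [u [v [[uj du] Zv ->]]].
exists (sng i u + sng i.+1 (cone p_gt0 v *~ (-1) ^+ i.+1)); split.
- apply: fdegD; apply: sng_deg; first by have -> : i.+1%:Z + j - 1 - i%:Z = j by lia.
  have -> : i.+1%:Z + j - 1 - i.+1%:Z = j - 1 by lia.
  by apply: rpredMz; apply: Zc_cone.
- by apply: ffilD; apply: sng_fil.
- rewrite raddfD; apply: ffilD; last by apply: ffil_d; apply: sng_fil.
  rewrite sng_d du mul0rn mul0rz; apply: ffilD; first exact: sng_fil.
  by move=> k _; rewrite /sng; case: eqP.
- rewrite model_dS !model_addE !sngE !sng_neq ?add0r ?addr0 //; try lia.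
  rewrite bdryMz (bdry_coneE pp Zv) sgn_sgnMn.
  by rewrite negbK.
Qed.

Lemma chain_denom2 i j (y : X) : fdeg X (i.+1%:Z + j - 1) y -> ffil X i y ->
  ffil X i.+1 (fd X y) -> denom2 (~~ odd i) j (fd X y i.+1).
Proof.
move=> my iy dy; have := fdeg_Zc my iy dy.
have -> : i.+1%:Z + j - 1 - i%:Z = j by lia.
move=> Zy; rewrite model_dS.
have [|v Zv ->] := @nZ_bdry j (y i.+1) i.+1.
  by have := my i.+1; congr (_ \in @homog _ _ _); lia.
by exists (y i), v; rewrite negbK.
Qed.

Lemma ssB_denom2 i j (x : X) : ssZ 2 i.+1 (i.+1%:Z + j) x ->
  (ssB 2 i.+1 (i.+1%:Z + j) x <-> denom2 (odd i.+1) j (x i.+1)).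
Proof.
move=> Zx; rewrite ssB_lead // subSS subn1 /=.
by split=> [[y [my iy dy <-]]|/denom2_chain//]; apply: chain_denom2.
Qed.

Lemma ssB_column1 j (x : X) : ssZ 3 1 (1 + j) x ->
  (ssB 3 1 (1 + j) x <-> denom2 true j (x 1%N)).
Proof.
move=> Zx; rewrite ssB_lead //.
by split=> [[y [my iy dy <-]]|/(@denom2_chain 0)//]; apply: (@chain_denom2 0).
Qed.

Lemma ssB_denom3 i j (x : X) : ssZ 3 i.+2 (i.+2%:Z + j) x ->
  (ssB 3 i.+2 (i.+2%:Z + j) x <-> denom3 (odd i) j (x i.+2)).
Proof.
move=> Zx; rewrite ssB_lead // !subSS subn0; split.
  move=> [y [my iy dy <-]]; have := fdeg_Zc my iy (ffilW (leqnSn _) dy).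
  have -> : i.+2%:Z + j - 1 - i%:Z = j + 1 by lia.
  move=> Zy; have [|w Zw we] := @nZ_bdry j (y i.+2) i.+2.
    by have := my i.+2; congr (_ \in @homog _ _ _); lia.
  exists (y i *~ (-1) ^+ i), (y i.+1), w; split=> //.
  - exact: ZcMz.
  - by have := my i.+1; congr (_ \in @homog _ _ _); lia.
  - have /eqP := dy i.+1 (leqnn _); rewrite model_dS exprS mulN1r mulrNz subr_eq0.
    by move=> /eqP e; rewrite hopMz e sgn_sgn.
  - by rewrite model_dS we.
move=> [u [v [w [[uj du] vj Zw huv xe]]]].
exists (sng i (u *~ (-1) ^+ i) + sng i.+1 v + sng i.+2 (cone p_gt0 w *~ (-1) ^+ i.+2)).
split.
- apply: fdegD; first apply: fdegD; apply: sng_deg.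
  + by apply: rpredMz; have -> : i.+2%:Z + j - 1 - i%:Z = j + 1 by lia.
  + by have -> : i.+2%:Z + j - 1 - i.+1%:Z = j by lia.
  + have -> : i.+2%:Z + j - 1 - i.+2%:Z = j - 1 by lia.
    by apply: rpredMz; apply: Zc_cone.
- by do 2?apply: ffilD; apply: sng_fil; lia.
- rewrite raddfD; apply: ffilD; last by apply: ffil_d; apply: sng_fil.
  rewrite raddfD !sng_d bdryMz du mul0rz mul0rn mul0rz hopMz huv.
  move=> k ki; rewrite !model_addE /sng exprS mulN1r mulrNz.
  have -> : (k == i.+2) = false by lia.
  by case: (k == i.+1); case: (k == i); rewrite ?addr0 ?add0r ?subrr ?addrN.
- rewrite model_dS !model_addE !sngE !sng_neq ?add0r ?addr0 //; try lia.
  rewrite bdryMz (bdry_coneE pp Zw) sgn_sgnMn.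
  by rewrite xe.
Qed.

Lemma page_lead r i j (N B : L -> Prop) M : subgroup N ->
  (forall x : X, ssZ r i (i%:Z + j) x -> N (x i)) ->
  (forall a, N a -> exists2 x : X, ssZ r i (i%:Z + j) x & x i = a) ->
  (forall x : X, ssZ r i (i%:Z + j) x -> (ssB r i (i%:Z + j) x <-> B (x i))) ->
  B 0 -> subquo_iso N B M -> page X r i j M.
Proof.
move=> sN ZN NZ ZB B0; apply: (@subquo_iso_transfer _ _ _ _ _ _ _ (fun x : X => x i)) => //.
- exact: ssZ_sub.
- by move=> x y _ _; rewrite model_subE subrr.
- by move=> a /NZ[x Zx <-]; exists x => //; rewrite subrr.
Qed.

(** ** Pages *)

Lemma page2_column0 j M : subquo_iso (@numer2 p n false j) (@nZ p n j) M -> page X 2 0 j M.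
Proof.
apply: page_lead.
- exact: numer2_sub.
- by move=> x /(ssZ_numer2 (leqnn 2)).
- by move=> a /(@numer2_ssZ 0).
- by move=> x; rewrite add0r; apply: ssB_column0.
- exact: subgroup0 (nZ_sub _ _ _).
Qed.

Lemma page2_positive i j M : subquo_iso (@numer2 p n (odd i.+1) j) (@denom2 p n (odd i.+1) j) M ->
  page X 2 i.+1 j M.
Proof.
apply: page_lead.
- exact: numer2_sub.
- by move=> x /(ssZ_numer2 (leqnn 2)).
- by move=> a /numer2_ssZ.
- by move=> x; apply: ssB_denom2.
- exact: subgroup0 (denom2_sub _ _ _ _).
Qed.

(** ** Permanent cycles and extensions in general *)

Lemma permanent_of_lead r :
  (forall i j (x : X), ssZ r i (i%:Z + j) x -> exists y : X,
     [/\ fdeg X (i%:Z + j) y, ffil X i y, fd X y = 0 & y i = x i]) ->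
  permanent X r.
Proof.
move=> lead i m x Zx; have E : i%:Z + (m - i%:Z) = m by lia.
have [|y [my iy dy yx]] := lead i (m - i%:Z) x; first by rewrite E.
rewrite E in my; exists y; split=> //; have [_ ix _] := Zx.
by apply: ffilS; [exact: ffilB|rewrite model_subE yx subrr].
Qed.

(** A cocycle is modified by coboundaries column after column, until its
    filtration exceeds the bound which its degree imposes. *)
Lemma vanish_above r i0 m :
  (forall i (x : X), (i0 <= i)%N -> ssZ r i m x -> ssB r i m x) ->
  forall x : X, ssH i0 m x -> ssBH m x.
Proof.
move=> van.
have key (k : nat) : forall i (x : X), (i0 <= i)%N -> m + p%:Z - i%:Z < k%:Z ->
    fdeg X m x -> ffil X i x -> fd X x = 0 -> ssBH m x.
  elim: k => [|k IH] i x i0i mk mx ix dx.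
    have -> : x = 0.
      apply: funext => l; have [li|il] := ltnP l i; first exact: ix.
      by apply: (grade_out (mx l)); lia.
    exact: subgroup0 (ssBH_sub _ _).
  have Zx : ssZ r i m x by split=> //; rewrite dx; apply: ffil_0.
  have [y [my _ iy yx]] := (ssB_lead Zx).1 (van _ _ i0i Zx).
  have : ssBH m (x - fd X y).
    apply: (IH i.+1); rewrite ?raddfB ?dx ?fdd ?subrr //; try lia.
      by apply: fdegB => //; apply: fdeg_pred.
    by apply: ffilS; [apply: ffilB|rewrite model_subE yx subrr].
  move=> bx; rewrite -[x](subrK (fd X y)); apply: subgroupD; [exact: ssBH_sub|exact: bx|].
  by exists y.
move=> x [mx dx [y my ixy]].
rewrite -[x](subrK (fd X y)); apply: subgroupD; [exact: ssBH_sub| |by exists y].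
apply: (key (`|m| + p).+1 i0); rewrite ?raddfB ?dx ?fdd ?subrr //; first by lia.
by apply: fdegB => //; apply: fdeg_pred.
Qed.

Lemma split_kernel0 i m (Q : X -> Prop) : subgroup Q ->
  (forall x : X, ssH i.+1 m x -> Q x) -> ext_split (@ssH X i.+1 m) (@ssH X i m) Q.
Proof.
move=> sQ KQ; exists id; split=> //.
- by move=> x y _ _; rewrite subrr; apply: subgroup0.
- by move=> x _; rewrite subrr; apply: subgroup0 (ssH_sub _ _ _).
Qed.

Lemma split_quotient0 i m (Q : X -> Prop) : subgroup Q ->
  (forall x : X, ssH i m x -> ssH i.+1 m x) -> ext_split (@ssH X i.+1 m) (@ssH X i m) Q.
Proof.
move=> sQ GK; exists (fun=> 0); split.
- by move=> x _; apply: subgroup0 (ssH_sub _ _ _).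
- by move=> x y _ _; rewrite !subr0; apply: subgroup0.
- by move=> x _; apply: subgroup0.
- by move=> x /GK Kx; rewrite sub0r; apply: subgroupN => //; apply: ssH_sub.
Qed.

Lemma split_vanish r i m :
  (forall x : X, ssZ r i m x -> ssB r i m x) -> stepsplits X i m.
Proof.
move=> van; apply: split_quotient0; first exact: ssBH_sub.
move=> x [mx dx [y my ixy]]; split=> //.
have Zxy : ssZ r i m (x - fd X y).
  split=> //; first by apply: fdegB => //; apply: fdeg_pred.
  by rewrite raddfB dx fdd subrr; apply: ffil_0.
have [w [mw _ iw wx]] := (ssB_lead Zxy).1 (van _ Zxy).
exists (y + w); first exact: fdegD.
have -> : x - fd X (y + w) = x - fd X y - fd X w by rewrite fdD opprD addrA.
apply: ffilS; first exact: ffilB.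
by rewrite !model_subE wx model_subE subrr.
Qed.

(** ** Collapse and extensions for [p] prime to [n] *)

Section Coprime.
Hypothesis pn : ~~ (p %| n)%N.

Lemma coprime_vanish i m (x : X) : (0 < i)%N -> ssZ 2 i m x -> ssB 2 i m x.
Proof.
case: i => // i _; have -> : m = i.+1%:Z + (m - i.+1%:Z) by lia.
move=> Zx; apply/ssB_denom2 => //; apply: coprime_denom2 => //.
by apply: coprime_kernel => //; apply: (ssZ_numer2 (leqnn 2)).
Qed.

Lemma coprime_permanent : permanent X 2.
Proof.
apply: permanent_of_lead => i j x Zx; apply: kernel_cocycle.
by apply: coprime_kernel => //; apply: (ssZ_numer2 (leqnn 2)).
Qed.

Lemma coprime_page2 i j :
  page X 2 i j (if i == 0%N then Zmod_pow n (g p (- j)) else zmod0).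
Proof.
case: i => [|i] /=.
  apply: page2_column0; apply: (subquo_iso_ext _ _ (kernel_nZ_zero pp p_odd n_gt0 j)) => // x.
  by split=> [/(kernel_nZ_numer2 n_gt0)|/(coprime_kernel pp n_gt0 pn)].
apply: page2_positive; apply: subquo_iso_zmod0; first exact: numer2_sub.
by move=> x Nx; apply: coprime_denom2 => //; apply: coprime_kernel.
Qed.

Lemma coprime_step i m : stepsplits X i m.
Proof.
case: i => [|i]; last first.
  by apply: (@split_vanish 2) => x; apply: coprime_vanish.
apply: split_kernel0; first exact: ssBH_sub.
by apply: (@vanish_above 2) => i x; apply: coprime_vanish.
Qed.

End Coprime.

(** ** Collapse and extensions for [p] dividing [n] *)

Section Divisible.
Hypothesis pn : (p %| n)%N.

(** In the bottom row the chain witnessing a class of [E_2] lies in the last term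
    of the Koszul complex, which is trivial: in odd columns the whole term
    survives. *)
Definition survivors b j (a : L) : Prop :=
  if b && (j == 1 - p%:Z) then numer2 b j a else kernel_nZ b j a.

Lemma survivors_sub b j : subgroup (survivors b j).
Proof. by rewrite /survivors; case: (_ && _); [apply: numer2_sub|apply: kernel_nZ_sub]. Qed.

Lemma survivors_Zc b j a : survivors b j a -> Zc j a.
Proof.
rewrite /survivors; case: ifP => _; first by case.
move=> [u [v [[Zu _] Zv ->]]]; by apply: ZcD => //; apply: ZcMn.
Qed.

Lemma numer3_survivors b j a : numer3 b j a -> survivors b j a.
Proof.
move=> Na; rewrite /survivors; have [j1|j1] := eqVneq j (1 - p%:Z); last first.
  by rewrite andbF; apply: numer3_kernel.
rewrite andbT; case: b Na => Na; first exact: numer3_numer2.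
by have [Za _] := Na; move: Za; rewrite j1; apply: Zc_kernel_low.
Qed.

Lemma survivors_cocycle i j a : survivors (odd i) j a ->
  exists y : X, [/\ fdeg X (i%:Z + j) y, ffil X i y, fd X y = 0 & y i = a].
Proof.
rewrite /survivors; case: ifP => [/andP[oi /eqP j1]|_]; last exact: kernel_cocycle.
move=> [Za [c cc hc]]; have [y [my iy yi dy]] := numer2_chain Za cc hc.
exists y; split=> //; rewrite dy /= oi hopMz hop_false_fixed ?mul0rz.
  by apply: funext => k; rewrite /sng; case: eqP.
by apply: (koszul_fixed p_gt0 p_odd (Zc_cone pp cc)); apply/orP; right; lia.
Qed.

Lemma divisible_permanent : permanent X 3.
Proof.
apply: permanent_of_lead => i j x Zx; apply: survivors_cocycle.
by apply: numer3_survivors; apply: ssZ_numer3.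
Qed.

Lemma divisible_page2 i j :
  page X 2 i j (if i == 0%N then
      if odd `|j|%N && (1 - p%:Z < j < 0)
      then dsum (Zmod_pow n (g p (- j))) (Zmod p)
      else Zmod_pow n (g p (- j))
    else if 1 - p%:Z <= j <= 0 then Zmod p else zmod0).
Proof.
have K0 := kernel_nZ_zero pp p_odd n_gt0 j.
case: i => [|i] /=.
  apply: page2_column0; case: ifP => [/andP[jo jp]|njo]; first exact: E2_zero_odd.
  apply: (subquo_iso_ext _ _ K0) => // x; split=> [/(kernel_nZ_numer2 n_gt0)//|Nx].
  have [jo|jo] := boolP (odd `|j|%N); last by apply: numer2_even Nx.
  have [Zx _] := Nx; rewrite (Zc_out pp p_odd n_gt0 Zx); last by lia.
  exact: subgroup0 (kernel_nZ_sub _ _ _ _).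
apply: page2_positive; case: ifP => jp; first exact: E2_positive.
apply: subquo_iso_zmod0; first exact: numer2_sub.
move=> x [Zx _]; rewrite (Zc_out pp p_odd n_gt0 Zx) ?jp //.
exact: subgroup0 (denom2_sub _ _ _ _).
Qed.

Lemma page3_lead i j (B : L -> Prop) M :
  (forall x : X, ssZ 3 i (i%:Z + j) x -> (ssB 3 i (i%:Z + j) x <-> B (x i))) ->
  B 0 -> subquo_iso (survivors (odd i) j) B M -> page X 3 i j M.
Proof.
apply: page_lead; first exact: survivors_sub.
- by move=> x /ssZ_numer3 Nx; apply: numer3_survivors; apply: Nx.
- move=> a /survivors_cocycle[y [my iy dy yi]]; exists y => //.
  by split=> //; rewrite dy; apply: ffil_0.
Qed.

(** The positions of the nonzero terms of [E_3] outside of column [0]. *)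
Definition E3_row (i : nat) j :=
  [|| (j == 0) && ~~ odd i, (j == 1 - p%:Z) && odd i |
      [&& i == 1%N, odd `|j|%N & 2 - p%:Z <= j <= -1]].

Lemma denom3_0 b j : @denom3 p n b j 0.
Proof. by apply: denom2_denom3; apply: subgroup0 (denom2_sub _ _ _ _). Qed.

Lemma divisible_page3 i j :
  page X 3 i j (if i == 0%N then Zmod_pow n (g p (- j))
    else if E3_row i j then Zmod p else zmod0).
Proof.
have pp2 := prime_gt1 pp.
case: i => [|[|i]] /=.
- apply: (page3_lead (B := @nZ p n j)); last exact: kernel_nZ_zero.
    by move=> x; rewrite add0r; apply: ssB_column0.
  exact: subgroup0 (nZ_sub _ _ _).
- apply: (page3_lead (B := @denom2 p n true j)); first exact: ssB_column1.
    exact: subgroup0 (denom2_sub _ _ _ _).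
  have [jp|jp] := boolP (1 - p%:Z <= j <= 0); last first.
    rewrite (_ : E3_row 1 j = false); last by rewrite /E3_row /=; lia.
    apply: subquo_iso_zmod0; first exact: survivors_sub.
    move=> x /survivors_Zc Zx; rewrite (Zc_out pp p_odd n_gt0 Zx jp).
    exact: subgroup0 (denom2_sub _ _ _ _).
  rewrite /survivors /=; have [j1|j1] := eqVneq j (1 - p%:Z).
    rewrite (_ : E3_row 1 j = true); last by rewrite /E3_row j1 eqxx orbT.
    exact: E2_positive.
  apply: kernel_nZ_iso => //; have := tate_degree pp p_odd n_gt0 true jp.
  rewrite (_ : E3_row 1 j = odd `|j|%N); first by case: odd.
  rewrite /E3_row (negPf j1) andbF /=; case: (boolP (odd `|j|%N)) => jo //=; lia.
- apply: (page3_lead (B := @denom3 p n (odd i) j)).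
  + exact: ssB_denom3.
  + exact: denom3_0.
  have -> : odd i.+2 = odd i by rewrite /= negbK.
  have -> : E3_row i.+2 j = (j == 0) && ~~ odd i || (j == 1 - p%:Z) && odd i.
    by rewrite /E3_row /= !negbK orbF.
  move: (odd i) => b.
  have [jp|jp] := boolP (1 - p%:Z <= j <= 0); last first.
    have -> : (j == 0) = false by lia.
    have -> : (j == 1 - p%:Z) = false by lia.
    apply: subquo_iso_zmod0; first exact: survivors_sub.
    move=> x /survivors_Zc Zx; rewrite (Zc_out pp p_odd n_gt0 Zx jp).
    exact: denom3_0.
  rewrite /survivors.
  have [j0|j0] := eqVneq j 0.
    have -> : (j == 1 - p%:Z) = false by lia.
    rewrite andbF /= orbF.
    apply: (subquo_iso_ext (N := @kernel_nZ p n b j) (B := @denom2 p n b j)) => //.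
      move=> x Kx; split; first exact: denom2_denom3.
      apply: denom3_denom2 => //; last by rewrite j0 eqxx.
      by have [u [v [[Zu _] Zv ->]]] := Kx; apply: ZcD => //; apply: ZcMn.
    apply: kernel_nZ_iso => //; have := tate_degree pp p_odd n_gt0 b jp.
    by rewrite j0 /=; case: b.
  have [j1|j1] := eqVneq j (1 - p%:Z); last first.
    rewrite andbF /=; apply: subquo_iso_zmod0; first exact: kernel_nZ_sub.
    by move=> x; apply: kernel_denom3 => //; lia.
  rewrite andbT /=; case: b.
    apply: (subquo_iso_ext (N := @numer2 p n true j) (B := @denom2 p n true j)) => //.
      move=> x [Zx _]; split; first exact: denom2_denom3.
      by apply: denom3_denom2 => //; rewrite j1 eqxx orbT.
    exact: E2_positive.
  apply: subquo_iso_zmod0; first exact: kernel_nZ_sub.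
  by move=> x; apply: kernel_denom3 => //; lia.
Qed.

Lemma divisible_vanish i m (x : X) : (0 < i)%N -> ~~ E3_row i (m - i%:Z) ->
  ssZ 3 i m x -> ssB 3 i m x.
Proof.
case: i => // i _ /negPf nE; have := divisible_page3 i.+1 (m - i.+1%:Z).
rewrite /page nE /= => /subquo_iso_zmod0_sub; rewrite addrC subrK; exact.
Qed.

(** So every extension other than that of column [0] has a trivial kernel or a
    trivial quotient. *)
Lemma E3_row_unique i i' m : (0 < i < i')%N -> E3_row i (m - i%:Z) ->
  ~~ E3_row i' (m - i'%:Z).
Proof. rewrite /E3_row; lia. Qed.

Lemma divisible_step_positive i m : (0 < i)%N -> stepsplits X i m.
Proof.
move=> i0; have [Ei|nEi] := boolP (E3_row i (m - i%:Z)); last first.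
  by apply: (@split_vanish 3) => x; apply: divisible_vanish.
apply: split_kernel0; first exact: ssBH_sub.
apply: (@vanish_above 3) => i' x ii'; apply: divisible_vanish; first by lia.
by apply: E3_row_unique Ei; lia.
Qed.

(** The Tate group of invariants vanishes in an odd row, so that [e] is [n] times a
    norm, which is the boundary of a norm. *)
Lemma invariant_cobound j e : 1 - p%:Z <= j <= 0 -> odd `|j|%N ->
  Zker false j e -> nZ j e -> ssBH j (sng 0 e : X).
Proof.
move=> jp jo [Ze he] [c cc ec].
have hc : hop false c = 0 by apply: (koszul_MnI n_gt0); rewrite -hopMn -ec.
have [c' cc' cE] : Zim true j c.
  by apply: (tate_vanish pp p_odd n_gt0 (b := false) jp); rewrite ?jo.
exists (sng 0 (hop true (cone p_gt0 c'))).
  by apply: sng_deg; rewrite subr0; apply: grade_hop; apply: Zc_cone.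
have h0 : hop false (hop true (cone p_gt0 c')) = 0 by apply: (hop_hop false).
rewrite sng_d h0 (hop_bdry n_gt0) (bdry_coneE pp cc') -cE -ec mulr1z.
by apply: funext => k; rewrite model_addE /sng; do 2!case: eqP; rewrite add0r.
Qed.

Lemma ssH0_cocycle m (x : X) : fdeg X m x -> fd X x = 0 -> ssH 0 m x.
Proof. by move=> mx dx; split=> //; exists 0; [apply: fdeg0|apply: ffil0]. Qed.

Lemma cocycle_kernel m (x : X) : ssH 0 m x -> kernel_nZ false m (x 0%N).
Proof.
move=> [mx dx _].
have Zx : ssZ 3 0 (0%:Z + m) x.
  by rewrite add0r; split=> //; rewrite dx; apply: ffil_0.
have := numer3_survivors (ssZ_numer3 Zx); rewrite /survivors /=; exact.
Qed.

Lemma sng0_invariant m u : Zker false m u ->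
  fdeg X m (sng 0 u) /\ fd X (sng 0 u) = 0.
Proof.
move=> [[um du] hu]; split; first by apply: sng_deg; rewrite subr0.
rewrite sng_d hu du mul0rn mul0rz.
by apply: funext => k; rewrite model_addE /sng; do 2!case: eqP; rewrite addr0.
Qed.

Lemma ssH1_nZ m (x : X) : ssH 1 m x -> nZ m (x 0%N).
Proof.
move=> [mx dx [y my xy]].
have -> : x 0%N = fd X y 0%N by apply/subr0_eq; rewrite -[LHS]model_subE; apply: xy.
rewrite model_d0 -[_ *+ n]mulr1z -(expr0 (-1)); apply: nZ_bdry.
by have := my 0%N; rewrite subr0.
Qed.

Lemma nZ_ssH1 m (x : X) : fdeg X m x -> fd X x = 0 -> nZ m (x 0%N) -> ssH 1 m x.
Proof.
move=> mx dx [c cc xc]; split=> //; exists (sng 0 (cone p_gt0 c)).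
  by apply: sng_deg; rewrite subr0; apply: Zc_cone.
move=> k; rewrite ltnS leqn0 => /eqP ->.
by rewrite model_subE model_d0 sngE (bdry_coneE pp cc) xc subrr.
Qed.

(** The invariant part of the leading term gives a section of the edge map. *)
Lemma odd_step m : 1 - p%:Z <= m <= 0 -> odd `|m|%N -> stepsplits X 0 m.
Proof.
move=> mp mo.
have /choice[u uP] (x : X) : exists u, ssH 0 m x -> Zker false m u /\ nZ m (x 0%N - u).
  have [/cocycle_kernel[u [v [Zu Zv e]]]|nH] := pselect (ssH 0 m x); last by exists 0.
  by exists u => _; split=> //; exists v => //; rewrite e addrC addKr.
have cob e : Zker false m e -> nZ m e -> ssBH m (sng 0 e : X).
  exact: invariant_cobound.
exists (fun x : X => sng 0 (u x)); split.
- move=> x /uP[/sng0_invariant[du hu] _]; exact: ssH0_cocycle.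
- move=> x y Hx Hy; have [Zx nx] := uP _ Hx; have [Zy ny] := uP _ Hy.
  have [Zxy nxy] := uP _ (subgroupB (ssH_sub X 0 m) Hx Hy).
  rewrite -!sngB; apply: cob.
    by do 2?apply: subgroupB => //; exact: Zker_sub.
  have -> : u (x - y) - (u x - u y) =
      ((x 0%N - u x) - (y 0%N - u y)) - ((x - y) 0%N - u (x - y)).
    by rewrite model_subE; abel.
  by do 2?apply: subgroupB => //; exact: nZ_sub.
- move=> x Kx; have Hx : ssH 0 m x by case: Kx => mx dx _; apply: ssH0_cocycle.
  have [Zu nu] := uP _ Hx; apply: cob => //.
  rewrite -[u x](subKr (x 0%N)); apply: subgroupB; [exact: nZ_sub| |exact: nu].
  exact: ssH1_nZ.
- move=> x Hx; have [Zu nu] := uP _ Hx; have [mx dx _] := Hx.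
  have [mu du] := sng0_invariant Zu.
  apply: nZ_ssH1; first exact: fdegB.
    by rewrite fdB du dx subrr.
  rewrite model_subE sngE -opprB; apply: subgroupN => //; exact: nZ_sub.
Qed.

Lemma divisible_step i m :
  ~ (i = 0%N /\ exists j : nat, [/\ odd j, (j <= p - 2)%N & m = 1 - j%:Z]) ->
  stepsplits X i m.
Proof.
have p2 := prime_gt1 pp.
case: i => [|i] nex; last by apply: divisible_step_positive.
have [m0|m0] := ltrP 0 m.
  apply: split_quotient0; first exact: ssBH_sub.
  move=> x Hx; have [mx dx _] := Hx; apply: nZ_ssH1 => //.
  have -> : x 0%N = 0.
    by apply: (grade_out (j := m)); [have := mx 0%N; rewrite subr0|lia].
  exact: subgroup0 (nZ_sub _ _ _).
have [mp|mp] := lerP m (1 - p%:Z).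
  apply: split_kernel0; first exact: ssBH_sub.
  apply: (@vanish_above 3) => i' x i'0; apply: divisible_vanish => //.
  by rewrite /E3_row; lia.
have [mo|me] := boolP (odd `|m|%N); first by apply: odd_step => //; lia.
case: nex; split=> //; exists (`|m|.+1)%N; split; rewrite /= ?me //; lia.
Qed.

(** The class in column [0] of an invariant cycle [a] that is not a norm is killed
    by [n]. If the extension were split, then [n] would also kill one of its lifts
    modulo [F^2]; comparing entries in columns [0] and [1], this makes [a] a
    norm. *)
Lemma even_nonsplit j : odd j -> (j <= p - 2)%N -> ~ lowsplits X (1 - j%:Z).
Proof.
move=> jo jp [s [sG sB sK sE]]; set m := 1 - j%:Z in sG sB sK sE.
have p2 := prime_gt1 pp.
have mp : 1 - p%:Z <= m <= 0 by rewrite /m; lia.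
have [a [[Za ha] na]] : exists a : L, Zker false m a /\ ~ Zim true m a.
  have := tate_degree pp p_odd n_gt0 false mp.
  have -> : false == odd `|m|%N by rewrite /m; lia.
  move=> [f [_ fS fK]]; have [a Za fa] := fS (inZp 1); exists a; split=> //.
  move/(fK a Za); rewrite fa => /(congr1 val) /=.
  by rewrite modn_small // prednK //; lia.
have [mx dx] := sng0_invariant (conj Za ha); set x := sng 0 a in mx dx.
have Hx : ssH 0 m x by apply: ssH0_cocycle.
have sum_s k : ssH 2 m (s (x *+ k) - s x *+ k).
  elim: k => [|k IH].
    rewrite !mulr0n subr0; apply: sK; exact: subgroup0 (ssH_sub _ _ _).
  have Hk : ssH 0 m (x *+ k) by apply: subgroupMn => //; apply: ssH_sub.
  have Hk1 : ssH 0 m (x *+ k.+1) by apply: subgroupMn => //; apply: ssH_sub.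
  have := sB _ _ Hk1 Hx; rewrite {1}mulrSr addrK => h.
  have -> : s (x *+ k.+1) - s x *+ k.+1 =
      (s (x *+ k) - s x *+ k) - (s (x *+ k) - (s (x *+ k.+1) - s x)).
    by rewrite (mulrSr (s x)); abel.
  by apply: subgroupB => //; apply: ssH_sub.
have MnE (y : X) k i : (y *+ k) i = y i *+ k.
  by elim: k => // k IH; rewrite !mulrS -IH.
have Kxn : ssH 1 m (x *+ n).
  apply: nZ_ssH1; [exact: subgroupMn (fdeg_sub _ _) mx|by rewrite raddfMn dx mul0rn|].
  by exists a; rewrite // MnE sngE.
have [_ _ [w1 mw1 w1E]] : ssH 2 m (s x *+ n).
  rewrite -[s x *+ n](subKr (s (x *+ n))); apply: subgroupB; first exact: ssH_sub.
    exact: sK.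
  exact: sum_s.
have [_ _ [w0 mw0 w0E]] := sE x Hx; have [msx dsx _] := sG x Hx.
pose f : X := s x - x - fd X w0; pose w : X := w1 - w0 *+ n.
have mw : fdeg X (m - 1) w.
  by apply: fdegB => //; exact: (subgroupMn n (fdeg_sub X (m - 1)) mw0).
have fE : s x = x + f + fd X w0 by rewrite /f; abel.
have fwE : ffil X 2 (x *+ n + f *+ n - fd X w).
  have -> : x *+ n + f *+ n - fd X w = s x *+ n - fd X w1; last exact: w1E.
  rewrite fdB [fd X (w0 *+ n)]raddfMn fE !mulrnDl; abel.
have aw : a = bdry (w 0%N).
  apply: (koszul_MnI2 n_gt0); rewrite -model_d0; apply/subr0_eq.
  have := fwE 0%N isT; rewrite model_subE model_addE !MnE.
  by rewrite [f 0%N](w0E 0%N isT) mul0rn addr0 [x 0%N]sngE => ->.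
have Zf : Zc (m - 1) (f 1%N).
  apply: (fdeg_Zc (m := m)); rewrite ?/f //.
    by apply: fdegB; [apply: fdegB|apply: fdeg_pred].
  by rewrite !fdB dsx dx fdd !subr0; apply: ffil_0.
pose q := f 1%N + bdry (w 1%N).
have Zq : Zc (m - 1) q.
  apply: ZcD => //; apply: (Zc_bdry n_gt0).
  by have := mw 1%N; congr (_ \in @homog _ _ _).
have hw : hop false (w 0%N) = q *+ n.
  have := fwE 1%N isT; rewrite model_subE model_addE !MnE model_dS.
  rewrite [x 1%N]sng_neq // mul0rn add0r mulrN1z => /subr0_eq fn.
  by rewrite /q mulrnDl fn subrK.
have hq : hop true q = 0 by apply: (hop_MnI n_gt0 hw).
have pq := hop_divE hq.
pose e := w 0%N - hop_div true q *+ (n %/ p).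
have he : hop false e = 0 by rewrite hopB hopMn -pq hw (n_mulp pn) subrr.
have ej : e \in @homog p C (m - 1).
  apply: rpredB; first by have := mw 0%N; rewrite subr0.
  by apply: rpredMn; have [] := Zc_hop_div n_gt0 true Zq.
have m1 : - p%:Z < m - 1 < 0 by lia.
have le := liftE pp ej m1 he.
apply: na; exists (bdry (inner_lift false e)).
  by apply: (Zc_bdry n_gt0); apply: grade_lift.
rewrite -(hop_bdry n_gt0) le /e bdryB bdryMn (bdry_hop_div n_gt0) (proj2 Zq).
by rewrite hop_div0 mul0rn subr0.
Qed.

End Divisible.

End ModelPages.
Theorem theorem5p1 (p n : nat) (W : cpresolution p)
    (hp : prime p) (p_odd : odd p) (n_gt0 : (0 < n)%N) :
  let E := hom_bicomplex W (Dn0 p n) in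
  (~~ (p %| n)%N ->
    (forall (i : nat) (j : int),
       page_iso E 2 i j
         (if i == 0%N then Zmod_pow n (g p (- j)) else zmod0)) /\
    collapses_at E 2 /\
    (forall (i : nat) (m : int), step_split E i m)) /\
  ((p %| n)%N ->
    (forall (i : nat) (j : int),
       page_iso E 2 i j
         (if i == 0%N then
            if odd `|j|%N && (1 - p%:Z < j < 0)
            then dsum (Zmod_pow n (g p (- j))) (Zmod p)
            else Zmod_pow n (g p (- j))
          else if 1 - p%:Z <= j <= 0 then Zmod p else zmod0)) /\
    collapses_at E 3 /\
    (forall (i : nat) (j : int),
       page_iso E 3 i j
         (if i == 0%N then Zmod_pow n (g p (- j))
          else if [|| (j == 0) && ~~ odd i,
                      (j == 1 - p%:Z) && odd i |
                      [&& i == 1%N, odd `|j|%N & 2 - p%:Z <= j <= -1]]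
          then Zmod p else zmod0)) /\
    (forall j : nat, odd j -> (j <= p - 2)%N -> ~ low_split E (1 - j%:Z)) /\
    (forall (i : nat) (m : int),
       ~ (i = 0%N /\
          exists j : nat, [/\ odd j, (j <= p - 2)%N & m = 1 - j%:Z]) ->
       step_split E i m)).
Proof.
move=> E; have EX := hom_model_equiv W (prime_gt0 hp) n_gt0; rewrite -/E in EX.
have XE := filtered_equiv_sym EX.
split=> [pn|pn].
  split; first by move=> i j; apply: (filtered_equiv_page EX) => //; apply: coprime_page2.
  split; last by move=> i m; apply: (filtered_equiv_step EX); apply: coprime_step.
  apply: (@permanent_collapse (tot_fcomplex E)) => //.
  by apply: (filtered_equiv_permanent EX) => //; apply: coprime_permanent.
split; first by move=> i j; apply: (filtered_equiv_page EX) => //; apply: divisible_page2.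
split.
  apply: (@permanent_collapse (tot_fcomplex E)) => //.
  by apply: (filtered_equiv_permanent EX) => //; apply: divisible_permanent.
split; first by move=> i j; apply: (filtered_equiv_page EX) => //; apply: divisible_page3.
split=> [j jo jp low|i m nex].
  by apply: (@even_nonsplit p n hp p_odd n_gt0 pn j) => //; apply: (filtered_equiv_low XE).
by apply: (filtered_equiv_step EX); apply: divisible_step.
Qed.
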